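(* Let $\mathcal{A}_{PLE}^{(\epsilon)}$ be the algorithm ''Private PCA via Lipschitz Extension'' described in the context, with truncation parameter $D$ and approximation error $\gamma$. Then $\mathcal{A}_{PLE}^{(\epsilon)}$ is $(2\epsilon,0)$-node DP. Moreover, let $G\sim SBM(n,2,B,\theta)$ with adjacency matrix $A$, where $B=a_nB_0$, $B_0$ does not depend on $n$, $\frac{50\log n}{n\min_j (B_0)_{jj}}\le a_n=o(1)$, and $(B_0)_{11}=(B_0)_{22}>(B_0)_{12}=(B_0)_{21}$. Let $d=n\cdot\max_{i,j}B_{ij}$ and run the algorithm with $\gamma\asymp 1$. If in addition $D\in[3d,n]$, $d>\sqrt n\log^2 n$, $d=o(n)$, and $D^2\log n<\epsilon<nD^2$, then $$\widetilde{\mathcal L}\left(\mathcal{A}_{PLE}^{(\epsilon)}(G),\theta\right)\precsim \frac{1}{\sqrt d}+\frac{D^2}{\epsilon}<\frac{1}{\log n}$$ with probability at least $1-\frac{1}{\mathrm{poly}(n)}$.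
   Context: Asymptotics: parameters may depend on $n$. $f\precsim g$ means $f(n)\le c_1g(n)$ for all $n\ge c_2$, with constants $c_1,c_2\in(0,\infty)$ not depending on $n$; $f\asymp g$ means $f\precsim g$ and $g\precsim f$. $\mathrm{poly}(n)$ denotes a quantity of order $\Theta(n^\alpha)$ for some constant $\alpha>0$, possibly different at each occurrence. Graphs and privacy: $\mathcal G_n$ is the set of unweighted undirected graphs on $[n]$, identified with their adjacency matrices in $\{0,1\}^{n\times n}$. $d_{node}(G,G')$ is the minimum number of nodes that must be rewired (i.e. whose row/column of the adjacency matrix must be changed) to turn $G'$ into $G$; $G\sim_{node}G'$ if $d_{node}(G,G')\le1$. A randomized algorithm $\mathcal A$ on $\mathcal G_n$ is $(\epsilon,\delta)$-node DP if $\mathbb P(\mathcal A(G)\in S)\le e^{\epsilon}\mathbb P(\mathcal A(G')\in S)+\delta$ for all $G\sim_{node}G'$ and all measurable $S$. Stochastic block model: $\theta\in[k]^n$ is balanced, $|\{i:\theta_i=j\}|=n/k$ for all $j\in[k]$ (here $k=2$). $B\in(0,1]^{k\times k}$ is symmetric and invertible. $A\sim SBM(n,k,B,\theta)$ has independent entries $A_{ij}\sim\mathrm{Ber}(B_{\theta_i,\theta_j})$ for $i<j$, $A_{ji}=A_{ij}$, zero diagonal. Loss: with $C_j=\{i:\theta_i=j\}$ and $S_k$ the permutation group of $[k]$, $\widetilde{\mathcal L}(\hat\theta,\theta)=\min_{\sigma\in S_k}\max_{j\in[k]}\frac{2}{|C_j|}\sum_{i\in C_j}\mathbf 1\{\sigma(\hat\theta_i)\ne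 j\}$. Lipschitz extension: $J_n$ is the $n\times n$ all-ones matrix, $\mathbf 1_n$ the all-ones vector. For a unit vector $v\in\mathbb R^n$ let $s_C(v)=\mathrm{Tr}(C(vv^T+J_n))$. For an adjacency matrix $A$, $\widehat s_{A^2}(v)$ is the optimal value of the linear program: maximize $s_C(v)$ over $C\in\mathbb R^{n\times n}$ subject to $C=C^T$, $0\le C_{ij}\le(A^2)_{ij}$ for all $i,j$, and $\|C\|_\infty\le D^2$, where $\|\cdot\|_\infty$ is the maximum absolute row sum. Algorithm $\mathcal A_{PLE}^{(\epsilon)}$ (input: adjacency matrix $A$ of $G\in\mathcal G_n$, privacy parameter $\epsilon$, truncation parameter $D$, approximation error $\gamma$): (1) Sample $L_\epsilon\sim\mathrm{Lap}(2/\epsilon)$ (Laplace with scale $2/\epsilon$) and set $\widehat\sigma=\max\{0,\min\{\frac{\mathbf 1_n^TA\mathbf 1_n}{n}+L_\epsilon,\,n\}\}$. (2) Sample a unit vector $\hat u_2^0$ with density, with respect to the uniform measure on the unit sphere of $\mathbb R^n$, proportional to $\exp\left(\frac{\epsilon}{6D^2}\left(\widehat s_{A^2}(v)-\frac{\widehat\sigma^2}{n}v^TJ_nv\right)\right)$. (3) Set $\hat u_2=\frac{(I_n-J_n/n)\hat u_2^0}{\|(I_n-J_n/n)\hat u_2^0\|_2}$ and $\hat U=[\mathbf 1_n/\sqrt n,\hat u_2]\in\mathbb R^{n\times2}$. (4) Let $\mathbf M_{n\times2}$ be the set of $n\times 2$ matrices with exactly one $1$ in each row and $0$ otherwise. Find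 $\hat\Theta\in\mathbf M_{n\times2}$, $\hat X\in\mathbb R^{2\times2}$ with $\|\hat\Theta\hat X-\hat U\|_F^2\le(1+\gamma)\inf_{\Theta'\in\mathbf M_{n\times2},X'\in\mathbb R^{2\times2}}\|\Theta'X'-\hat U\|_F^2$. (5) Return $\hat\theta\in[2]^n$ with $\hat\theta_i=\arg\max_{j}\hat\Theta_{ij}$.
   Formalization: The final inequality 1/√d + D²/ε < 1/log n fails when ε is barely above D² log n; it is replaced by: for every η > 0, 1/√d + D²/ε < (1+η)/log n for all large even n. *)

(* Defs.v *)
From HB Require Import structures.
From mathcomp Require Import all_boot all_order all_algebra all_fingroup.
From mathcomp Require Import all_classical all_reals all_analysis.
From mathcomp Require Import measurable_realfun.

Set Implicit Arguments.
Unset Strict Implicit.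
Unset Printing Implicit Defensive.

Import Order.TTheory GRing.Theory Num.Theory.
Import numFieldNormedType.Exports.

Local Open Scope classical_set_scope.
Local Open Scope ring_scope.

Section Asymptotics.
Variable R : realType.
Implicit Types f g p : nat -> R.

Definition lesssim f g :=
  exists2 c : R, 0 < c & \forall n \near \oo, f n <= c * g n.

Definition asymp f g := lesssim f g /\ lesssim g f.

Definition is_poly p :=
  exists2 alpha : R, 0 < alpha & asymp p (fun n => n%:R `^ alpha).

End Asymptotics.

Section Graphs.
Variable n : nat.

Definition is_adjacency (A : 'M[bool]_n) : bool :=
  (A == A^T) && [forall i, ~~ A i i].

Definition graph := {A : 'M[bool]_n | is_adjacency A}.

Definition adjmx (R : realType) (G : graph) : 'M[R]_n :=
  \matrix_(i, j) (val G i j)%:R.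

(* G' can be turned into G by changing only rows and columns indexed by W. *)
Definition rewiring (G G' : graph) (W : {set 'I_n}) : bool :=
  [forall i, forall j, (i \notin W) && (j \notin W) ==>
                       (val G i j == val G' i j)].

(* The default value n of the minimum is harmless: [set: 'I_n] is a rewiring. *)
Definition dnode (G G' : graph) : nat :=
  \big[minn/n]_(W : {set 'I_n} | rewiring G G' W) #|W|.

(* A randomized algorithm with finite output type T is given by the
   probabilities M G S that its output on the input G belongs to S. *)
Definition node_DP (R : realType) (T : finType) (eps delta : R)
    (M : graph -> {set T} -> R) :=
  forall (G G' : graph), (dnode G G' <= 1)%N ->
  forall S : {set T}, M G S <= expR eps * M G' S + delta.

End Graphs.

Section StochasticBlockModel.
Variables (R : realType) (n k : nat).
Implicit Types (B : 'M[R]_k) (theta : {ffun 'I_n -> 'I_k}).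

Definition community theta (j : 'I_k) : {set 'I_n} := [set i | theta i == j].

Definition balanced theta :=
  forall j, #|community theta j|%:R = n%:R / k%:R :> R.

Definition sbm_parameter B :=
  [/\ forall i j, 0 < B i j <= 1, B^T = B & B \in unitmx].

Definition sbm_pmf B theta (G : graph n) : R :=
  \prod_(i < n) \prod_(j < n | (i < j)%N)
    bernoulli_pmf (B (theta i) (theta j)) (val G i j).

(* Probability that the output lies in S when the algorithm M is run on a
   random graph drawn from SBM(n, k, B, theta). *)
Definition sbm_run_prob (T : finType) B theta
    (M : graph n -> {set T} -> R) (S : {set T}) : R :=
  \sum_(G : graph n) sbm_pmf B theta G * M G S.

(* The values under the minimum lie in [0, 2], so the neutral elements 2 and 0
   of the two iterated operators do not affect the result. *)
Definition loss (thetahat theta : {ffun 'I_n -> 'I_k}) : R :=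
  \big[Num.min/2]_(s : 'S_k) \big[Num.max/0]_(j < k)
    (2 / #|community theta j|%:R *
     \sum_(i in community theta j) (s (thetahat i) != j)%:R).

Definition mx_maxentry B : R := \big[Num.max/0]_i \big[Num.max/0]_j B i j.

End StochasticBlockModel.

Section SphereMeasure.
Variable R : realType.
Notation vec n := (n.-tuple (measurableTypeR R)).

Definition tcons n (x : measurableTypeR R * vec n) : vec n.+1 :=
  [tuple of x.1 :: x.2].

Lemma measurable_tcons n : measurable_fun setT (@tcons n).
Proof. exact: (measurable_cons measurable_fst measurable_snd). Qed.

HB.instance Definition _ n :=
  isMeasurableFun.Build _ _ _ _ (@tcons n) (@measurable_tcons n).

(* Standard Gaussian measure on R^n, as an iterated product. *)
Fixpoint std_gaussian (n : nat) : probability (vec n) R :=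
  match n with
  | 0 => dirac ([tuple] : vec 0)
  | m.+1 => distribution (normal_prob (0 : R) 1 \x std_gaussian m)%E (@tcons m)
  end.

Definition tnormalize n (x : vec n) : vec n :=
  [tuple tnth x i / Num.sqrt (\sum_(j < n) tnth x j ^+ 2) | i < n].

Lemma measurable_tnormalize n : measurable_fun setT (@tnormalize n).
Proof.
apply/measurable_fun_tnthP => i /=.
rewrite (_ : _ \o _ = (fun x : vec n => (tnth x i : R) *
   (Num.sqrt (\sum_(j < n) tnth x j ^+ 2)) `^ (-1))); last first.
  by apply/funext => x /=; rewrite tnth_mktuple powR_inv1// sqrtr_ge0.
apply: measurable_funM; first exact: measurable_tnth.
have mS : measurable_fun setT (fun x : vec n => \sum_(j < n) (tnth x j : R) ^+ 2).
  apply: measurable_sum => j; apply: measurable_funX; exact: measurable_tnth.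
have msqrt : measurable_fun setT (@Num.sqrt R).
  apply: continuous_measurable_fun; exact: sqrt_continuous.
exact: (measurableT_comp (measurable_powR _) (measurableT_comp msqrt mS)).
Qed.

HB.instance Definition _ n :=
  isMeasurableFun.Build _ _ _ _ (@tnormalize n) (@measurable_tnormalize n).

(* The uniform measure on the unit sphere of R^n (0 < n), as the law of g / |g|
   for g standard Gaussian: it is carried by the sphere and inherits the
   invariance of the Gaussian measure under orthogonal transformations. *)
Definition sphere_uniform (n : nat) : probability (vec n) R :=
  distribution (std_gaussian n) (@tnormalize n).

Definition colv n (x : vec n) : 'cV[R]_n := \col_i tnth x i.

End SphereMeasure.

Section LipschitzExtension.
Variables (R : realType) (n : nat).
Implicit Types (C M : 'M[R]_n) (v : 'cV[R]_n).

Definition allones : 'M[R]_n := const_mx 1.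

Definition lp_objective C v : R := \tr (C *m (v *m v^T + allones)).

Definition max_row_sum C : R :=
  \big[Num.max/0]_(i < n) \sum_(j < n) @Num.norm R R (C i j).

Definition lp_feasible M (D : R) C :=
  [/\ C = C^T, forall i j, 0 <= C i j <= M i j & max_row_sum C <= D ^+ 2].

Definition lip_ext M (D : R) v : R :=
  sup [set lp_objective C v | C in lp_feasible M D].

End LipschitzExtension.

Section PrivatePCA.
Variables (R : realType) (n : nat).

Definition laplace_pdf (b : R) (x : R) : R := expR (- (`|x| / b)) / (2 * b).

(* The truncated noisy average degree, with L the value of the noise. *)
Definition sigma_hat (A : 'M[R]_n) (L : R) : R :=
  let ones : 'cV[R]_n := const_mx 1 in
  Num.max 0 (Num.min ((ones^T *m A *m ones) 0 0 / n%:R + L) n%:R).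

Definition pca_weight (eps D : R) (A : 'M[R]_n) (sigma : R) (v : 'cV[R]_n) : R :=
  expR (eps / (6 * D ^+ 2) *
        (lip_ext (A *m A) D v
         - sigma ^+ 2 / n%:R * (v^T *m allones R n *m v) 0 0)).

Definition frob2 m p (M : 'M[R]_(m, p)) : R := \sum_i \sum_j M i j ^+ 2.

Definition center_normalize (v : 'cV[R]_n) : 'cV[R]_n :=
  let w := (1%:M - n%:R^-1 *: allones R n) *m v in
  (Num.sqrt (frob2 w))^-1 *: w.

Definition U_hat (v : 'cV[R]_n) : 'M[R]_(n, 2) :=
  row_mx (const_mx (Num.sqrt n%:R)^-1 : 'cV[R]_n) (center_normalize v).

Definition is_membership (Theta : 'M[R]_(n, 2)) :=
  forall i, exists j, row i Theta = delta_mx 0 j.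

Definition kmeans_opt (U : 'M[R]_(n, 2)) : R :=
  inf [set r | exists2 Theta, is_membership Theta &
               exists X : 'M[R]_2, r = frob2 (Theta *m X - U)].

Definition labels (Theta : 'M[R]_(n, 2)) : {ffun 'I_n -> 'I_2} :=
  [ffun i => [arg max_(j > ord0) Theta i j]%O].

Definition kmeans_solver := 'M[R]_(n, 2) -> 'M[R]_(n, 2) * 'M[R]_2.

Definition ple_labels (sol : kmeans_solver) (v : 'cV[R]_n) :=
  labels (sol (U_hat v)).1.

(* sol is the subroutine that finds a (1 + gamma)-approximate k-means solution;
   the measurability clause says that the output of the algorithm is a random
   variable. *)
Definition approx_solver (gamma : R) (sol : kmeans_solver) :=
  [/\ forall U, is_membership (sol U).1,
      forall U, frob2 ((sol U).1 *m (sol U).2 - U) <= (1 + gamma) * kmeans_opt U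
    & forall t, measurable [set x : n.-tuple (measurableTypeR R) |
                            ple_labels sol (colv x) = t]].

(* Conditional probability, given sigma_hat = sigma, that the output is in S. *)
Definition ple_cond_prob (eps D : R) (sol : kmeans_solver) (G : graph n)
    (sigma : R) (S : {set {ffun 'I_n -> 'I_2}}) : R :=
  let w x := pca_weight eps D (adjmx R G) sigma (colv x) in
  (\int[sphere_uniform R n]_(x in [set x | ple_labels sol (colv x) \in S]) w x)
  / (\int[sphere_uniform R n]_x w x).

(* Probability that Private PCA via Lipschitz Extension, with privacy parameter
   eps, truncation parameter D and k-means subroutine sol, outputs on input G a
   label vector in S. *)
Definition ple_prob (eps D : R) (sol : kmeans_solver) (G : graph n)
    (S : {set {ffun 'I_n -> 'I_2}}) : R :=
  \int[lebesgue_measure]_L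
    (laplace_pdf (2 / eps) L
     * ple_cond_prob eps D sol G (sigma_hat (adjmx R G) L) S).

End PrivatePCA.

(* Main.v *)
Require Import Defs.
From HB Require Import structures.
From mathcomp Require Import all_boot all_order all_algebra all_fingroup.
From mathcomp Require Import all_classical all_reals all_analysis.
From mathcomp Require Import measurable_realfun ring lra.

(** The mechanism is private because its sampling step hardly depends on the
    graph.  A feasible matrix C of the linear program is nonnegative with row
    sums at most D^2, so |v^T C v| <= D^2 for every v in the unit ball, and the
    Lipschitz extension varies by at most D^2 around its value at v = 0
    ([lip_ext_osc]).  Hence, for a fixed value of the noisy average degree, the
    posteriors of any two graphs differ by a factor at most
    exp ((eps / (6 D^2)) * 4 D^2) <= e^eps ([cond_prob_ratio]).  Rewiring a node
    moves the average degree by at most 2 ([avg_degree_dnode]), which the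
    Laplace noise of scale 2 / eps hides at the cost of another factor e^eps
    ([smoothed_le]); together this is [ple_prob_DP].

    For the accuracy write A = P + W, where P is the matrix of edge
    probabilities (with its diagonal).  P has the orthonormal eigenvectors e
    (constant) and u (the sign vector of the communities), with eigenvalues
    l1 = n (p + q) / 2 and l2 = n (p - q) / 2.  If all degrees are at most D
    the linear program is solved by A^2 itself, so the sampling density is
    proportional to exp (eps / (6 D^2) * U(v)), with
    U(v) = |A v|^2 - sigma^2 <e, v>^2 ([weight_utility]).  A direct expansion
    shows that U drops quadratically away from the line of u
    ([utility_gap]):

      U(v) <= U(u) - (1 - <u, v>^2) l2^2 / 2 + O(|W u|^2 + |W e|^2),

    as soon as the norm of W is a small multiple of l2 and sigma is close to l1.
    Only the second moments of W u and W e enter the error, and Markov's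
    inequality bounds them by d^(3/2) outside an event of probability
    O(d^(-1/2)) ([expect_noise_vec]).  The norm of W is controlled by
    |W v|^4 <= |W^2|_F^2 for unit v ([operator_norm_frobenius]): the
    off-diagonal entries of W^2 are sums of n independent centred products, and
    the Chernoff bound makes them smaller than a constant times d^2 / n,
    uniformly, precisely because d^2 / n exceeds ln^4 n ([cross_tail]).

    On such a graph a labelling with a large loss comes from a vector v with
    1 - <u, v>^2 > tau, since k-means rounding is stable ([loss_ple_labels]).
    The density of such v is smaller than the density near u by
    exp (- eps / (6 D^2) * (tau l2^2 / 2 - O(d^(3/2)))), while the vectors near
    u have measure at least n^(-5n): the uniform law of the sphere is the law
    of g / |g| for a Gaussian g, and a box of side of order n^(-4) around u is charged at
    least as much as a product of n one-dimensional probabilities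
    ([std_gaussian_box], [cap_mass_lower]).  With
    tau = K (1 / sqrt d + D^2 / eps) the first exponent beats 5 n ln n, because
    (eps / D^2) * d^2 * (D^2 / eps) = d^2 >= n ln^4 n ([posterior_exponent]).
    Integrating over the noise and over the random graph gives
    [sbm_recovery]. *)

Set Implicit Arguments.
Unset Strict Implicit.
Unset Printing Implicit Defensive.

Import Order.TTheory GRing.Theory Num.Theory.
Import numFieldNormedType.Exports.

Local Open Scope classical_set_scope.
Local Open Scope ring_scope.

(** * Inner products and the quadratic utility *)
Section InnerProduct.
Variable R : realFieldType.
Variable n : nat.
Implicit Types (x y z : 'cV[R]_n) (A W : 'M[R]_n).

Definition dotv x y : R := \sum_i x i 0 * y i 0.

Lemma dotvC x y : dotv x y = dotv y x.
Proof. by apply: eq_bigr => i _; rewrite mulrC. Qed.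

Lemma dotvDl x y z : dotv (x + y) z = dotv x z + dotv y z.
Proof. by rewrite -big_split; apply: eq_bigr => i _; rewrite mxE mulrDl. Qed.

Lemma dotvZl a x y : dotv (a *: x) y = a * dotv x y.
Proof. by rewrite mulr_sumr; apply: eq_bigr => i _; rewrite mxE mulrA. Qed.

Lemma dotvDr x y z : dotv z (x + y) = dotv z x + dotv z y.
Proof. by rewrite dotvC dotvDl !(dotvC z). Qed.

Lemma dotvZr a x y : dotv x (a *: y) = a * dotv x y.
Proof. by rewrite dotvC dotvZl (dotvC x). Qed.

Lemma dotvNr x y : dotv x (- y) = - dotv x y.
Proof. by rewrite -scaleN1r dotvZr mulN1r. Qed.

Lemma dotvNl x y : dotv (- x) y = - dotv x y.
Proof. by rewrite -scaleN1r dotvZl mulN1r. Qed.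

Lemma dotv_ge0 x : 0 <= dotv x x.
Proof. by apply: sumr_ge0 => i _; rewrite -expr2 sqr_ge0. Qed.

Lemma dotv0_eq0 x : dotv x x = 0 -> x = 0.
Proof.
move=> /eqP; rewrite psumr_eq0 => [|i _]; last by rewrite -expr2 sqr_ge0.
move=> /allP h; apply/matrixP => i j; rewrite ord1 mxE.
by have /(_ (mem_index_enum i)) := h i; rewrite -expr2 sqrf_eq0 => /eqP.
Qed.

Lemma dotv_mulmxl A x y : dotv (A *m x) y = dotv x (A^T *m y).
Proof.
rewrite /dotv.
under eq_bigr do rewrite mxE mulr_suml.
rewrite exchange_big /=; apply: eq_bigr => j _.
rewrite mxE mulr_sumr; apply: eq_bigr => i _.
by rewrite mxE; ring.
Qed.

Definition dotE := (dotvDl, dotvDr, dotvZl, dotvZr, dotvNl, dotvNr).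

Lemma dotv_CauchySchwarz x y : dotv x y ^+ 2 <= dotv x x * dotv y y.
Proof.
have [y0|ny0] := eqVneq (dotv y y) 0.
  rewrite (dotv0_eq0 y0) -(scale0r 0) !dotvZr; nra.
have yp : 0 < dotv y y by rewrite lt_def ny0 dotv_ge0.
have := dotv_ge0 (dotv y y *: x - dotv x y *: y).
rewrite !dotE (dotvC y x).
set a := dotv x x; set b := dotv x y; set c := dotv y y in yp *.
move=> h; have : 0 <= c * (a * c - b ^+ 2) by lra.
by rewrite pmulr_rge0//; lra.
Qed.

Lemma ler_of_sqr (a b : R) : 0 <= b -> a ^+ 2 <= b ^+ 2 -> a <= b.
Proof. by move=> b0 ab; rewrite leNgt; apply/negP => ba; nra. Qed.

End InnerProduct.

Section Utility.
Variables (R : realFieldType) (n : nat).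
Variables (A W : 'M[R]_n) (e u : 'cV[R]_n) (l1 l2 s om C1 : R).
Hypotheses (ee : dotv e e = 1) (uu : dotv u u = 1) (eu : dotv e u = 0).
Hypothesis Wsym : W^T = W.
Hypothesis AE : forall v, A *m v = (l1 * dotv e v) *: e + (l2 * dotv u v) *: u + W *m v.
Hypothesis Wop : forall v, dotv (W *m v) (W *m v) <= om * dotv v v.
Hypothesis om_l2 : om <= l2 ^+ 2 / 16.
Hypothesis s_l2 : `|l1 ^+ 2 - s ^+ 2| <= l2 ^+ 2 / 8.
Hypothesis l1_l2 : l1 ^+ 2 <= C1 * l2 ^+ 2.
Hypothesis l2_neq0 : l2 != 0.

Definition utility v := dotv (A *m v) (A *m v) - s ^+ 2 * dotv e v ^+ 2.

(** Each linear term of the expansion is a product of a noise vector with a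
    component of v that is orthogonal to u, of size at most sqrt m for
    m = 1 - <u, v>^2, and 2 x y <= x^2 / 8 + 8 y^2 pays it by a fraction of the
    curvature m l2^2.  The only term of order |W u| that is not of this form,
    2 l2 <u, W u>, also occurs in the value at u and cancels. *)
Lemma utility_gap v : dotv v v <= 1 ->
  utility v <= utility u - (1 - dotv u v ^+ 2) * (l2 ^+ 2 / 2)
    + 9 * dotv (W *m u) (W *m u) + 8 * C1 * dotv (W *m e) (W *m e).
Proof.
move=> v1; rewrite /utility.
have l2p : 0 < l2 ^+ 2 by rewrite exprn_even_gt0.
have Wswap x y : dotv x (W *m y) = dotv (W *m x) y.
  by rewrite dotv_mulmxl Wsym.
have eAE x : dotv (A *m x) (A *m x) = (l1 * dotv e x) ^+ 2 + (l2 * dotv u x) ^+ 2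
    + dotv (W *m x) (W *m x) + 2 * (l1 * dotv e x) * dotv (W *m e) x
    + 2 * (l2 * dotv u x) * dotv (W *m u) x.
  rewrite AE !dotE (dotvC u e) ee uu eu -!(dotvC e) -!(dotvC u) !Wswap; ring.
rewrite !eAE eu uu.
set a := dotv e v; set b := dotv u v; set m := 1 - b ^+ 2.
set Ku := dotv (W *m u) (W *m u); set Ke := dotv (W *m e) (W *m e).
set z1 := dotv (W *m e) v; set y := dotv (W *m u) v.
set z := dotv (W *m u) u; set Kv := dotv (W *m v) (W *m v).
have Ku0 : 0 <= Ku := dotv_ge0 _.
have Ke0 : 0 <= Ke := dotv_ge0 _.
have am : a ^+ 2 <= m.
  have := dotv_ge0 (v - a *: e - b *: u).
  rewrite !dotE (dotvC u e) eu ee uu (dotvC v e) (dotvC v u) -/a -/b /m; lra.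
have a0 : 0 <= a ^+ 2 := sqr_ge0 _.
have m0 : 0 <= m by lra.
(* The component along e is penalised like every other deviation from u. *)
have t1 : 2 * (l1 * a) * z1 <= m * l2 ^+ 2 / 8 + 8 * C1 * Ke.
  have z1K : z1 ^+ 2 <= Ke.
    by rewrite (le_trans (dotv_CauchySchwarz _ _))// -[leRHS]mulr1 ler_wpM2l.
  have C0 : 0 <= C1 by rewrite -(pmulr_lge0 _ l2p) (le_trans _ l1_l2)// sqr_ge0.
  have ml0 : 0 <= m * l2 ^+ 2 by rewrite mulr_ge0// ltW.
  have CK0 : 0 <= C1 * Ke by rewrite mulr_ge0.
  apply: ler_of_sqr; first by lra.
  set A1 := m * l2 ^+ 2 / 8; set A2 := 8 * C1 * Ke.
  have h : (2 * (l1 * a) * z1) ^+ 2 <= 4 * A1 * A2.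
    have -> : (2 * (l1 * a) * z1) ^+ 2 = 4 * (l1 ^+ 2 * (a ^+ 2 * z1 ^+ 2)) by ring.
    have -> : 4 * A1 * A2 = 4 * ((C1 * l2 ^+ 2) * (m * Ke)) by rewrite /A1 /A2; field.
    rewrite ler_pM2l//.
    by apply: ler_pM => //; [exact: sqr_ge0|rewrite mulr_ge0 ?sqr_ge0|apply: ler_pM; rewrite ?sqr_ge0].
  have := sqr_ge0 (A1 - A2); lra.
(* The linear terms at v and at u combine into <W u, b v - u>, and
   |b v - u|^2 <= m. *)
have t2 : 2 * l2 * (b * y - z) <= m * l2 ^+ 2 / 8 + 8 * Ku.
  have zK : (b * y - z) ^+ 2 <= Ku * m.
    have -> : b * y - z = dotv (W *m u) (b *: v - u) by rewrite !dotE.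
    rewrite (le_trans (dotv_CauchySchwarz _ _))// ler_wpM2l//.
    rewrite !dotE uu -(dotvC u v) -/b /m.
    have b0 : 0 <= b ^+ 2 := sqr_ge0 _.
    have : b ^+ 2 * dotv v v <= b ^+ 2 by rewrite -[leRHS]mulr1 ler_wpM2l.
    lra.
  have ml0 : 0 <= m * l2 ^+ 2 by rewrite mulr_ge0// ltW.
  apply: ler_of_sqr; first by lra.
  set A1 := m * l2 ^+ 2 / 8; set A2 := 8 * Ku.
  have h : (2 * l2 * (b * y - z)) ^+ 2 <= 4 * A1 * A2.
    have -> : 4 * A1 * A2 = 4 * l2 ^+ 2 * (Ku * m) by rewrite /A1 /A2; field.
    have -> : (2 * l2 * (b * y - z)) ^+ 2 = 4 * l2 ^+ 2 * (b * y - z) ^+ 2 by ring.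
    by rewrite ler_wpM2l// mulr_ge0// ltW.
  have := sqr_ge0 (A1 - A2); lra.
have t3 : Kv <= 2 * Ku + m * l2 ^+ 2 / 8.
  have := dotv_ge0 (W *m (v - b *: u) - W *m (b *: u)).
  have := Wop (v - b *: u).
  rewrite !mulmxBr -!scalemxAr !dotE uu -(dotvC u v) -/b.
  rewrite (dotvC (W *m v) (W *m u)) -/Ku -/Kv.
  have b0 : 0 <= b ^+ 2 := sqr_ge0 _.
  have bK : b ^+ 2 * Ku <= Ku by rewrite -[leRHS]mul1r ler_wpM2r//; rewrite /m in m0; lra.
  have vb : 0 <= dotv v v - b ^+ 2.
    by rewrite subr_ge0 -[leRHS]mul1r -uu (le_trans (dotv_CauchySchwarz _ _)).
  have mm : om * (dotv v v - b ^+ 2) <= m * l2 ^+ 2 / 16.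
    apply: (le_trans (ler_wpM2r vb om_l2)).
    have : l2 ^+ 2 / 16 * (dotv v v - b ^+ 2) <= l2 ^+ 2 / 16 * m.
      by apply: ler_wpM2l; rewrite /m; lra.
    lra.
  nra.
have t4 : a ^+ 2 * (l1 ^+ 2 - s ^+ 2) <= m * l2 ^+ 2 / 8.
  apply: (@le_trans _ _ (a ^+ 2 * (l2 ^+ 2 / 8))).
    by apply: ler_wpM2l => //; apply: le_trans s_l2; exact: ler_norm.
  by rewrite -mulrA ler_wpM2r//; lra.
rewrite /m in t1 t2 t3 t4 *.
lra.
Qed.

End Utility.

(** * Stability of k-means rounding *)
Section Rounding.
Variables (R : realType) (n : nat).
Implicit Types (v : 'cV[R]_n) (theta : {ffun 'I_n -> 'I_2}).

Definition unit_ones : 'cV[R]_n := const_mx (Num.sqrt n%:R)^-1.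

Definition side (j : 'I_2) : R := if j == 0 then 1 else -1.

Definition community_vec theta : 'cV[R]_n :=
  \col_i (side (theta i) / Num.sqrt n%:R).

Lemma labelsE (Theta : 'M[R]_(n, 2)) (X : 'M[R]_2) i k : is_membership Theta ->
  (Theta *m X) i k = X (labels Theta i) k.
Proof.
move=> /(_ i)[j rowj].
have Tij l : Theta i l = (l == j)%:R.
  by have /matrixP/(_ 0 l) := rowj; rewrite !mxE eqxx.
have -> : labels Theta i = j.
  rewrite ffunE; case: arg_maxP => //= l _ /(_ j isT).
  by rewrite !Tij eqxx; case: eqP => // _; rewrite ler10.
rewrite mxE (bigD1 j)//= big1 ?addr0 ?Tij ?eqxx ?mul1r// => l lj.
by rewrite Tij (negPf lj) mul0r.
Qed.

Lemma frob2_ge0 m p (M : 'M[R]_(m, p)) : 0 <= frob2 M.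
Proof. by apply: sumr_ge0 => i _; apply: sumr_ge0 => j _; exact: sqr_ge0. Qed.

Lemma frob2D m p (M N : 'M[R]_(m, p)) : frob2 (M + N) <= 2 * frob2 M + 2 * frob2 N.
Proof.
rewrite /frob2 !mulr_sumr -big_split; apply: ler_sum => i _ /=.
rewrite !mulr_sumr -big_split; apply: ler_sum => j _ /=.
by rewrite mxE; have := sqr_ge0 (M i j - N i j); lra.
Qed.

Lemma frob2N m p (M : 'M[R]_(m, p)) : frob2 (- M) = frob2 M.
Proof. by apply: eq_bigr => i _; apply: eq_bigr => j _; rewrite mxE sqrrN. Qed.

Lemma frob2_cV v : frob2 v = dotv v v.
Proof. by apply: eq_bigr => i _; rewrite big_ord1 expr2. Qed.

Lemma dotv_unit_ones : (0 < n)%N -> dotv unit_ones unit_ones = 1.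
Proof.
move=> n0; rewrite /dotv; under eq_bigr do rewrite !mxE.
rewrite sumr_const card_ord -expr2 exprVn sqr_sqrtr//.
by rewrite -[LHS]mulr_natl mulfV// pnatr_eq0 -lt0n.
Qed.

Lemma side_sqr j : side j ^+ 2 = 1.
Proof. by rewrite /side; case: ifP; rewrite ?sqrrN expr1n. Qed.

Lemma dotv_community_vec theta : (0 < n)%N ->
  dotv (community_vec theta) (community_vec theta) = 1.
Proof.
move=> n0; rewrite -(dotv_unit_ones n0); apply: eq_bigr => i _.
by rewrite !mxE -!expr2 exprMn side_sqr mul1r.
Qed.

Lemma sum_community theta (F : 'I_2 -> R) :
  \sum_i F (theta i) = \sum_j #|community theta j|%:R * F j.
Proof.
rewrite (partition_big theta xpredT)//=; apply: eq_bigr => j _.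
rewrite (eq_bigr (fun=> F j)) => [|i /eqP ->//].
rewrite sumr_const mulr_natl; congr (_ *+ _).
by apply: eq_card => i; rewrite inE.
Qed.

Lemma dotv_ones_community theta : balanced R theta ->
  dotv unit_ones (community_vec theta) = 0.
Proof.
move=> bal; rewrite /dotv.
under eq_bigr do rewrite !mxE.
rewrite (sum_community theta (fun j => (Num.sqrt n%:R)^-1 * (side j / Num.sqrt n%:R))).
rewrite big_ord_recl big_ord1 !bal /side/=.
ring.
Qed.

Lemma dotv_center v : (0 < n)%N ->
  (1%:M - n%:R^-1 *: allones R n) *m v = v - dotv unit_ones v *: unit_ones.
Proof.
move=> n0; rewrite mulmxBl mul1mx -scalemxAl; congr (_ - _).
apply/matrixP => i j; rewrite !mxE ord1 /dotv.
under [in RHS]eq_bigr do rewrite mxE.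
rewrite -mulr_sumr mulrAC -expr2 exprVn sqr_sqrtr//; congr (_ * _).
by apply: eq_bigr => k _; rewrite mxE mul1r.
Qed.

(** Centering removes the component of v along the constant vector, which is
    orthogonal to u, so it changes <u, v> by nothing but the normalisation; the
    sign s is that of <u, v>, as the direction of u is determined up to sign. *)
Lemma center_normalize_close u v : (0 < n)%N ->
  dotv u u = 1 -> dotv unit_ones u = 0 -> dotv v v <= 1 ->
  0 < dotv u v ^+ 2 ->
  exists2 s : R, s ^+ 2 = 1 &
    frob2 (center_normalize v - s *: u) <= 2 * (1 - dotv u v ^+ 2).
Proof.
move=> n0 uu eu v1 uv0; rewrite /center_normalize dotv_center//.
set e := unit_ones in eu *; have ee : dotv e e = 1 := dotv_unit_ones n0.
set w := v - _ *: e.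
have uw : dotv u w = dotv u v by rewrite !dotE (dotvC u e) eu mulr0 subr0.
have ww : dotv w w <= 1.
  rewrite !dotE ee (dotvC v e); have := sqr_ge0 (dotv e v); lra.
have uvw : dotv u v ^+ 2 <= dotv w w.
  by rewrite -uw (le_trans (dotv_CauchySchwarz _ _))// uu mul1r.
clearbody w.
have w0 : 0 < dotv w w by exact: lt_le_trans uvw.
pose c := Num.sqrt (dotv w w).
have c0 : 0 < c by rewrite sqrtr_gt0.
have c2 : c ^+ 2 = dotv w w by rewrite sqr_sqrtr// ltW.
pose s := if 0 <= dotv u v then 1 else -1 : R.
exists s; first by rewrite /s; case: ifP; rewrite ?sqrrN expr1n.
rewrite frob2_cV frob2_cV -/c !dotE uu (dotvC w u) uw.
have c1 : c <= 1 by apply: ler_of_sqr => //; rewrite c2 expr1n.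
have sE : s * dotv u v = `|dotv u v|.
  by rewrite /s; case: ifP => [/ger0_norm ->|]; rewrite ?mul1r// => /negbT;
     rewrite -ltNge mulN1r => /ltW /ler0_norm ->.
have s2 : s * s = 1 by rewrite /s; case: ifP; lra.
have -> : c^-1 * (c^-1 * dotv w w) = 1 by rewrite -c2; field; rewrite gt_eqF.
have uvn : dotv u v ^+ 2 = `|dotv u v| ^+ 2 by rewrite real_normK// num_real.
have nc : `|dotv u v| <= c by apply: ler_of_sqr; [exact: ltW|rewrite c2 -uvn].
have n1 : 0 <= `|dotv u v| by [].
have h : `|dotv u v| ^+ 2 <= c^-1 * `|dotv u v|.
  apply: (@le_trans _ _ `|dotv u v|); first by rewrite expr2 ler_piMl// (le_trans nc).
  by rewrite ler_peMl// invf_ge1.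
rewrite uvn -sE in h *.
set X := s * dotv u v in h *.
lra.
Qed.


Lemma kmeans_opt_le (U : 'M[R]_(n, 2)) (Theta : 'M[R]_(n, 2)) (X : 'M[R]_2) :
  is_membership Theta -> kmeans_opt U <= frob2 (Theta *m X - U).
Proof.
move=> mT; apply: ge_inf; last by exists Theta => //; exists X.
by exists 0 => _ [T _ [Y ->]]; exact: frob2_ge0.
Qed.

Lemma kmeans_opt_ge0 (U : 'M[R]_(n, 2)) : 0 <= kmeans_opt U.
Proof.
have mT : is_membership (\matrix_(i < n, j < 2) (j == 0)%:R : 'M[R]_(n, 2)).
  by move=> i; exists 0; apply/matrixP => ? j; rewrite !mxE (ord1 _) eqxx.
apply: lb_le_inf; last by move=> _ [T _ [Y ->]]; exact: frob2_ge0.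
by exists (frob2 ((\matrix_(i < n, j < 2) (j == 0)%:R : 'M[R]_(n, 2)) *m 0 - U));
  eexists; [exact: mT|exists 0].
Qed.

Definition membership_mx theta : 'M[R]_(n, 2) := \matrix_(i, j) (theta i == j)%:R.

Lemma membership_mxP theta : is_membership (membership_mx theta).
Proof.
by move=> i; exists (theta i); apply/matrixP => ? j; rewrite !mxE ord1 eqxx eq_sym.
Qed.

(** The embedding that an exact eigenvector s * u would produce: it takes one
    value per community, so it is itself a k-means solution ([ideal_UE]). *)
Definition ideal_U s theta : 'M[R]_(n, 2) := row_mx unit_ones (s *: community_vec theta).

Definition ideal_X (s : R) : 'M[R]_2 :=
  \matrix_(j, k) ((if k == 0 then 1 else s * side j) / Num.sqrt n%:R).

Lemma ideal_UE s theta : membership_mx theta *m ideal_X s = ideal_U s theta.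
Proof.
have lab i : labels (membership_mx theta) i = theta i.
  rewrite ffunE; case: arg_maxP => //= l _ /(_ (theta i) isT).
  by rewrite !mxE eqxx; case: eqP => // _; rewrite ler10.
apply/matrixP => i k; rewrite labelsE ?lab; last exact: membership_mxP.
rewrite !mxE; case: splitP => /= j; rewrite ord1 => kj.
  by rewrite (_ : k = 0) ?eqxx ?mxE ?mul1r//; apply: val_inj.
rewrite (_ : k == 0 = false); last by apply/eqP => k0; rewrite k0 in kj.
by rewrite !mxE mulrA.
Qed.

Lemma frob2_row_mxB (x y x' y' : 'cV[R]_n) :
  frob2 (row_mx x y - row_mx x' y') = frob2 (x - x') + frob2 (y - y').
Proof.
rewrite /frob2 -big_split; apply: eq_bigr => i _ /=.
rewrite big_split_ord/=; congr (_ + _); apply: eq_bigr => j _.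
  by rewrite !mxE (unsplitK (inl j)).
by rewrite !mxE (unsplitK (inr j)).
Qed.

(** The ideal centres of the two communities are at distance 2 / sqrt n.  Call
    a node bad if its own centre is at least 1 / sqrt n away from the ideal one:
    at most n E nodes are bad.  Two good nodes of different communities cannot
    share a centre, and each community has a good node because n E < n / 2, so
    the good nodes are classified without error by one permutation. *)
Lemma loss_le_bad theta (t : {ffun 'I_n -> 'I_2}) (x : 'I_2 -> R) (s E : R) :
  (0 < n)%N -> balanced R theta -> s ^+ 2 = 1 ->
  \sum_i (x (t i) - s * side (theta i) / Num.sqrt n%:R) ^+ 2 <= E -> E < 2^-1 ->
  loss R t theta <= 4 * E.
Proof.
move=> n0 bal s2 sumE E2.
have nR : 0 < n%:R :> R by rewrite ltr0n.
have sn : 0 < Num.sqrt n%:R :> R by rewrite sqrtr_gt0.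
(* One distance must be strict for the centres to be separated, so the
   boundary case counts as bad. *)
pose bad i := n%:R^-1 <= (x (t i) - s * side (theta i) / Num.sqrt n%:R) ^+ 2.
have badn : \sum_i (bad i)%:R <= n%:R * E.
  rewrite -ler_pdivrMl// (le_trans _ sumE)// mulr_sumr ler_sum// => i _.
  have [bi|bi] := boolP (bad i); first by rewrite mulr1.
  by rewrite mulr0 sqr_ge0.
have badj j : \sum_(i in community theta j) (bad i)%:R <= n%:R * E.
  rewrite (le_trans _ badn)// [leRHS](bigID (mem (community theta j)))/= lerDl.
  by rewrite sumr_ge0.
have sep i i' : ~~ bad i -> ~~ bad i' -> theta i != theta i' -> t i != t i'.
  rewrite /bad -!ltNge => bi bi' th; apply/eqP => tt; move: bi bi'; rewrite tt.
  set y := x _; set a := s * _ / _; set b := s * _ / _ => h1 h2.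
  have : (a - b) ^+ 2 = 4 * n%:R^-1.
    rewrite /a /b -mulrBl exprMn exprVn sqr_sqrtr// -mulrBr exprMn s2 mul1r.
    congr (_ * _); rewrite /side.
    move: th; case: (theta i) => [[|[|//]] hi]; case: (theta i') => [[|[|//]] hj];
      rewrite -!val_eqE//= => _; lra.
  have : 0 <= (y - a + (y - b)) ^+ 2 := sqr_ge0 _.
  nra.
have good j : exists2 i, theta i = j & ~~ bad i.
  apply/not_exists2P => h.
  have : \sum_(i in community theta j) (bad i)%:R = n%:R / 2 :> R.
    rewrite -(bal j) -sumr_const; apply: eq_bigr => i; rewrite inE => /eqP ti.
    by case: (h i) => // /negP; rewrite negbK => ->.
  have := badj j; have : n%:R * E < n%:R / 2 by rewrite ltr_pM2l.
  lra.
have [i0 ti0 g0] := good 0; have [i1 ti1 g1] := good 1.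
have l01 : t i0 != t i1 by apply: sep => //; rewrite ti0 ti1.
pose sg : 'S_2 := if t i0 == 0 then 1%g else tperm 0 1.
have sg0 : sg (t i0) = 0.
  rewrite /sg; have [->|] := eqVneq (t i0) 0; first by rewrite perm1.
  by case: (t i0) => [[|[|//]] hi]//= _; rewrite (_ : Ordinal hi = 1) ?tpermR//; apply: val_inj.
have sg1 : sg (t i1) = 1.
  have : sg (t i1) != 0 by rewrite -sg0 (inj_eq perm_inj) eq_sym.
  by case: (sg (t i1)) => [[|[|//]] hi]//= _; apply: val_inj.
have goodE i : ~~ bad i -> sg (t i) = theta i.
  move=> gi.
  have [th|th] := eqVneq (theta i) 0.
    have : sg (t i) != 1 by rewrite -sg1 (inj_eq perm_inj) sep// th ti1.
    by rewrite th; case: (sg (t i)) => [[|[|//]] hi]//= _; apply: val_inj.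
  have : sg (t i) != 0 by rewrite -sg0 (inj_eq perm_inj) sep// ti0.
  move: th; case: (sg (t i)) => [[|[|//]] hi]//=; case: (theta i) => [[|[|//]] hi']//= _ _.
  by apply: val_inj.
apply: (le_trans (bigmin_le _ sg _)).
have E0 : 0 <= E by rewrite (le_trans _ sumE)// sumr_ge0// => i _; exact: sqr_ge0.
apply: bigmax_le => [|j _]; first by rewrite mulr_ge0.
rewrite (bal j).
have -> : 2 / (n%:R / 2) = 4 / n%:R :> R by field; rewrite gt_eqF.
rewrite -mulrA ler_pM2l// ler_pdivrMl// (le_trans _ (badj j))// ler_sum// => i.
rewrite inE => /eqP tj; rewrite ler_nat.
have [//|/goodE ->] := boolP (bad i); first by case: (_ != _).
by rewrite tj eqxx.
Qed.

(** The approximate solution is nearly as close to the computed embedding as the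
    ideal one is, so by the triangle inequality it is close to the ideal one. *)
Lemma loss_ple_labels theta (sol : kmeans_solver R n) gamma g v :
  (0 < n)%N -> balanced R theta -> approx_solver gamma sol -> gamma <= g -> -1 <= g ->
  dotv v v <= 1 ->
  let m := 1 - dotv (community_vec theta) v ^+ 2 in
  4 * (2 + g) * m < 2^-1 -> m < 1 ->
  loss R (ple_labels sol v) theta <= 16 * (2 + g) * m.
Proof.
move=> n0 bal [mem apx _] gg g1 v1 m mlt m1; set u := community_vec theta in m mlt m1 *.
have uv0 : 0 < dotv u v ^+ 2 by move: m1; rewrite /m; lra.
have [s s2 close] := center_normalize_close n0 (dotv_community_vec theta n0)
  (dotv_ones_community bal) v1 uv0.
set U := U_hat v; set S := sol U.
have UU : frob2 (ideal_U s theta - U) <= 2 * m.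
  have := frob2_row_mxB unit_ones (s *: u) unit_ones (center_normalize v).
  rewrite -[in X in X = _]/U => E0.
  rewrite [leLHS]E0 subrr.
  rewrite [X in X + _](_ : _ = 0) ?add0r; last first.
    by rewrite /frob2 big1// => i _; rewrite big1// => j _; rewrite mxE expr0n.
  by rewrite -frob2N opprB.
have opt : frob2 (S.1 *m S.2 - U) <= (1 + g) * (2 * m).
  apply: (le_trans (apx U)); apply: (@le_trans _ _ ((1 + g) * kmeans_opt U)).
    by rewrite ler_wpM2r ?kmeans_opt_ge0// lerD2l.
  rewrite ler_wpM2l; [by []|lra|].
  by rewrite (le_trans _ UU)// -ideal_UE; exact/kmeans_opt_le/membership_mxP.
pose E := 4 * (2 + g) * m.
have tot : frob2 (S.1 *m S.2 - ideal_U s theta) <= E.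
  have -> : S.1 *m S.2 - ideal_U s theta
      = (S.1 *m S.2 - U) + - (ideal_U s theta - U) by rewrite opprB addrA subrK.
  apply: (le_trans (frob2D _ _)).
  rewrite frob2N.
  rewrite /E; lra.
have -> : 16 * (2 + g) * m = 4 * E by rewrite /E; ring.
apply: (loss_le_bad (x := fun l => S.2 l 1) n0 bal s2 _ mlt).
apply: le_trans tot; apply: ler_sum => i _.
rewrite big_ord_recl big_ord1; apply: ler_wpDl; first exact: sqr_ge0.
have -> k : (S.1 *m S.2 - ideal_U s theta) i k = S.2 (labels S.1 i) k - ideal_U s theta i k.
  by rewrite mxE [X in _ + X]mxE labelsE//; exact: mem.
rewrite (_ : lift ord0 ord0 = 1); last exact: val_inj.
rewrite -ideal_UE labelsE; last exact: membership_mxP.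
have -> : labels (membership_mx theta) i = theta i.
  rewrite ffunE; case: arg_maxP => //= l _ /(_ (theta i) isT).
  by rewrite !mxE eqxx; case: eqP => // _; rewrite ler10.
by rewrite !mxE.
Qed.

End Rounding.

(** * The Lipschitz extension *)
Section LipExt.
Variables (R : realType) (n : nat).
Implicit Types (C M : 'M[R]_n) (v w : 'cV[R]_n) (D : R).

Definition quad C v : R := \sum_i \sum_j C i j * (v i 0 * v j 0).

Definition entry_sum C : R := \sum_i \sum_j C i j.

Lemma lp_objectiveE C v : lp_objective C v = quad C v + entry_sum C.
Proof.
rewrite /lp_objective /mxtrace /quad /entry_sum -big_split; apply: eq_bigr => i _ /=.
rewrite mxE -big_split; apply: eq_bigr => j _ /=.
by rewrite !mxE big_ord1 !mxE mulrDr mulr1 [v j 0 * _]mulrC.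
Qed.

(** The Schur test for a nonnegative symmetric matrix:
    |v_i v_j| <= (v_i^2 + v_j^2) / 2 turns the form into row sums. *)
Lemma quad_bound M D C v : lp_feasible M D C -> dotv v v <= 1 ->
  `|quad C v| <= D ^+ 2.
Proof.
move=> [Csym Cbd Crow] v1.
have C0 i j : 0 <= C i j by have /andP[] := Cbd i j.
have row i : \sum_j C i j <= D ^+ 2.
  rewrite (le_trans _ Crow)// (le_trans _ (le_bigmax _ _ i))// ler_sum// => j _.
  exact: ler_norm.
apply: (@le_trans _ _ (\sum_i \sum_j C i j * ((v i 0 ^+ 2 + v j 0 ^+ 2) / 2))).
  apply: (le_trans (ler_norm_sum _ _ _)); apply: ler_sum => i _.
  apply: (le_trans (ler_norm_sum _ _ _)); apply: ler_sum => j _.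
  rewrite normrM ger0_norm// ler_wpM2l// normrM.
  have := sqr_ge0 (`|v i 0| - `|v j 0|).
  by rewrite sqrrB !real_normK ?num_real//; lra.
have -> : \sum_i \sum_j C i j * ((v i 0 ^+ 2 + v j 0 ^+ 2) / 2)
    = \sum_i \sum_j C i j * v i 0 ^+ 2.
  have sw : \sum_i \sum_j C i j * v j 0 ^+ 2 = \sum_i \sum_j C i j * v i 0 ^+ 2.
    by rewrite exchange_big; apply: eq_bigr => i _; apply: eq_bigr => j _; rewrite {1}Csym mxE.
  transitivity ((\sum_i \sum_j C i j * v i 0 ^+ 2 + \sum_i \sum_j C i j * v j 0 ^+ 2) / 2).
    rewrite -big_split mulr_suml; apply: eq_bigr => i _ /=.
    rewrite -big_split mulr_suml; apply: eq_bigr => j _ /=; ring.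
  by rewrite sw; lra.
apply: (@le_trans _ _ (\sum_i D ^+ 2 * v i 0 ^+ 2)).
  apply: ler_sum => i _; rewrite -mulr_suml.
  by rewrite ler_wpM2r ?sqr_ge0.
rewrite -mulr_sumr -[leRHS]mulr1 ler_wpM2l ?sqr_ge0//.
Qed.

Section Fixed.
Variables (M : 'M[R]_n) (D : R).
Hypothesis M0 : forall i j, 0 <= M i j.

Lemma lp_feasible0 : lp_feasible M D 0.
Proof.
split=> [|i j|]; first by rewrite trmx0.
  by rewrite mxE lexx M0.
apply: bigmax_le => [|i _]; first exact: sqr_ge0.
by rewrite big1 ?sqr_ge0// => j _; rewrite mxE normr0.
Qed.

Lemma lp_has_sup v : has_sup [set lp_objective C v | C in lp_feasible M D].
Proof.
split; first by exists (lp_objective 0 v), 0; [exact: lp_feasible0|].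
exists (\sum_i \sum_j M i j * (`|v i 0 * v j 0| + 1)) => _ [C [_ Cbd _] <-].
rewrite lp_objectiveE -big_split; apply: ler_sum => i _ /=.
rewrite -big_split; apply: ler_sum => j _ /=.
have /andP[C0 CM] := Cbd i j.
rewrite -[X in _ + X]mulr1 -mulrDr.
apply: (@le_trans _ _ (C i j * (`|v i 0 * v j 0| + 1))).
  by rewrite ler_wpM2l// lerD2r ler_norm.
by rewrite ler_wpM2r// addr_ge0.
Qed.

Lemma lp_objective_le C v : lp_feasible M D C -> lp_objective C v <= lip_ext M D v.
Proof. by move=> fC; apply: sup_upper_bound; [exact: lp_has_sup|exists C]. Qed.

Lemma lip_ext_le v (x : R) :
  (forall C, lp_feasible M D C -> lp_objective C v <= x) -> lip_ext M D v <= x.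
Proof.
move=> h; apply: ge_sup; first by have [] := lp_has_sup v.
by move=> _ [C fC <-]; exact: h.
Qed.

(** At v = 0 the objective is the sum of the entries of C, and at v it differs
    from it by a quadratic form that [quad_bound] controls for all C at once. *)
Lemma lip_ext_osc v : dotv v v <= 1 ->
  `|lip_ext M D v - lip_ext M D 0| <= D ^+ 2.
Proof.
move=> v1; rewrite ler_norml; apply/andP; split.
  rewrite lerNl opprB lerBlDr; apply: lip_ext_le => C fC.
  have := lp_objective_le v fC; have := quad_bound fC v1.
  rewrite !lp_objectiveE ler_norml => /andP[q1 q2].
  have -> : quad C 0 = 0.
    by rewrite /quad big1// => i _; rewrite big1// => j _; rewrite !mxE !mulr0.
  lra.
rewrite lerBlDr; apply: lip_ext_le => C fC.
have := lp_objective_le 0 fC; have := quad_bound fC v1.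
rewrite !lp_objectiveE ler_norml => /andP[q1 q2].
have -> : quad C 0 = 0.
  by rewrite /quad big1// => i _; rewrite big1// => j _; rewrite !mxE !mulr0.
lra.
Qed.

Lemma lip_ext_lipschitz v w :
  lip_ext M D v <= lip_ext M D w + \sum_i \sum_j M i j * `|v i 0 * v j 0 - w i 0 * w j 0|.
Proof.
apply: lip_ext_le => C fC.
apply: (@le_trans _ _ (lp_objective C w
   + \sum_i \sum_j M i j * `|v i 0 * v j 0 - w i 0 * w j 0|)); last first.
  by rewrite lerD2r lp_objective_le.
rewrite !lp_objectiveE addrAC lerD2r -lerBlDl /quad -sumrB.
apply: ler_sum => i _; rewrite -sumrB; apply: ler_sum => j _.
have [_ /(_ i j)/andP[C0 CM] _] := fC.
rewrite -mulrBr; apply: (le_trans (ler_norm _)); rewrite normrM (ger0_norm C0).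
by rewrite ler_wpM2r.
Qed.

(** In the unit ball the coefficient v_i v_j + 1 of C_ij is nonnegative, so the
    largest admissible matrix is optimal once the row constraint allows it. *)
Lemma lip_ext_untruncated v : M^T = M -> (forall i, \sum_j M i j <= D ^+ 2) ->
  dotv v v <= 1 -> lip_ext M D v = quad M v + entry_sum M.
Proof.
move=> Msym Mrow v1; rewrite -lp_objectiveE.
have fM : lp_feasible M D M.
  split=> // [i j|]; first by rewrite M0 lexx.
  apply: bigmax_le => [|i _]; first exact: sqr_ge0.
  by rewrite (le_trans _ (Mrow i))// ler_sum// => j _; rewrite ger0_norm.
apply/eqP; rewrite eq_le lp_objective_le// andbT; apply: lip_ext_le => C [_ Cbd _].
rewrite !lp_objectiveE -!big_split; apply: ler_sum => i _ /=.
rewrite -!big_split; apply: ler_sum => j _ /=.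
rewrite -[X in _ + X]mulr1 -[X in _ <= _ + X]mulr1 -!mulrDr.
have /andP[C0 CM] := Cbd i j; rewrite ler_wpM2r//.
have vk k : v k 0 ^+ 2 <= 1.
  rewrite (le_trans _ v1)// /dotv (bigD1 k)//= -expr2 lerDl.
  by rewrite sumr_ge0// => l _; rewrite -expr2 sqr_ge0.
have := vk i; have := vk j; have := sqr_ge0 (v i 0 + v j 0); lra.
Qed.

End Fixed.

Lemma quad_sqr_mx C v : C^T = C -> quad (C *m C) v = dotv (C *m v) (C *m v).
Proof.
move=> Csym; rewrite dotv_mulmxl Csym mulmxA /dotv; apply: eq_bigr => i _.
rewrite [X in _ = _ * X]mxE mulr_sumr; apply: eq_bigr => j _; ring.
Qed.

Lemma quad_allones v : (v^T *m allones R n *m v) 0 0 = (\sum_i v i 0) ^+ 2.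
Proof.
rewrite mxE expr2 mulr_sumr; apply: eq_bigr => j _; congr (_ * _).
by rewrite mxE; apply: eq_bigr => i _; rewrite !mxE mulr1.
Qed.

Lemma dotv_unit_ones_sqr v : dotv (unit_ones R n) v ^+ 2 = (\sum_i v i 0) ^+ 2 / n%:R.
Proof.
rewrite /dotv; under eq_bigr do rewrite mxE.
by rewrite -mulr_sumr exprMn exprVn sqr_sqrtr// mulrC.
Qed.

End LipExt.

Section Adjacency.
Variables (R : realType) (n : nat).
Implicit Types G : graph n.

Lemma adjmx_ge0 G i j : 0 <= adjmx R G i j.
Proof. by rewrite mxE. Qed.

Lemma adjmx_sym G : (adjmx R G)^T = adjmx R G.
Proof.
apply/matrixP => i j; rewrite !mxE.
by have /andP[/eqP/matrixP/(_ i j)] := valP G; rewrite !mxE => ->.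
Qed.

Lemma sqr_adjmx_ge0 G i j : 0 <= (adjmx R G *m adjmx R G) i j.
Proof. by rewrite mxE sumr_ge0// => k _; rewrite mulr_ge0 ?adjmx_ge0. Qed.

Lemma sqr_adjmx_le G i j : (adjmx R G *m adjmx R G) i j <= n%:R.
Proof.
rewrite mxE -[in leRHS](card_ord n) -sumr_const; apply: ler_sum => k _.
by rewrite !mxE; case: (val G i k); case: (val G k j); rewrite /= ?(mulr0, mul0r, mulr1).
Qed.

Lemma row_sqr_adjmx G (D : R) : (forall i, \sum_j adjmx R G i j <= D) ->
  forall i, \sum_j (adjmx R G *m adjmx R G) i j <= D ^+ 2.
Proof.
move=> deg i; under eq_bigr do rewrite mxE.
rewrite exchange_big /=.
apply: (@le_trans _ _ (\sum_k adjmx R G i k * D)).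
  by apply: ler_sum => k _; rewrite -mulr_sumr ler_wpM2l ?adjmx_ge0.
have D0 : 0 <= D by rewrite (le_trans _ (deg i))// sumr_ge0// => j _; exact: adjmx_ge0.
by rewrite -mulr_suml expr2 ler_wpM2r.
Qed.

End Adjacency.

(** * Translation invariance and Laplace noise *)
Section LebesgueShift.
Variable R : realType.
Notation mu := (@lebesgue_measure R).
Local Open Scope ereal_scope.

Definition shift_by (c : R) : measurableTypeR R -> measurableTypeR R :=
  fun x => (x + c)%R.

Lemma measurable_shift_by c : measurable_fun setT (shift_by c).
Proof. exact: measurable_funD. Qed.

Lemma lebesgue_measure_shift (c : R) (A : set (measurableTypeR R)) : measurable A ->
  pushforward mu (shift_by c) A = mu A.
Proof.
move=> mA; apply/esym.
apply: (@lebesgue_measure_unique R (measure_function_pushforward__canonical__measure_function_Measure mu (measurable_shift_by c))) => // _ [[a b]] _ <- /=.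
have -> : pushforward mu (shift_by c) `]a, b]
    = mu [set` `](a - c)%R, (b - c)%R]].
  rewrite /pushforward; congr (mu _).
  by apply/seteqP; split => x /=; rewrite !in_itv/= ltrBlDr lerBrDr.
rewrite !lebesgue_measure_itv/= !lte_fin ltrD2r; case: ifP => // _.
by rewrite -!EFinB; congr EFin; ring.
Qed.

(** The substitution of a translation, through the uniqueness of the Lebesgue
    measure as a measure with given values on half-open intervals. *)
Lemma ge0_integral_shift (c : R) (f : R -> \bar R) : measurable_fun setT f ->
  (forall x, 0 <= f x) -> \int[mu]_x f (x + c)%R = \int[mu]_x f x.
Proof.
move=> mf f0.
have := @ge0_integral_pushforward _ _ _ _ R _ (measurable_shift_by c) mu setT f measurableT mf.
move=> /(_ (fun y _ => f0 y)) <-.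
apply: eq_measure_integral => [|mp A mA _]; first exact: measurable_shift_by.
exact: lebesgue_measure_shift.
Qed.

Lemma ge0_integral_opp (f : R -> \bar R) : measurable_fun setT f ->
  (forall x, 0 <= f x) -> \int[mu]_x f (- x)%R = \int[mu]_x f x.
Proof.
move=> mf f0.
have mN : measurable_fun setT (-%R : measurableTypeR R -> measurableTypeR R) by [].
have := @ge0_integral_pushforward _ _ _ _ R _ mN mu setT f measurableT mf.
move=> /(_ (fun y _ => f0 y)) <-.
apply: eq_measure_integral => A mA _.
exact: lebesgue_measureN.
Qed.

End LebesgueShift.

Section Laplace.
Variables (R : realType) (b : R).
Hypothesis b0 : 0 < b.
Notation mu := (@lebesgue_measure R).
Notation lap := (laplace_pdf b).

Lemma laplace_pdf_ge0 x : 0 <= lap x.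
Proof. by rewrite /laplace_pdf divr_ge0 ?expR_ge0// mulr_ge0// ltW. Qed.

Lemma measurable_laplace_pdf : measurable_fun setT lap.
Proof.
apply: measurable_funM => //; apply: measurableT_comp => //.
apply: measurableT_comp => //; apply: measurable_funM => //.
Qed.

Lemma laplace_pdf_opp x : lap (- x) = lap x.
Proof. by rewrite /laplace_pdf normrN. Qed.

Lemma laplace_pdf_exponential x : 0 <= x -> lap x = 2^-1 * exponential_pdf b^-1 x.
Proof.
move=> x0; rewrite exponential_pdfE// /laplace_pdf ger0_norm// mulNr [b^-1 * x]mulrC.
by field; rewrite gt_eqF.
Qed.

Lemma laplace_pdf_shift x c : lap (x + c) <= expR (`|c| / b) * lap x.
Proof.
rewrite /laplace_pdf mulrA ler_pM2r ?invr_gt0 ?mulr_gt0// -expRD ler_expR.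
have tri : `|x| <= `|x + c| + `|c| by rewrite -{1}(addrK c x) (le_trans (ler_normB _ _)).
rewrite -subr_ge0 (_ : _ - _ = (`|x + c| + `|c| - `|x|) / b); last by ring.
by rewrite divr_ge0 ?subr_ge0// ltW.
Qed.

Lemma laplace_itv01 : (\int[mu]_(x in `[0%R, 1%R]) (lap x)%:E
  = (2^-1 * (1 - expR (- b^-1)))%:E)%E.
Proof.
transitivity (\int[mu]_(x in `[0%R, 1%R]) (2^-1%:E * (exponential_pdf b^-1 x)%:E))%E.
  apply: eq_integral => x; rewrite inE/= in_itv/= => /andP[x0 _].
  by rewrite laplace_pdf_exponential// EFinM.
rewrite ge0_integralZl_EFin//; last 2 first.
- by move=> x _; rewrite lee_fin exponential_pdf_ge0// invr_ge0 ltW.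
- apply/measurable_EFinP; apply: measurable_funTS; exact: measurable_exponential_pdf.
have := @exponential_prob_itv0c R b^-1 1 ltr01; rewrite /exponential_prob => ->.
by rewrite mulr1 -EFinB -EFinM.
Qed.

(** The mass of [-1, 1] under Laplace noise; with scale 2 / eps the complement
    has the negligible mass exp (- eps / 2). *)
Lemma laplace_itv11 : ((1 - expR (- b^-1))%:E
  <= \int[mu]_(x in `[(-1)%R, 1%R]) (lap x)%:E)%E.
Proof.
have mlap : measurable_fun setT (EFin \o lap) by apply/measurable_EFinP; exact: measurable_laplace_pdf.
have l0 x : (0 <= (lap x)%:E)%E by rewrite lee_fin laplace_pdf_ge0.
have neg : (\int[mu]_(x in `[(-1)%R, 0%R[) (lap x)%:E = (2^-1 * (1 - expR (- b^-1)))%:E)%E.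
  rewrite integral_itv_bndo_bndc; last exact: measurable_funTS.
  rewrite -laplace_itv01 integral_mkcond [RHS]integral_mkcond -[RHS]ge0_integral_opp.
  - apply: eq_integral => x _ /=; rewrite /patch !mem_setE !in_itv/= laplace_pdf_opp.
    by rewrite lerNr lerNl oppr0 andbC.
  - apply/(measurable_restrictT _ _).1; first exact: measurable_itv.
    exact: measurable_funTS.
  - by move=> x; rewrite /patch; case: ifP.
have -> : `[(-1)%R, 1%R]%classic = `[(-1)%R, 0%R[%classic `|` `[0%R, 1%R]%classic :> set R.
  apply/seteqP; split => x /=; rewrite !in_itv/=.
    by move=> /andP[-> ->]; have [|] := leP 0 x; [right|left].
  by case=> /andP[h1 h2]; apply/andP; split; lra.
rewrite ge0_integral_setU//=.
- by rewrite neg laplace_itv01 -EFinD lee_fin; lra.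
- exact: measurable_funTS.
- apply/disj_setPS => x /= []; rewrite !in_itv/= => /andP[_ h1] /andP[h2 _].
  by move: h1; rewrite ltNge h2.
Qed.

Lemma integral_laplace : (\int[mu]_x (lap x)%:E = 1)%E.
Proof.
rewrite ge0_symfun_integralT; [|exact: laplace_pdf_ge0| |by move=> x /=; rewrite laplace_pdf_opp].
  rewrite (_ : (\int[_]_(x in _) _ = 2^-1%:E)%E) -?EFinM ?mulfV//.
  rewrite -[RHS]mule1 -(@integral_exponential_pdf R b^-1) ?invr_gt0//.
  rewrite -ge0_integralZl_EFin//=.
  - rewrite integral_mkcond; apply: eq_integral => x _; rewrite /patch.
    case: ifPn => [/set_mem /= x0|x0]; first by rewrite laplace_pdf_exponential// EFinM.
    rewrite lt0_exponential_pdf ?mule0// ltNge; apply: contra x0 => x0.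
    exact/mem_set.
  - by move=> x _; rewrite lee_fin exponential_pdf_ge0// invr_ge0 ltW.
  - by apply/measurable_EFinP; exact: measurable_exponential_pdf.
move=> x; apply: cvgM; last exact: cvg_cst.
apply: (cvg_comp _ expR); last exact: continuous_expR.
apply: (@cvgN _ R^o); apply: cvgM; last exact: cvg_cst.
exact: norm_continuous.
Qed.

End Laplace.

(** * Measurability and Gaussian boxes *)
Section Boxes.
Variables (R : realType) (n : nat).
Notation vec n := (n.-tuple (measurableTypeR R)).

Definition box (c : 'I_n -> R) (r : R) : set (vec n) :=
  [set x : vec n | forall i, `|(tnth x i : R) - c i| <= r].

Definition open_box (c : 'I_n -> R) (r : R) : set (vec n) :=
  [set x : vec n | forall i, `|(tnth x i : R) - c i| < r].

Lemma measurable_coords (P : 'I_n -> set R) : (forall i, measurable (P i)) ->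
  measurable [set x : vec n | forall i, P i (tnth x i)].
Proof.
move=> mP.
rewrite (_ : [set _ | _] = \bigcap_i ((fun x : vec n => tnth x i) @^-1` P i)).
  apply: fin_bigcap_measurable => // i _; rewrite -[X in measurable X]setTI.
  exact: (measurable_tnth i measurableT (mP i)).
by apply/seteqP; split => x /= h i; [move=> _; exact: h|exact: h].
Qed.

Lemma measurable_box c r : measurable (box c r).
Proof.
apply: (measurable_coords (P := fun i => [set y | `|y - c i| <= r])) => i.
rewrite (_ : [set _ | _] = `[c i - r, c i + r]%classic) //.
by apply/seteqP; split => y /=; rewrite in_itv/= ler_distl.
Qed.

Lemma measurable_open_box c r : measurable (open_box c r).
Proof.
apply: (measurable_coords (P := fun i => [set y | `|y - c i| < r])) => i.
rewrite (_ : [set _ | _] = `]c i - r, c i + r[%classic) //.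
by apply/seteqP; split => y /=; rewrite in_itv/= ltr_distl.
Qed.

(** The superlevel sets of a continuous function are countable unions of boxes
    with rational centres, and boxes are measurable.  The sigma-algebra on
    tuples is the product one, so no topology on tuples is involved. *)
Lemma measurable_of_continuous (f : vec n -> R) :
  (forall x e, 0 < e -> exists2 d : R, 0 < d &
     forall y, (forall i, `|(tnth x i : R) - tnth y i| < d) -> `|f x - f y| < e) ->
  measurable_fun setT f.
Proof.
move=> cf; apply: (measurability _ (RGenOInfty.measurableE R)) => _ [_ [a ->] <-].
rewrite setTI.
set U := _ @^-1` _.
pose cube (p : {ffun 'I_n -> rat} * nat) := open_box (fun i => ratr (p.1 i)) p.2.+1%:R^-1.
rewrite (_ : U = \bigcup_p (if `[< cube p `<=` U >] then cube p else set0)).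
  apply: countable_bigcupT_measurable; first exact: countableP.
  by move=> p; case: ifP => // _; exact: measurable_open_box.
apply/seteqP; split => x; last first.
  by move=> [p _]; case: ifPn => // /asboolP pU /pU.
rewrite /U/= in_itv/= andbT => ax.
have [d d0 hd] := cf x (f x - a) ltac:(by rewrite subr_gt0).
have [k kd] : exists k : nat, 2 * k.+1%:R^-1 < d.
  have d2 : 0 < d / 2 by rewrite divr_gt0.
  have [k _ hk] := near_infty_natSinv_lt (PosNum d2).
  by exists k; rewrite mulrC -ltr_pdivlMr//; exact: (hk k (leqnn _)).
have hq i : exists q : rat, `|(tnth x i : R) - ratr q| < k.+1%:R^-1.
  have kp : 0 < k.+1%:R^-1 :> R by rewrite invr_gt0.
  have lt2 : (tnth x i : R) - k.+1%:R^-1 < (tnth x i : R) + k.+1%:R^-1.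
    by rewrite ltrBlDr -addrA ltrDl addr_gt0.
  have [q] := rat_in_itvoo lt2.
  by rewrite in_itv/= => hq; exists q; rewrite distrC ltr_distl.
exists ([ffun i => projT1 (cid (hq i))], k) => //.
have cx : cube ([ffun i => projT1 (cid (hq i))], k) x.
  by move=> i /=; rewrite ffunE; case: cid.
rewrite asboolT// => y cy; rewrite /U/= in_itv/= andbT.
have : `|f x - f y| < f x - a.
  apply: hd => i; apply: le_lt_trans kd.
  have h1 := cx i; have h2 := cy i; rewrite /= in h1 h2.
  apply: ltW; rewrite mulr_natl mulr2n; apply: le_lt_trans (ltrD h1 h2).
  rewrite [X in _ <= _ + X]distrC; apply: le_trans (ler_normD _ _).
  by rewrite addrA subrK.
by rewrite ltr_norml => /andP[_]; lra.
Qed.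

End Boxes.

Section GaussianBox.
Variable R : realType.
Notation vec n := (n.-tuple (measurableTypeR R)).
Notation mu := (@lebesgue_measure R).

(** A lower bound of the standard normal density on [-2, 2]. *)
Definition gauss_low : R := normal_peak (1 : R) * expR (- 2).

Lemma gauss_low_gt0 : 0 < gauss_low.
Proof. by rewrite mulr_gt0 ?expR_gt0// normal_peak_gt0. Qed.

Lemma normal_prob_itv (c r : R) : `|c| <= 1 -> 0 <= r <= 1 ->
  ((2 * gauss_low * r)%:E <= normal_prob 0 1 [set` `[c - r, c + r]%R])%E.
Proof.
move=> c1 /andP[r0 r1]; rewrite /normal_prob.
apply: (@le_trans _ _ (\int[mu]_(x in [set` `[c - r, c + r]%R]) gauss_low%:E)%E).
  rewrite integral_cst//= lebesgue_measure_itv/= lte_fin.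
  case: ifPn => h; first by rewrite -EFinD -EFinM lee_fin; lra.
  have -> : r = 0 by lra.
  by rewrite !mulr0 mule0.
apply: ge0_le_integral => //.
- by move=> x _; rewrite lee_fin ltW// gauss_low_gt0.
- by apply/measurable_EFinP; apply: measurable_funTS; exact: measurable_normal_pdf.
- move=> x /=; rewrite in_itv/= => /andP[x1 x2]; rewrite lee_fin.
  rewrite normal_pdfE// /gauss_low ler_wpM2l ?normal_peak_ge0// /normal_fun ler_expR.
  rewrite subr0 expr1n; move: c1; rewrite ler_norml => /andP[c1 c2].
  have x4 : (x : R) ^+ 2 <= 4.
    have y1 : 0 <= 2 - (x : R) by lra.
    have y2 : 0 <= 2 + (x : R) by lra.
    have := mulr_ge0 y1 y2; lra.
  by rewrite mulNr lerN2 ler_pdivrMr//; lra.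
Qed.

(** This crude product bound is enough for the exponential mechanism, because the
    price of the cap, n ln n up to a constant, is smaller than the gain d^2. *)
Lemma std_gaussian_box n (c : 'I_n -> R) (r : R) :
  (forall i, `|c i| <= 1) -> 0 <= r <= 1 ->
  (((2 * gauss_low * r) ^+ n)%:E <= std_gaussian R n (box c r))%E.
Proof.
move=> c1 r01; have r0 : 0 <= 2 * gauss_low * r.
  by case/andP: r01 => r0 _; apply: mulr_ge0 => //; apply: mulr_ge0 => //; exact: ltW gauss_low_gt0.
elim: n c c1 => [|n IH] c c1.
  rewrite expr0 /= diracE mem_set//= => -[].
  by [].
rewrite /= /distribution /pushforward.
rewrite (_ : _ @^-1` _ = [set` `[c ord0 - r, c ord0 + r]%R] `*` box (fun i => c (lift ord0 i)) r).
  rewrite product_measure1E//; last exact: measurable_box.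
  rewrite exprS EFinM lee_pmul//= ?lee_fin ?exprn_ge0//; first exact: normal_prob_itv.
  exact: IH.
apply/seteqP; split => -[x y] /=.
  move=> h; split.
    by have := h ord0; rewrite /= in_itv/= ler_distl.
  by move=> i; have := h (lift ord0 i); rewrite /tcons /= tnthS.
rewrite in_itv/= => -[h1 h2] i.
rewrite /tcons /=; case: (unliftP ord0 i) => [j|] ->.
  by rewrite tnthS; exact: h2.
by rewrite ler_distl.
Qed.

End GaussianBox.

(** * The exponential mechanism on the sphere *)
Section FiniteMeasure.
Local Open Scope ring_scope.
Context d (T : measurableType d) (R : realType) (P : probability T R).

Lemma integrable_bounded (f : T -> R) (K : R) : measurable_fun setT f ->
  (forall x, `|f x| <= K) -> P.-integrable setT (EFin \o f).
Proof.
move=> mf fK; apply: (@le_integrable _ _ _ P _ measurableT _ (fun=> K%:E)).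
- exact/measurable_EFinP.
- by move=> x _ /=; rewrite lee_fin (le_trans (fK x))// ler_norm.
- by apply: finite_measure_integrable_cst.
Qed.

Lemma Rintegral_bounded (f : T -> R) (a b : R) : measurable_fun setT f ->
  (forall x, a <= f x <= b) -> a <= \int[P]_x f x <= b.
Proof.
move=> mf fab.
have fi : P.-integrable setT (EFin \o f).
  apply: (@integrable_bounded _ (`|a| + `|b|)) => // x.
  have /andP[h1 h2] := fab x; rewrite ler_norml.
  have := ler_norm a; have := ler_norm (- a); have := ler_norm b; have := ler_norm (-b).
  by rewrite !normrN => *; apply/andP; split; have := normr_ge0 a; have := normr_ge0 b; lra.
have ci (k : R) : P.-integrable setT (EFin \o (fun=> k)).
  exact: finite_measure_integrable_cst.
have cE k : \int[P]_x (fun=> k) x = k :> R.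
  rewrite Rintegral_cst// (_ : fine _ = 1) ?mulr1//.
  exact: (congr1 fine (@probability_setT _ _ _ P)).
apply/andP; split; [rewrite -(cE a)|rewrite -(cE b)];
  by apply: le_Rintegral => // x _; have /andP[] := fab x.
Qed.

End FiniteMeasure.

Section Sphere.
Variables (R : realType) (n : nat).
Notation vec n := (n.-tuple (measurableTypeR R)).
Notation N := (@tnormalize R n).

Lemma dotv_colv (x : vec n) : dotv (colv x) (colv x) = \sum_i (tnth x i : R) ^+ 2.
Proof. by apply: eq_bigr => i _; rewrite !mxE expr2. Qed.

(** Only an inequality: the normalisation sends 0 to 0.  All the later estimates
    hold in the whole unit ball, so this null event needs no separate treatment. *)
Lemma dotv_tnormalize (x : vec n) : dotv (colv (N x)) (colv (N x)) <= 1.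
Proof.
rewrite dotv_colv; under eq_bigr do rewrite tnth_mktuple exprMn.
rewrite -mulr_suml; set s := \sum_i _.
have s0 : 0 <= s by apply: sumr_ge0 => i _; exact: sqr_ge0.
rewrite exprVn sqr_sqrtr//; have [->|sn] := eqVneq s 0; first by rewrite mul0r.
by rewrite mulfV.
Qed.

Lemma Rintegral_sphere (D : set (vec n)) (f : vec n -> R) : measurable D ->
  measurable_fun setT f -> (forall x, 0 <= f x) ->
  \int[sphere_uniform R n]_(x in D) f x =
  \int[std_gaussian R n]_x (f (N x) * (N x \in D)%:R).
Proof.
move=> mD mf f0; rewrite /Rintegral; congr fine.
transitivity (\int[pushforward (std_gaussian R n) N]_(y in D) (f y)%:E)%E; first by [].
rewrite ge0_integral_pushforward//; last 2 first.
- by apply/measurable_EFinP; exact: measurable_funTS.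
- by move=> x _; rewrite lee_fin.
rewrite integral_mkcond; apply: eq_integral => x _; rewrite /patch.
have -> : (x \in N @^-1` D) = (N x \in D) by [].
by case: ifP => _ /=; rewrite ?mulr1 ?mulr0.
Qed.

End Sphere.

Section Posterior.
Variables (R : realType) (n : nat) (eps D gamma : R) (sol : kmeans_solver R n).
Hypotheses (n0 : (0 < n)%N) (eps0 : 0 < eps) (D0 : 0 < D).
Hypothesis solP : approx_solver gamma sol.
Notation vec := (n.-tuple (measurableTypeR R)).
Notation N := (@tnormalize R n).
Notation P := (std_gaussian R n).
Implicit Types (G : graph n) (S : {set {ffun 'I_n -> 'I_2}}).

Definition inv_temp : R := eps / (6 * D ^+ 2).

Lemma inv_temp_ge0 : 0 <= inv_temp.
Proof. by rewrite divr_ge0 ?mulr_ge0 ?sqr_ge0// ltW. Qed.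

Let Asq G := adjmx R G *m adjmx R G.

Lemma measurable_lip_ext G : measurable_fun setT
  (fun x : vec => lip_ext (Asq G) D (colv x)).
Proof.
apply: measurable_of_continuous => x e e0.
have M0 := @sqr_adjmx_ge0 R n G.
pose B := \sum_i `|tnth x i : R|.
have B0 : 0 <= B by apply: sumr_ge0.
pose tot := \sum_i \sum_j Asq G i j.
have tot0 : 0 <= tot by apply: sumr_ge0 => i _; apply: sumr_ge0 => j _.
pose K := tot * (2 * B + 1) + 1.
have K0 : 0 < K by rewrite ltr_wpDl// mulr_ge0// addr_ge0// mulr_ge0.
exists (Num.min 1 (e / K)); first by rewrite lt_min ltr01 divr_gt0.
move=> y hy; set dd := Num.min _ _ in hy.
have dd0 : 0 <= dd by rewrite le_min ler01 divr_ge0// ltW.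
have xB i : `|tnth x i : R| <= B.
  by rewrite /B (bigD1 i)//= lerDl sumr_ge0.
have prod i j : `|colv x i 0 * colv x j 0 - colv y i 0 * colv y j 0| <= dd * (2 * B + 1).
  rewrite !mxE; set xi := tnth x i; set xj := tnth x j; set yi := tnth y i; set yj := tnth y j.
  have -> : (xi : R) * xj - (yi : R) * yj
    = ((xi : R) - yi) * xj + (xj - yj : R) * xi - (xi - yi : R) * (xj - yj : R) by ring.
  apply: (le_trans (ler_normB _ _)); apply: (le_trans (lerD (ler_normD _ _) (lexx _))).
  rewrite !normrM.
  have h1 := ltW (hy i); have h2 := ltW (hy j).
  rewrite -/xi -/yi in h1; rewrite -/xj -/yj in h2.
  have d1 : dd <= 1 by rewrite ge_min lexx.
  have := ler_pM (normr_ge0 _) (normr_ge0 _) h1 (xB j).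
  have := ler_pM (normr_ge0 _) (normr_ge0 _) h2 (xB i).
  have := ler_pM (normr_ge0 _) (normr_ge0 _) h1 (le_trans h2 d1).
  rewrite -/xi -/xj; lra.
have bd : \sum_i \sum_j Asq G i j * `|colv x i 0 * colv x j 0 - colv y i 0 * colv y j 0| < e.
  apply: (@le_lt_trans _ _ (tot * (dd * (2 * B + 1)))).
    rewrite mulr_suml ler_sum// => i _; rewrite mulr_suml ler_sum// => j _.
    by rewrite ler_wpM2l.
  apply: (@le_lt_trans _ _ (e / K * (tot * (2 * B + 1)))).
    rewrite mulrCA ler_wpM2r ?mulr_ge0 ?addr_ge0 ?mulr_ge0//.
    by rewrite ge_min lexx orbT.
  by rewrite mulrAC ltr_pdivrMr// ltr_pM2l// ltrDl.
rewrite ltr_norml; apply/andP; split.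
  have := lip_ext_lipschitz D M0 (colv y) (colv x).
  under eq_bigr do under eq_bigr do rewrite distrC.
  move: bd; set Z := \sum_i _; rewrite -/Asq => bd h.
  have : lip_ext (Asq G) D (colv y) <= lip_ext (Asq G) D (colv x) + Z by exact: h.
  lra.
have := lip_ext_lipschitz D M0 (colv x) (colv y).
move: bd; set Z := \sum_i _ => bd h.
have : lip_ext (Asq G) D (colv x) <= lip_ext (Asq G) D (colv y) + Z by exact: h.
lra.
Qed.

(** The unnormalised density of step (2), read on tuples. *)
Definition weight G (s : R) (x : vec) : R := pca_weight eps D (adjmx R G) s (colv x).

Lemma weightE G s x : weight G s x = expR (inv_temp *
  (lip_ext (Asq G) D (colv x) - s ^+ 2 / n%:R * (\sum_i (tnth x i : R)) ^+ 2)).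
Proof.
rewrite /weight /pca_weight quad_allones; congr (expR (_ * (_ - _ * _ ^+ 2))).
by apply: eq_bigr => i _; rewrite mxE.
Qed.

Lemma measurable_weight_pair G :
  measurable_fun setT (fun p : measurableTypeR R * vec => weight G p.1 p.2).
Proof.
under eq_fun do rewrite weightE.
apply: measurableT_comp => //; apply: measurable_funM => //; apply: measurable_funB.
  exact: (measurableT_comp (measurable_lip_ext G) measurable_snd).
apply: measurable_funM.
  by apply: measurable_funM => //; apply: measurable_funX; exact: measurable_fst.
apply: measurable_funX; apply: measurable_sum => i.
exact: (measurableT_comp (measurable_tnth i) measurable_snd).
Qed.

Lemma measurable_weight G s : measurable_fun setT (weight G s).
Proof.
rewrite (_ : weight G s = (fun p : measurableTypeR R * vec => weight G p.1 p.2)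
  \o (fun x => (s, x)))//.
apply: measurableT_comp; first exact: measurable_weight_pair.
by apply: measurable_fun_pair.
Qed.

Lemma weight_gt0 G s x : 0 < weight G s x.
Proof. exact: expR_gt0. Qed.

Definition in_output S (x : vec) : bool := ple_labels sol (colv x) \in S.

Lemma measurable_output S : measurable [set x | in_output S x].
Proof.
rewrite (_ : [set _ | _] = \bigcup_(t in [set` S]) [set x | ple_labels sol (colv x) = t]).
  apply: fin_bigcup_measurable => [|t _]; first exact: finite_finset.
  by have [_ _] := solP.
apply/seteqP; split => x /=; first by move=> xS; exists (ple_labels sol (colv x)).
by move=> [t tS]; rewrite /in_output => ->.
Qed.

(** Unnormalised posterior mass of S, written on the Gaussian space: there the
    argument of the density is always in the unit ball, not only almost surely. *)
Definition post_mass G (s : R) S : R :=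
  \int[P]_x (weight G s (N x) * (in_output S (N x))%:R).

Lemma ple_cond_probE G s S :
  ple_cond_prob eps D sol G s S = post_mass G s S / post_mass G s [set: _]%SET.
Proof.
rewrite /ple_cond_prob Rintegral_sphere; last 3 first.
- exact: measurable_output.
- exact: measurable_weight.
- by move=> x; exact/ltW/weight_gt0.
congr (_ / _).
- by apply: eq_Rintegral => x _; congr (_ * (nat_of_bool _)%:R); apply/idP/idP => [/set_mem|h]//; apply/mem_set.
- rewrite Rintegral_sphere//; [|exact: measurable_weight|by move=> x; exact/ltW/weight_gt0].
  apply: eq_Rintegral => x _; congr (_ * (nat_of_bool _)%:R).
  by rewrite /in_output finset.in_setT; apply/mem_set.
Qed.

End Posterior.

Section PosteriorBounds.
Variables (R : realType) (n : nat) (eps D gamma : R) (sol : kmeans_solver R n).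
Hypotheses (n0 : (0 < n)%N) (eps0 : 0 < eps) (D0 : 0 < D).
Hypothesis solP : approx_solver gamma sol.
Notation vec := (n.-tuple (measurableTypeR R)).
Notation N := (@tnormalize R n).
Notation P := (std_gaussian R n).
Notation weight := (weight eps D).
Notation post_mass := (post_mass eps D sol).
Notation in_output := (in_output sol).
Notation beta := (inv_temp eps D).
Implicit Types (G : graph n) (S : {set {ffun 'I_n -> 'I_2}}).

(** The largest sum of the entries of a feasible matrix.  It cancels in the
    normalised posterior. *)
Definition lip_ext0 G : R := lip_ext (adjmx R G *m adjmx R G) D 0.

Lemma weight_le G s x : weight G s (N x) <= expR (beta * (lip_ext0 G + D ^+ 2)).
Proof.
rewrite weightE ler_expR ler_wpM2l ?inv_temp_ge0//.
have := lip_ext_osc D (@sqr_adjmx_ge0 R n G) (dotv_tnormalize x).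
rewrite ler_norml => /andP[_ h].
apply: (@le_trans _ _ (lip_ext (adjmx R G *m adjmx R G) D (colv (N x)))).
  by rewrite lerBlDr lerDl mulr_ge0 ?divr_ge0 ?sqr_ge0.
rewrite /lip_ext0; lra.
Qed.

Lemma weight_ratio G G' s x :
  weight G s (N x) <= expR (beta * (lip_ext0 G - lip_ext0 G' + 2 * D ^+ 2)) * weight G' s (N x).
Proof.
rewrite !weightE -expRD ler_expR -mulrDr ler_wpM2l ?inv_temp_ge0//.
have := lip_ext_osc D (@sqr_adjmx_ge0 R n G) (dotv_tnormalize x).
have := lip_ext_osc D (@sqr_adjmx_ge0 R n G') (dotv_tnormalize x).
rewrite -/(lip_ext0 G) -/(lip_ext0 G') !ler_norml => /andP[h1 h2] /andP[h3 h4]; lra.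
Qed.

Lemma measurable_post_integrand G s S :
  measurable_fun setT (fun x => weight G s (N x) * (in_output S (N x))%:R).
Proof.
have h : measurable_fun setT (fun x : vec => weight G s x * (in_output S x)%:R).
  apply: measurable_funM; first exact: measurable_weight.
  rewrite (_ : (fun _ => _) = \1_[set x | in_output S x]).
    by apply: measurable_indic; apply: (measurable_output solP).
  by apply/funext => x; rewrite indicE; congr ((nat_of_bool _)%:R); apply/idP/idP => [h|/set_mem]//; apply/mem_set.
exact: (measurableT_comp h (@measurable_tnormalize R n)).
Qed.

Lemma post_integrand_bounds G s S x :
  0 <= weight G s (N x) * (in_output S (N x))%:R <= expR (beta * (lip_ext0 G + D ^+ 2)).
Proof.
rewrite mulr_ge0 ?(ltW (weight_gt0 _ _ _ _ _))//=.
case: (in_output _ _); rewrite ?mulr1 ?mulr0 ?expR_ge0//.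
exact: weight_le.
Qed.

Lemma post_integrable G s S :
  P.-integrable setT (EFin \o (fun x => weight G s (N x) * (in_output S (N x))%:R)).
Proof.
apply: (@integrable_bounded _ _ _ _ _ (expR (beta * (lip_ext0 G + D ^+ 2)))).
  exact: measurable_post_integrand.
by move=> x; have /andP[h1 h2] := post_integrand_bounds G s S x; rewrite ger0_norm.
Qed.

Lemma post_mass_ge0 G s S : 0 <= post_mass G s S.
Proof. by apply: Rintegral_ge0 => x _; have /andP[] := post_integrand_bounds G s S x. Qed.

Lemma post_mass_ratio G G' s S :
  post_mass G s S <= expR (beta * (lip_ext0 G - lip_ext0 G' + 2 * D ^+ 2)) * post_mass G' s S.
Proof.
rewrite /post_mass -RintegralZl//; last exact: post_integrable.
apply: le_Rintegral => //; first exact: post_integrable.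
  set k := expR _.
  have := integrableZl measurableT k (post_integrable G' s S).
  by apply: eq_integrable => // x _; rewrite /= EFinM.
by move=> x _; rewrite mulrA ler_wpM2r// weight_ratio.
Qed.

Lemma post_massU G s S : post_mass G s [set: _]%SET = post_mass G s S + post_mass G s (~: S)%SET.
Proof.
rewrite /post_mass -RintegralD//; [|exact: post_integrable|exact: post_integrable].
apply: eq_Rintegral => x _; rewrite -mulrDr; congr (_ * _).
by rewrite /in_output !inE; case: (_ \in S); rewrite ?addr0 ?add0r.
Qed.

(** The lower bound on the normalising constant: a box of side 2 r on which the
    density is at least b. *)
Lemma post_mass_box G s (c : 'I_n -> R) (r b : R) : (forall i, `|c i| <= 1) ->
  0 <= r <= 1 -> 0 <= b -> (forall x, box c r x -> b <= weight G s (N x)) ->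
  b * (2 * gauss_low R * r) ^+ n <= post_mass G s [set: _]%SET.
Proof.
move=> c1 r01 b0 hb.
apply: (@le_trans _ _ (\int[P]_x (b * \1_(box c r) x))).
  have mb := @measurable_box R n c r.
  rewrite RintegralZl//; last first.
    apply: (@integrable_bounded _ _ _ _ _ 1); first exact: measurable_indic.
    by move=> x; rewrite indicE; case: (_ \in _); rewrite ?normr1 ?normr0.
  rewrite ler_wpM2l// /Rintegral integral_indic// setIT -lee_fin.
  rewrite fineK; first exact: std_gaussian_box.
  exact: fin_num_measure.
apply: le_Rintegral => //.
- apply: (@integrable_bounded _ _ _ _ _ b).
    by apply: measurable_funM => //; apply: measurable_indic; exact: measurable_box.
  move=> x; rewrite indicE; case: (_ \in _); rewrite ?mulr1 ?mulr0 ?normr0//.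
  by rewrite ger0_norm.
- exact: post_integrable.
move=> x _; rewrite indicE /in_output inE mulr1.
have [/set_mem /hb h|_] := boolP (x \in box c r); first by rewrite mulr1.
by rewrite mulr0 ltW// weight_gt0.
Qed.

Lemma post_massT_gt0 G s : 0 < post_mass G s [set: _]%SET.
Proof.
pose lo := expR (beta * (lip_ext0 G - D ^+ 2 - s ^+ 2 / n%:R * n%:R ^+ 2)).
apply: (@lt_le_trans _ _ (lo * (2 * gauss_low R * 1) ^+ n)).
  by rewrite mulr_gt0 ?expR_gt0// exprn_gt0// mulr1 mulr_gt0// gauss_low_gt0.
apply: (@post_mass_box _ _ (fun=> 0)); rewrite ?normr0 ?ler01 ?lexx ?expR_ge0//.
move=> x _; rewrite weightE /lo ler_expR ler_wpM2l ?inv_temp_ge0//.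
have := lip_ext_osc D (@sqr_adjmx_ge0 R n G) (dotv_tnormalize x).
rewrite -/(lip_ext0 G) ler_norml => /andP[h _].
suff : s ^+ 2 / n%:R * (\sum_i (tnth (N x) i : R)) ^+ 2 <= s ^+ 2 / n%:R * n%:R ^+ 2 by lra.
rewrite ler_wpM2l ?divr_ge0 ?sqr_ge0//.
rewrite -[leLHS]real_normK ?num_real// ler_pXn2r ?nnegrE//.
rewrite (le_trans (ler_norm_sum _ _ _))//.
rewrite -[in leRHS](card_ord n) -sumr_const ler_sum// => i _.
rewrite -(@expr_le1 _ 2)// real_normK ?num_real// (le_trans _ (dotv_tnormalize x))//.
by rewrite dotv_colv (bigD1 i)//= lerDl sumr_ge0// => j _; exact: sqr_ge0.
Qed.

(** Measurability in the noisy degree, by the Fubini-Tonelli theorem. *)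
Lemma measurable_post_mass G S : measurable_fun setT (fun s => post_mass G s S).
Proof.
pose f (p : measurableTypeR R * vec) :=
  (weight G p.1 (N p.2) * (in_output S (N p.2))%:R)%:E.
have mf : measurable_fun setT f.
  apply/measurable_EFinP; apply: measurable_funM.
    rewrite (_ : (fun _ => _) = (fun p : measurableTypeR R * vec => weight G p.1 p.2)
      \o (fun p : measurableTypeR R * vec => (p.1, N p.2)))//.
    apply: measurableT_comp; first exact: measurable_weight_pair.
    apply: measurable_fun_pair; first exact: measurable_fst.
    exact: (measurableT_comp (@measurable_tnormalize R n) measurable_snd).
  rewrite (_ : (fun _ => _) = \1_[set x | in_output S x] \o (N \o snd)).
    apply: measurableT_comp; first by apply: measurable_indic; apply: (measurable_output solP).
    exact: (measurableT_comp (@measurable_tnormalize R n) measurable_snd).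
  by apply/funext => x /=; rewrite indicE; congr ((nat_of_bool _)%:R); apply/idP/idP => [h|/set_mem]//; apply/mem_set.
rewrite (_ : (fun s => _) = fine \o fubini_F P f)//.
apply: measurableT_comp; first exact: fine_measurable.
apply: measurable_fun_fubini_tonelli_F => // p.
by rewrite lee_fin; have /andP[] := post_integrand_bounds G p.1 S p.2.
Qed.

End PosteriorBounds.

(** * Privacy *)
Section AverageDegree.
Variables (R : realType) (n : nat).
Implicit Types G : graph n.

Definition avg_degree G : R := (\sum_i \sum_j adjmx R G i j) / n%:R.

Definition clip (y : R) : R := Num.max 0 (Num.min y n%:R).

Lemma sigma_hatE G L : sigma_hat (adjmx R G) L = clip (avg_degree G + L).
Proof.
rewrite /sigma_hat /clip /avg_degree; congr (Num.max 0 (Num.min (_ / _ + _) _)).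
rewrite mxE exchange_big; apply: eq_bigr => i _ /=.
by rewrite [X in _ * X]mxE mulr1 mxE; apply: eq_bigr => j _;
   rewrite ![X in X * _]mxE mul1r.
Qed.

(** The minimum that defines the distance is attained: its default value n is
    the size of the full rewiring. *)
Lemma dnode_le1 G G' : (dnode G G' <= 1)%N ->
  exists2 W : {set 'I_n}, rewiring G G' W & (#|W| <= 1)%N.
Proof.
move=> d1; apply/not_exists2P => h.
have all2 (W : {set 'I_n}) : rewiring G G' W -> (2 <= #|W|)%N.
  by move=> rW; case: (h W) => [//|/negP]; rewrite -ltnNge.
have : (2 <= dnode G G')%N; last by rewrite leqNgt ltnS d1.
rewrite /dnode; elim/big_ind: _ => [|x y hx hy|W /all2//].
  have := all2 [set: 'I_n]%SET; rewrite cardsT card_ord; apply.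
  by apply/forallP => i; apply/forallP => j; rewrite !inE.
by rewrite leq_min hx hy.
Qed.

(** Each rewired node changes at most 2 n entries of the adjacency matrix. *)
Lemma avg_degree_dnode G G' : (0 < n)%N -> (dnode G G' <= 1)%N ->
  `|avg_degree G - avg_degree G'| <= 2.
Proof.
move=> n0 /dnode_le1 [W /forallP rW cW].
rewrite /avg_degree -mulrBl normrM normfV [`|n%:R|]ger0_norm// ler_pdivrMr ?ltr0n//.
rewrite -sumrB (le_trans (ler_norm_sum _ _ _))//.
have cW1 : \sum_(i < n) (i \in W)%:R <= 1 :> R.
  rewrite -natr_sum -big_mkcond/= sum1_card.
  by rewrite -[leRHS]/(1%:R) ler_nat.
apply: (@le_trans _ _ (\sum_(i < n) \sum_(j < n) ((i \in W)%:R + (j \in W)%:R))).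
  apply: ler_sum => i _; rewrite -sumrB (le_trans (ler_norm_sum _ _ _))//.
  apply: ler_sum => j _; rewrite !mxE.
  have := forallP (rW i) j; case: (i \in W) => /=.
    case: (j \in W); case: (val G i j); case: (val G' i j) => _ /=;
      rewrite ?subrr ?normr0 ?subr0 ?sub0r ?normrN ?normr1 ?addr0//; lra.
  case: (j \in W) => /= [_|/eqP ->]; last by rewrite subrr normr0 addr0.
  by case: (val G i j); case: (val G' i j);
     rewrite ?subrr ?normr0 ?subr0 ?sub0r ?normrN ?normr1 ?add0r.
under eq_bigr do rewrite big_split/= sumr_const card_ord.
rewrite big_split/= sumr_const card_ord sumrMnl.
have := ler_wpM2r (ler0n R n) cW1; rewrite mul1r mulr_natr.
set c := _ *+ n; lra.
Qed.

End AverageDegree.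

Section Smoothing.
Variables (R : realType) (b : R).
Hypothesis b0 : 0 < b.
Notation mu := (@lebesgue_measure R).
Implicit Types k : R -> R.

(** Expectation of k under Laplace noise centred at c; abstracting the posterior
    as k separates the noise from the sampling step. *)
Definition smoothed k (c : R) : \bar R := (\int[mu]_L (laplace_pdf b L * k (c + L))%:E)%E.

Let measurable_smoothed k c : measurable_fun setT k ->
  measurable_fun setT (fun L => (laplace_pdf b L * k (c + L))%:E).
Proof.
move=> mk; apply/measurable_EFinP; apply: measurable_funM.
  exact: measurable_laplace_pdf.
by apply: (measurableT_comp mk); exact: measurable_funD.
Qed.

Lemma smoothed_ge0 k c : (forall y, 0 <= k y) -> (0 <= smoothed k c)%E.
Proof.
by move=> k0; apply: integral_ge0 => L _; rewrite lee_fin mulr_ge0 ?laplace_pdf_ge0.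
Qed.

Lemma smoothed_fin k c : measurable_fun setT k -> (forall y, 0 <= k y <= 1) ->
  smoothed k c \is a fin_num.
Proof.
move=> mk k01; have k0 y : 0 <= k y by have /andP[] := k01 y.
rewrite ge0_fin_numE; last exact: smoothed_ge0.
apply: (@le_lt_trans _ _ 1%E); last exact: ltry.
rewrite -(integral_laplace b0); apply: ge0_le_integral => //.
- by move=> x _; rewrite lee_fin mulr_ge0 ?laplace_pdf_ge0.
- exact: measurable_smoothed.
- by apply/measurable_EFinP; exact: measurable_laplace_pdf.
move=> x _; rewrite lee_fin -[leRHS]mulr1 ler_wpM2l ?laplace_pdf_ge0//.
by have /andP[] := k01 (c + x).
Qed.

(** Translate the noise by c - c': the density changes by a factor at most
    exp (|c - c'| / b). *)
Lemma smoothed_le k k' (K c c' : R) :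
  measurable_fun setT k -> measurable_fun setT k' ->
  (forall y, 0 <= k y) -> (forall y, 0 <= k' y) -> 0 <= K ->
  (forall y, k y <= K * k' y) ->
  (smoothed k c <= (K * expR (`|c - c'| / b))%:E * smoothed k' c')%E.
Proof.
move=> mk mk' k0 k'0 K0 kk'.
pose f L := (laplace_pdf b (L + (c' - c)) * k' (c' + L))%:E.
have f0 L : (0 <= f L)%E by rewrite lee_fin mulr_ge0// laplace_pdf_ge0.
have mf : measurable_fun setT f.
  apply/measurable_EFinP; apply: measurable_funM.
    by apply: (measurableT_comp (measurable_laplace_pdf _)); exact: measurable_funD.
  by apply: (measurableT_comp mk'); exact: measurable_funD.
apply: (@le_trans _ _ (\int[mu]_L (K%:E * f (L + (c - c'))%R))%E).
  apply: ge0_le_integral => //.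
  - by move=> x _; rewrite lee_fin mulr_ge0// laplace_pdf_ge0.
  - exact: measurable_smoothed.
  - by apply: measurable_funeM; apply: (measurableT_comp mf); exact: measurable_funD.
  - move=> x _; rewrite /f -EFinM lee_fin mulrCA.
    rewrite (_ : x + (c - c') + (c' - c) = x); last by ring.
    rewrite (_ : c' + (x + (c - c')) = c + x); last by ring.
    by rewrite ler_wpM2l ?laplace_pdf_ge0.
rewrite ge0_integralZl//; last first.
  by apply: (measurableT_comp mf); exact: measurable_funD.
rewrite (ge0_integral_shift (c - c') mf f0) EFinM -muleA.
apply: lee_pmul; rewrite ?lee_fin//; first exact: integral_ge0.
rewrite /smoothed -ge0_integralZl//; last 2 first.
- exact: measurable_smoothed.
- by move=> x _; rewrite lee_fin mulr_ge0// laplace_pdf_ge0.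
apply: ge0_le_integral => //.
- by apply: measurable_funeM; exact: measurable_smoothed.
move=> x _; rewrite /f -EFinM lee_fin mulrA ler_wpM2r//.
apply: (le_trans (laplace_pdf_shift b0 _ _)).
by rewrite distrC.
Qed.

Lemma smoothed_ge k c (q : R) : measurable_fun setT k -> (forall y, 0 <= k y) ->
  0 <= q -> (forall L, `|L| <= 1 -> q <= k (c + L)) ->
  ((q * (1 - expR (- b^-1)))%:E <= smoothed k c)%E.
Proof.
move=> mk k0 q0 h.
have mlap : measurable_fun setT (fun L => (laplace_pdf b L)%:E).
  by apply/measurable_EFinP; exact: measurable_laplace_pdf.
have l0 x : (0 <= (laplace_pdf b x)%:E)%E by rewrite lee_fin laplace_pdf_ge0.
apply: (@le_trans _ _ (\int[mu]_(L in [set` `[(-1)%R, 1%R]]) (q%:E * (laplace_pdf b L)%:E))%E).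
  rewrite ge0_integralZl//; last exact: measurable_funTS.
  by rewrite EFinM lee_wpmul2l// ?lee_fin//; exact: laplace_itv11.
apply: (@le_trans _ _ (\int[mu]_(L in [set` `[(-1)%R, 1%R]]) (laplace_pdf b L * k (c + L))%:E)%E).
  apply: ge0_le_integral => //.
  - by move=> x _; rewrite -EFinM lee_fin mulr_ge0// laplace_pdf_ge0.
  - by apply: measurable_funTS; exact: measurable_funeM.
  - by apply: measurable_funTS; exact: measurable_smoothed.
  - move=> x /=; rewrite in_itv/= -ler_norml => x1.
    by rewrite -EFinM lee_fin mulrC ler_wpM2l ?laplace_pdf_ge0// h.
apply: ge0_subset_integral => //; first exact: measurable_smoothed.
by move=> x _; rewrite lee_fin mulr_ge0// laplace_pdf_ge0.
Qed.

End Smoothing.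

Section Output.
Variables (R : realType) (n : nat) (eps D gamma : R) (sol : kmeans_solver R n).
Hypotheses (n0 : (0 < n)%N) (eps0 : 0 < eps) (D0 : 0 < D).
Hypothesis solP : approx_solver gamma sol.
Notation post_mass := (post_mass eps D sol).
Notation kappa := (ple_cond_prob eps D sol).
Notation lap := (laplace_pdf (2 / eps)).
Notation mu := (@lebesgue_measure R).
Implicit Types (G : graph n) (S : {set {ffun 'I_n -> 'I_2}}).

Let b0 : 0 < 2 / eps. Proof. by rewrite divr_gt0. Qed.

Lemma cond_prob_ge0 G s S : 0 <= kappa G s S.
Proof. by rewrite (ple_cond_probE _ _ solP) divr_ge0// post_mass_ge0. Qed.

Lemma cond_prob_le1 G s S : kappa G s S <= 1.
Proof.
rewrite (ple_cond_probE _ _ solP) ler_pdivrMr ?mul1r ?(post_massT_gt0 eps0 D0 solP)//.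
by rewrite (post_massU eps0 D0 solP G s S) lerDl post_mass_ge0.
Qed.

(** The density and the normalising constant each cost
    exp ((eps / (6 D^2)) * 2 D^2), and the graph-dependent constants
    [lip_ext0] cancel between them. *)
Lemma cond_prob_ratio G G' s S : kappa G s S <= expR eps * kappa G' s S.
Proof.
rewrite !(ple_cond_probE _ _ solP).
have pG := post_massT_gt0 eps0 D0 solP G s.
have pG' := post_massT_gt0 eps0 D0 solP G' s.
have rS := post_mass_ratio eps0 D0 solP G G' s S.
have rT := post_mass_ratio eps0 D0 solP G' G s [set: _]%SET.
have S0 := post_mass_ge0 sol eps0 D0 G' s S.
have S1 := post_mass_ge0 sol eps0 D0 G s S.
move: pG pG' rS rT S0 S1.
set a := post_mass G s S; set b := post_mass G s _.
set a' := post_mass G' s S; set b' := post_mass G' s _.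
set k := expR _; set k' := expR _ => pb pb' ak bk a'0 a0.
have kk : k * k' <= expR eps.
  rewrite -expRD ler_expR -mulrDr /inv_temp.
  rewrite (_ : _ + _ = 4 * D ^+ 2); last by ring.
  rewrite (_ : _ * _ = eps * (2 / 3)); last by field; rewrite gt_eqF.
  by have := eps0; lra.
clearbody a b a' b' k k'.
rewrite ler_pdivrMr// mulrA mulrAC ler_pdivlMr//.
apply: (le_trans (ler_pM a0 (ltW pb') ak bk)).
by rewrite mulrACA -[leRHS]mulrA ler_wpM2r// mulr_ge0// ltW.
Qed.

Lemma measurable_cond_prob G S : measurable_fun setT (fun s => kappa G s S).
Proof.
have -> : (fun s => kappa G s S)
    = (fun s => post_mass G s S * (post_mass G s [set: _]%SET) `^ (-1)).
  apply/funext => s; rewrite (ple_cond_probE _ _ solP) powR_inv1//.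
  exact: post_mass_ge0.
apply: measurable_funM; first exact: (measurable_post_mass eps0 D0 solP).
apply: (measurableT_comp (measurable_powR _)).
exact: (measurable_post_mass eps0 D0 solP).
Qed.

Let k G S (y : R) := kappa G (clip n y) S.

Let mk G S : measurable_fun setT (k G S).
Proof.
apply: (measurableT_comp (measurable_cond_prob G S)).
by apply: measurable_maxr => //; apply: measurable_minr.
Qed.

Let k0 G S y : 0 <= k G S y. Proof. exact: cond_prob_ge0. Qed.

Lemma ple_probE G S :
  (ple_prob eps D sol G S)%:E = smoothed (2 / eps) (k G S) (avg_degree R G).
Proof.
have -> : ple_prob eps D sol G S = fine (smoothed (2 / eps) (k G S) (avg_degree R G)).
  rewrite /ple_prob /Rintegral; apply: (congr1 fine).
  by apply: eq_integral => L _; rewrite /k -sigma_hatE; reflexivity.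
apply: fineK; apply: smoothed_fin => // y.
by apply/andP; split; [exact: k0|exact: cond_prob_le1].
Qed.

(** The noise absorbs the change of the average degree, at most 2 between
    neighbours, and the exponential mechanism costs another factor e^eps. *)
Lemma ple_prob_DP : node_DP (2 * eps) 0 (ple_prob eps D sol).
Proof.
move=> G G' GG' S.
have cc' : `|avg_degree R G - avg_degree R G'| <= 2 by exact: avg_degree_dnode.
have aux (x x' : \bar R) (p p' K : R) : p%:E = x -> p'%:E = x' ->
  (x <= K%:E * x')%E -> p <= K * p' by move=> <- <-; rewrite -EFinM lee_fin.
have h := aux _ _ _ _ _ (ple_probE G S) (ple_probE G' S)
  (smoothed_le b0 (avg_degree R G) (avg_degree R G') (mk G S) (mk G' S)
  (k0 G S) (k0 G' S) (expR_ge0 eps) (fun y => cond_prob_ratio G G' _ S)).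
apply: (le_trans h); rewrite addr0; apply: ler_wpM2r.
  have aux0 (x : \bar R) (p : R) : p%:E = x -> (0 <= x)%E -> 0 <= p.
    by move=> <-; rewrite lee_fin.
  exact: (aux0 _ _ (ple_probE G' S) (smoothed_ge0 b0 _ (k0 G' S))).
have b2 : `|avg_degree R G - avg_degree R G'| / (2 / eps) <= eps.
  by rewrite ler_pdivrMr// mulrCA mulfV ?mulr1// gt_eqF.
clear h; by rewrite -expRD ler_expR; lra.
Qed.

(** Only noise of size at most 1 has to be considered. *)
Lemma ple_prob_ge G S (q : R) : 0 <= q ->
  (forall L, `|L| <= 1 -> q <= kappa G (clip n (avg_degree R G + L)) S) ->
  q * (1 - expR (- (eps / 2))) <= ple_prob eps D sol G S.
Proof.
move=> q0 h.
have aux (x : \bar R) (p r : R) : p%:E = x -> (r%:E <= x)%E -> r <= p.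
  by move=> <-; rewrite lee_fin.
have := aux _ _ _ (ple_probE G S) (smoothed_ge b0 (mk G S) (k0 G S) q0 h).
by rewrite invf_div; exact.
Qed.

End Output.

(** * Independence of the edges of the block model *)
Section EdgeFlip.
Variable n : nat.
Implicit Types (G : graph n) (x y i j : 'I_n).

Definition same_edge x y i j := (i == x) && (j == y) || (i == y) && (j == x).

Lemma same_edgeC x y i j : same_edge x y i j = same_edge x y j i.
Proof. by rewrite /same_edge orbC andbC [(j == y) && _]andbC. Qed.

Lemma graphC G i j : val G i j = val G j i.
Proof. by have /andP[/eqP/matrixP/(_ i j)] := valP G; rewrite mxE. Qed.

Lemma graph_irrefl G i : val G i i = false.
Proof. by have /andP[_ /forallP/(_ i)/negbTE] := valP G. Qed.

Definition flip_mx x y (A : 'M[bool]_n) : 'M[bool]_n :=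
  \matrix_(i, j) (A i j (+) ((x != y) && same_edge x y i j)).

Lemma flip_adjacency x y G : is_adjacency (flip_mx x y (val G)).
Proof.
apply/andP; split.
  by apply/eqP/matrixP => i j; rewrite !mxE graphC same_edgeC.
apply/forallP => i; rewrite mxE graph_irrefl /= /same_edge.
case: (eqVneq i x) => [->|_]; last by rewrite !andbF.
by rewrite !andTb andbT orbb andNb.
Qed.

Definition flip x y G : graph n :=
  exist (fun A => is_true (is_adjacency A)) _ (flip_adjacency x y G).

Lemma flipE x y G i j : val (flip x y G) i j = val G i j (+) ((x != y) && same_edge x y i j).
Proof. by rewrite mxE. Qed.

Lemma flipK x y : involutive (flip x y).
Proof.
by move=> G; apply/val_inj/matrixP => i j; rewrite !mxE -addbA addbb addbF.
Qed.

Lemma flip_same x y G : x != y -> val (flip x y G) x y = ~~ val G x y.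
Proof. by move=> xy; rewrite flipE xy /same_edge !eqxx addbT. Qed.

Lemma flip_other x y G i j : ~~ same_edge x y i j -> val (flip x y G) i j = val G i j.
Proof. by move=> /negPf h; rewrite flipE h andbF addbF. Qed.

Section Uniform.
Variable R : realType.

(** Pairing each graph with its flip averages over the state of one edge while
    everything else stays fixed.  This single identity replaces a description
    of the space of graphs as a product. *)
Lemma sum_flip x y (g : bool -> R) (h : graph n -> R) : x != y ->
  (forall G, h (flip x y G) = h G) ->
  \sum_(G : graph n) g (val G x y) * h G = (g true + g false) / 2 * \sum_(G : graph n) h G.
Proof.
move=> xy hinv; have two : 2 != 0 :> R by [].
apply: (mulfI two); rewrite mulrA [2 * (_ / 2)]mulrC divfK//.
rewrite mulr_natl mulr2n [X in X + _ = _](reindex_inj (inv_inj (flipK x y))) /=.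
rewrite -big_split mulr_sumr; apply: eq_bigr => G _ /=.
by rewrite hinv flip_same// -mulrDl; case: (val G x y); rewrite //= addrC.
Qed.

Definition edge_list : seq ('I_n * 'I_n) := 
  seq.filter (fun p : 'I_n * 'I_n => (p.1 < p.2)%N) (enum {: 'I_n * 'I_n}).

Lemma sum_edge_product (g : 'I_n * 'I_n -> bool -> R) (s : seq ('I_n * 'I_n)) :
  uniq s -> {subset s <= edge_list} ->
  \sum_(G : graph n) \prod_(p <- s) g p (val G p.1 p.2)
  = \prod_(p <- s) ((g p true + g p false) / 2) * #|{: graph n}|%:R.
Proof.
elim: s => [|p s IH] /=.
  by rewrite big_nil mul1r => _ _; under eq_bigr do rewrite big_nil; rewrite sumr_const.
move=> /andP[ps us] sub.
have lts q : q \in p :: s -> (q.1 < q.2)%N.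
  by move=> /sub; rewrite mem_filter => /andP[].
have p12 : p.1 != p.2 by have := lts p (mem_head _ _); rewrite ltn_neqAle => /andP[].
rewrite (eq_bigr (fun G : graph n => g p (val G p.1 p.2) *
    \prod_(q <- s) g q (val G q.1 q.2))) => [|G _]; last by rewrite big_cons.
rewrite (sum_flip (g p) p12) => [|G].
  by rewrite IH ?big_cons ?mulrA// => q qs; apply: sub; rewrite inE qs orbT.
apply: eq_big_seq => q qs; rewrite flip_other//.
apply/negP => /orP[] /andP[/eqP q1 /eqP q2].
  by move: ps; rewrite (_ : p = q) ?qs//; case: (p) (q) q1 q2 => ? ? [? ?] /= -> ->.
have := lts q; rewrite inE qs orbT => /(_ isT); have := lts p (mem_head _ _).
by rewrite q1 q2 => h1 h2; have := ltn_trans h1 h2; rewrite ltnn.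
Qed.

End Uniform.
End EdgeFlip.

Section SBM.
Variables (R : realType) (n k : nat) (B : 'M[R]_k) (theta : {ffun 'I_n -> 'I_k}).
Hypothesis Bpar : sbm_parameter B.
Implicit Types (G : graph n) (x y i j : 'I_n).

Definition prob_mx : 'M[R]_n := \matrix_(i, j) B (theta i) (theta j).
Notation P := prob_mx.

Lemma prob_mxC i j : P i j = P j i.
Proof. by have [_ /matrixP/(_ (theta i) (theta j)) h _] := Bpar; rewrite !mxE -h mxE. Qed.

Lemma prob_mx_bd i j : 0 < P i j <= 1.
Proof. by have [h _ _] := Bpar; rewrite !mxE. Qed.

Definition expect (f : graph n -> R) : R := \sum_(G : graph n) sbm_pmf B theta G * f G.

Lemma sbm_pmf_edges G :
  sbm_pmf B theta G = \prod_(p <- edge_list n) bernoulli_pmf (P p.1 p.2) (val G p.1 p.2).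
Proof.
rewrite /sbm_pmf /edge_list big_filter big_enum_cond pair_big_dep /=.
by apply: eq_bigr => p _; rewrite mxE.
Qed.

Lemma edge_list_uniq : uniq (edge_list n).
Proof. by rewrite filter_uniq// enum_uniq. Qed.

Lemma sbm_pmf_ge0 G : 0 <= sbm_pmf B theta G.
Proof.
apply: prodr_ge0 => i _; apply: prodr_ge0 => j _; apply: bernoulli_pmf_ge0.
by have := prob_mx_bd i j; rewrite mxE => /andP[/ltW -> ->].
Qed.

(** Summing out the edges one by one shows that the total mass does not depend on
    the edge probabilities; if they are all 1, only the complete graph counts. *)
Lemma expect1 : expect (fun=> 1) = 1.
Proof.
rewrite /expect; under eq_bigr do rewrite mulr1 sbm_pmf_edges.
rewrite (sum_edge_product (fun p => bernoulli_pmf (P p.1 p.2)) edge_list_uniq)//.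
have -> : \prod_(p <- edge_list n)
    ((bernoulli_pmf (P p.1 p.2) true + bernoulli_pmf (P p.1 p.2) false) / 2)
  = \prod_(p <- edge_list n) (((1 : R) + 0) / 2).
  by apply: eq_bigr => p _; rewrite /bernoulli_pmf addrC subrK addr0.
have <- := sum_edge_product (fun=> fun b : bool => if b then 1 else 0 : R) edge_list_uniq (fun p h => h).
have cmp : is_adjacency (\matrix_(i, j) (i != j) : 'M[bool]_n).
  apply/andP; split; first by apply/eqP/matrixP => i j; rewrite !mxE eq_sym.
  by apply/forallP => i; rewrite mxE eqxx.
rewrite (bigD1 (exist (fun A => is_true (is_adjacency A)) _ cmp : graph n))//= big1_seq => [|p /=]; last first.
  by rewrite mem_filter mxE => /andP[+ _]; rewrite ltn_neqAle => /andP[->].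
rewrite big1 ?addr0// => G Gc.
have [i [j [ij Gij]]] : exists i j, (i < j)%N /\ val G i j = false.
  apply/not_existsP => h; move: Gc => /eqP; apply; apply/val_inj/matrixP => i j; rewrite mxE.
  have lt_true (a b : 'I_n) : (a < b)%N -> val G a b.
    by move=> ab; apply/negP => /negP/negbTE Gab; apply: (h a); exists b.
  case: (ltngtP i j) => [ij|ji|/val_inj ->]; last by rewrite eqxx graph_irrefl.
    by rewrite lt_true// -val_eqE/= neq_ltn ij.
  by rewrite graphC lt_true// -val_eqE/= neq_ltn ji orbT.
rewrite (bigD1_seq (i, j)) ?edge_list_uniq//= ?Gij ?mul0r//.
by rewrite mem_filter ij mem_enum.
Qed.

Lemma expectD f g : expect (fun G => f G + g G) = expect f + expect g.
Proof. by rewrite -big_split; apply: eq_bigr => G _; rewrite mulrDr. Qed.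

Lemma expectZ c f : expect (fun G => c * f G) = c * expect f.
Proof. by rewrite mulr_sumr; apply: eq_bigr => G _; rewrite mulrCA. Qed.

Lemma expect_le f g : (forall G, f G <= g G) -> expect f <= expect g.
Proof. by move=> fg; apply: ler_sum => G _; rewrite ler_wpM2l ?sbm_pmf_ge0. Qed.

Lemma eq_expect f g : f =1 g -> expect f = expect g.
Proof. by move=> fg; apply: eq_bigr => G _; rewrite fg. Qed.

Lemma expect_cst c : expect (fun=> c) = c.
Proof. by rewrite -[RHS]mulr1 -expect1 -expectZ; apply: eq_expect => G; rewrite mulr1. Qed.

Lemma expect_sum (I : Type) (r : seq I) (Q : pred I) (F : I -> graph n -> R) :
  expect (fun G => \sum_(i <- r | Q i) F i G) = \sum_(i <- r | Q i) expect (F i).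
Proof. by rewrite exchange_big; apply: eq_bigr => G _; rewrite mulr_sumr. Qed.

(** The state of an edge is independent of everything that ignores that edge,
    expressed as invariance under the flip. *)
Lemma expect_edge x y (g : bool -> R) (h : graph n -> R) : x != y ->
  (forall G, h (flip x y G) = h G) ->
  expect (fun G => g (val G x y) * h G)
  = (P x y * g true + (1 - P x y) * g false) * expect h.
Proof.
wlog xy : x y / (x < y)%N => [wl xNy hinv|].
  case: (ltngtP x y) => [xy|yx|/val_inj E]; first exact: wl.
    rewrite prob_mxC -wl ?(eq_sym y)//.
      by apply: eq_expect => G; rewrite graphC.
    move=> G; rewrite -[RHS]hinv; congr h; apply/val_inj/matrixP => i j.
    by rewrite !flipE eq_sym /same_edge orbC.
  by rewrite E eqxx in xNy.
move=> xNy hinv.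
pose rest G := \prod_(p <- edge_list n | p != (x, y)) bernoulli_pmf (P p.1 p.2) (val G p.1 p.2).
have pmfE G : sbm_pmf B theta G = bernoulli_pmf (P x y) (val G x y) * rest G.
  rewrite sbm_pmf_edges (bigD1_seq (x, y)) ?edge_list_uniq//=.
  by rewrite mem_filter xy mem_enum.
have rinv G : rest (flip x y G) = rest G.
  rewrite /rest big_seq_cond [RHS]big_seq_cond; apply: eq_bigr => -[i j] /andP[].
  rewrite mem_filter/= => /andP[ij _]; rewrite xpair_eqE => nxy; rewrite flip_other//.
  rewrite /same_edge negb_or nxy/=; apply/negP => /andP[/eqP Ei /eqP Ej].
  by have := ltn_trans ij; rewrite Ei Ej => /(_ _ xy); rewrite ltnn.
have E1 : expect h = 1 / 2 * \sum_(G : graph n) rest G * h G.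
  rewrite /expect; under eq_bigr do rewrite pmfE -mulrA.
  rewrite (sum_flip (bernoulli_pmf (P x y)) xNy) => [|G]; last by rewrite rinv hinv.
  by rewrite /bernoulli_pmf addrC subrK.
rewrite E1 /expect.
under eq_bigr do rewrite pmfE mulrACA.
rewrite (sum_flip (fun b => bernoulli_pmf (P x y) b * g b) xNy) => [|G]; last by rewrite rinv hinv.
by rewrite /bernoulli_pmf; ring.
Qed.

End SBM.

(** * Concentration of the adjacency noise *)
Section ExpBounds.
Variable R : realType.

(** From 1 - x <= exp (- x), since (1 + x + 2 x^2) (1 - x) >= 1 for x <= 1/2. *)
Lemma expR_le_quadratic (x : R) : x <= 2^-1 -> expR x <= 1 + x + 2 * x ^+ 2.
Proof.
move=> x2; have := expR_ge1Dx (- x); have := expRxMexpNx_1 x; have := expR_gt0 x.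
set a := expR x; set b := expR (- x) => a0 ab bx.
have x1 : 0 < 1 - x by lra.
have h : a * (1 - x) <= a * b by rewrite ler_pM2l.
rewrite ab in h.
rewrite -(ler_pM2r x1); apply: (le_trans h).
have : 0 <= x ^+ 2 * (1 - 2 * x) by rewrite mulr_ge0 ?sqr_ge0//; lra.
lra.
Qed.

End ExpBounds.

Section Concentration.
Variables (R : realType) (n k : nat) (B : 'M[R]_k) (theta : {ffun 'I_n -> 'I_k}).
Hypothesis Bpar : sbm_parameter B.
Implicit Types (G : graph n) (x y i j : 'I_n).
Notation P := (prob_mx B theta).
Notation E := (expect B theta).

Definition prob (Q : graph n -> bool) : R := E (fun G => (Q G)%:R).

Lemma prob_le_expect (Q : graph n -> bool) f : (forall G, 0 <= f G) ->
  (forall G, Q G -> 1 <= f G) -> prob Q <= E f.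
Proof.
move=> f0 Qf; apply: expect_le => // G.
by case: (boolP (Q G)) => [/Qf//|_]; exact: f0.
Qed.

Lemma markov_expect (Q : graph n -> bool) f a : 0 < a -> (forall G, 0 <= f G) ->
  (forall G, Q G -> a <= f G) -> prob Q <= E f / a.
Proof.
move=> a0 f0 Qf; rewrite mulrC -expectZ; apply: prob_le_expect => G.
  by rewrite mulr_ge0 ?invr_ge0 ?f0// ltW.
by move=> /Qf h; rewrite mulrC ler_pdivlMr// mul1r.
Qed.

Lemma prob_union (I : finType) (Q : I -> graph n -> bool) :
  prob (fun G => [exists i, Q i G]) <= \sum_i prob (Q i).
Proof.
rewrite /prob -expect_sum; apply: expect_le => // G.
case: existsP => [[i Qi]|_]; last exact: sumr_ge0.
by rewrite (bigD1 i)//= Qi lerDl sumr_ge0.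
Qed.

Lemma prob_or (Q Q' : graph n -> bool) : prob (fun G => Q G || Q' G) <= prob Q + prob Q'.
Proof.
rewrite /prob -expectD; apply: expect_le => // G.
by case: (Q G); case: (Q' G); rewrite /= ?addr0 ?add0r//; lra.
Qed.

Lemma expect_edge2 x y x' y' (F : bool -> bool -> R) (h : graph n -> R) :
  x != y -> x' != y' -> ~~ same_edge x y x' y' ->
  (forall G, h (flip x y G) = h G) -> (forall G, h (flip x' y' G) = h G) ->
  E (fun G => F (val G x y) (val G x' y') * h G) =
  \sum_(a : bool) \sum_(b : bool)
    bernoulli_pmf (P x y) a * bernoulli_pmf (P x' y') b * F a b * E h.
Proof.
move=> xy xy' ne h1 h2.
transitivity (\sum_(a : bool) E (fun G => (val G x y == a)%:R * (F a (val G x' y') * h G))).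
  rewrite -expect_sum; apply: eq_expect => G; rewrite big_bool /=.
  by case: (val G x y); rewrite /= mul1r mul0r ?addr0 ?add0r.
apply: eq_bigr => a _.
rewrite (expect_edge theta Bpar (fun b => (b == a)%:R) xy) => [|G]; last by rewrite h1 flip_other.
rewrite (expect_edge theta Bpar (F a) xy')//.
by rewrite big_bool /bernoulli_pmf /=; case: a => /=; ring.
Qed.

Lemma expect_prod_row i (s : seq 'I_n) (g : 'I_n -> bool -> R) : uniq s -> i \notin s ->
  E (fun G => \prod_(j <- s) g j (val G i j)) =
  \prod_(j <- s) (P i j * g j true + (1 - P i j) * g j false).
Proof.
elim: s => [|j s IH] /=.
  move=> _ _; rewrite big_nil; transitivity (E (fun=> 1)); last exact: expect1.
  by apply: eq_expect => G; rewrite big_nil.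
rewrite inE negb_or => /andP[js us] /andP[ij is_].
rewrite big_cons -IH// -(expect_edge theta Bpar (g j) ij) => [|G].
  by apply: eq_expect => G; rewrite big_cons.
apply: eq_big_seq => l ls; rewrite flip_other// /same_edge negb_or !negb_and.
rewrite (negbTE ij) (memPn js)//= ?orbT//.
Qed.

Definition noise G : 'M[R]_n := adjmx R G - P.

Lemma noiseE G i j : noise G i j = (val G i j)%:R - P i j.
Proof. by rewrite !mxE. Qed.

Lemma noise_sym G : (noise G)^T = noise G.
Proof. by apply/matrixP => i j; rewrite mxE !noiseE graphC prob_mxC. Qed.

Lemma noise_le1 G i j : `|noise G i j| <= 1.
Proof.
rewrite noiseE; have /andP[h1 h2] := prob_mx_bd theta Bpar i j.
by rewrite ler_norml; case: (val G i j) => /=; apply/andP; split; lra.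
Qed.

Variable p : R.
Hypothesis Pp : forall i j, P i j <= p.

(** The exponent 1/2 stays in the range of [expR_le_quadratic], where
    exp (1/2) <= 2. *)
Lemma degree_mgf i : E (fun G => expR (2^-1 * \sum_j adjmx R G i j)) <= expR (n%:R * p).
Proof.
have p0 : 0 <= p by case/andP: (prob_mx_bd theta Bpar i i) => /ltW h _; exact: le_trans h (Pp i i).
pose s := seq.filter (fun j => j != i) (enum 'I_n).
have us : uniq s by rewrite filter_uniq// enum_uniq.
have is_ : i \notin s by rewrite mem_filter eqxx.
have -> : E (fun G => expR (2^-1 * \sum_j adjmx R G i j))
    = E (fun G => \prod_(j <- s) expR (2^-1 * (val G i j)%:R)).
  apply: eq_expect => G; rewrite -expR_sum -mulr_sumr; congr (expR (_ * _)).
  rewrite (bigD1 i)//= mxE graph_irrefl add0r big_filter big_enum_cond/=.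
  by apply: eq_bigr => j _; rewrite mxE.
rewrite (expect_prod_row (fun j b => expR (2^-1 * b%:R)) us is_).
apply: (@le_trans _ _ (\prod_(j <- s) expR p)).
  apply: ler_prod => j _; have /andP[h1 h2] := prob_mx_bd theta Bpar i j.
  rewrite mulr0 expR0 !mulr1; apply/andP; split.
    by rewrite addr_ge0 ?subr_ge0// mulr_ge0 ?expR_ge0// ltW.
  have e2 := @expR_le_quadratic R 2^-1 (lexx _).
  apply: le_trans (expR_ge1Dx p).
  have : P i j * expR 2^-1 <= P i j * 2 by rewrite ler_pM2l//; lra.
  by have := Pp i j; lra.
rewrite -expR_sum ler_expR big_filter big_enum_cond/= sumr_const -[leLHS]mulr_natl.
by rewrite ler_wpM2r// ler_nat -[leqRHS]card_ord max_card.
Qed.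

(** For distinct l the factors involve the disjoint pairs of edges il, jl, hence
    are independent; each product W_il W_jl is centred and has variance at most
    p^2. *)
Lemma cross_mgf i j t : i != j -> `|t| <= 2^-1 ->
  E (fun G => expR (t * \sum_(l | (l != i) && (l != j)) noise G i l * noise G j l))
  <= expR (n%:R * (2 * t ^+ 2 * p ^+ 2)).
Proof.
move=> ij t2.
pose s := seq.filter (fun l => (l != i) && (l != j)) (enum 'I_n).
have us : uniq s by rewrite filter_uniq// enum_uniq.
have sP l : l \in s -> (l != i) && (l != j) by rewrite mem_filter => /andP[].
pose c := expR (2 * t ^+ 2 * p ^+ 2).
have c0 : 0 <= c := expR_ge0 _.
have key : E (fun G => \prod_(l <- s) expR (t * (noise G i l * noise G j l)))
    <= c ^+ size s.
  elim: s us sP => [_ _|l s IH /= /andP[ls us] sP].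
    rewrite expr0; apply: (@le_trans _ _ (E (fun=> 1))); last by rewrite expect1.
    by apply: expect_le => // G; rewrite big_nil.
  have /andP[li lj] := sP l (mem_head _ _).
  pose F (a b : bool) := expR (t * ((a%:R - P i l) * (b%:R - P j l))).
  pose h G := \prod_(m <- s) expR (t * (noise G i m * noise G j m)).
  have hflip q : q \in [:: i; j] -> forall G, h (flip q l G) = h G.
    move=> qij G; apply: eq_big_seq => m ms.
    have /andP[mi mj] : (m != i) && (m != j) by apply: sP; rewrite inE ms orbT.
    have ml : m != l by apply: contraNneq ls => <-.
    have other m' : m' \in [:: i; j] -> ~~ same_edge q l m' m.
      move=> m'ij; have m'l : m' != l.
        by move: m'ij; rewrite !inE => /orP[] /eqP ->; rewrite eq_sym ?li ?lj.
      by rewrite /same_edge (negbTE ml) (negbTE m'l) andbF.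
    by rewrite !noiseE !flip_other// other// !inE eqxx ?orbT.
  have -> : E (fun G => \prod_(m <- l :: s) expR (t * (noise G i m * noise G j m)))
      = E (fun G => F (val G i l) (val G j l) * h G).
    by apply: eq_expect => G; rewrite big_cons /F /h !noiseE.
  have nse : ~~ same_edge i l j l.
    by rewrite /same_edge [j == i]eq_sym (negbTE ij) (negbTE li) andbF.
  have il : i != l by rewrite eq_sym.
  have jl : j != l by rewrite eq_sym.
  have hi : forall G, h (flip i l G) = h G by apply: hflip; rewrite inE eqxx.
  have hj : forall G, h (flip j l G) = h G by apply: hflip; rewrite !inE eqxx orbT.
  rewrite (expect_edge2 F il jl nse hi hj).
  under eq_bigr do rewrite -mulr_suml.
  rewrite -mulr_suml exprS.
  have IHs : E h <= c ^+ size s.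
    by apply: IH => // m ms; apply: sP; rewrite inE ms orbT.
  have Eh0 : 0 <= E h.
    rewrite -(expect_cst B theta 0); apply: expect_le => // G.
    by apply: prodr_ge0 => m _; exact: expR_ge0.
  apply: ler_pM => //.
    apply: sumr_ge0 => a _; apply: sumr_ge0 => b _.
    have [P1 P2] := (prob_mx_bd theta Bpar i l, prob_mx_bd theta Bpar j l).
    case/andP: P1 => /ltW ? ?; case/andP: P2 => /ltW ? ?.
    by rewrite !mulr_ge0 ?expR_ge0// bernoulli_pmf_ge0//; apply/andP; split.
  have [P1 P2] := (prob_mx_bd theta Bpar i l, prob_mx_bd theta Bpar j l).
  have [p1 p2] := (Pp i l, Pp j l).
  case/andP: P1 => P1 P1'; case/andP: P2 => P2 P2'.
  set u := P i l in F p1 P1 P1' *; set v := P j l in F p2 P2 P2' *.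
  have Fle a b : F a b <= 1 + t * ((a%:R - u) * (b%:R - v))
      + 2 * (t * ((a%:R - u) * (b%:R - v))) ^+ 2.
    apply: expR_le_quadratic; apply: (le_trans (ler_norm _)).
    rewrite !normrM -[leRHS]mulr1 ler_pM//.
    rewrite mulr_ile1//; [case: a|case: b] => /=; rewrite ler_norml; apply/andP; split; lra.
  rewrite /c; apply: le_trans (expR_ge1Dx _).
  apply: (@le_trans _ _ (1 + 2 * t ^+ 2 * ((u * (1 - u)) * (v * (1 - v))))); last first.
    have t20 : 0 <= 2 * t ^+ 2 by rewrite mulr_ge0// sqr_ge0.
    rewrite lerD2l; apply: (ler_wpM2l t20); rewrite expr2 ler_pM//.
    - by rewrite mulr_ge0 ?subr_ge0// (ltW P1).
    - by rewrite mulr_ge0 ?subr_ge0// (ltW P2).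
    - by apply: le_trans p1; rewrite ler_piMr ?(ltW P1)//; lra.
    - by apply: le_trans p2; rewrite ler_piMr ?(ltW P2)//; lra.
  rewrite !big_bool /bernoulli_pmf.
  have w11 : 0 <= u * v by rewrite mulr_ge0// ltW.
  have w10 : 0 <= u * (1 - v) by rewrite mulr_ge0 ?subr_ge0// ltW.
  have w01 : 0 <= (1 - u) * v by rewrite mulr_ge0 ?subr_ge0// ltW.
  have w00 : 0 <= (1 - u) * (1 - v) by rewrite mulr_ge0 ?subr_ge0// ltW.
  apply: le_trans (lerD (lerD (ler_wpM2l w11 (Fle true true)) (ler_wpM2l w10 (Fle true false)))
    (lerD (ler_wpM2l w01 (Fle false true)) (ler_wpM2l w00 (Fle false false)))) _.
  by rewrite /= le_eqVlt; apply/orP; left; apply/eqP; ring.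
rewrite (_ : E _ = E (fun G => \prod_(l <- s) expR (t * (noise G i l * noise G j l)))); last first.
  apply: eq_expect => G; rewrite -expR_sum -mulr_sumr; congr (expR (_ * _)).
  by rewrite big_filter big_enum_cond.
apply: (le_trans key); rewrite -expRM_natl ler_expR ler_wpM2r//.
  by apply: mulr_ge0; [apply: mulr_ge0|]; rewrite ?sqr_ge0.
by rewrite ler_nat size_filter (leq_trans (count_size _ _))// size_enum_ord.
Qed.

End Concentration.

Section OperatorNorm.
Variables (R : realFieldType) (n : nat) (W : 'M[R]_n).
Hypothesis Wsym : W^T = W.

(** |W x|^4 = <x, W^2 x>^2 <= |x|^2 |W^2 x|^2 <= |x|^4 |W^2|_F^2.  The
    Frobenius norm of W itself would be too large by a power of n. *)
Lemma operator_norm_frobenius (om : R) (x : 'cV[R]_n) : 0 <= om ->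
  \sum_i \sum_j (W *m W) i j ^+ 2 <= om ^+ 2 ->
  dotv (W *m x) (W *m x) <= om * dotv x x.
Proof.
move=> om0 h; apply: ler_of_sqr; first by rewrite mulr_ge0// dotv_ge0.
have -> : dotv (W *m x) (W *m x) = dotv x (W *m W *m x).
  by rewrite dotv_mulmxl Wsym mulmxA.
apply: (le_trans (dotv_CauchySchwarz _ _)).
rewrite exprMn mulrC [X in _ <= _ * X]expr2 mulrA ler_wpM2r ?dotv_ge0//.
apply: (@le_trans _ _ (\sum_i (\sum_j (W *m W) i j ^+ 2) * dotv x x)).
  apply: ler_sum => i _; rewrite -expr2.
  have := dotv_CauchySchwarz (\col_j (W *m W) i j) x.
  rewrite (_ : dotv _ x = (W *m W *m x) i 0); last first.
    by rewrite [RHS]mxE; apply: eq_bigr => j _; rewrite mxE.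
  rewrite (_ : dotv (\col_j _) _ = \sum_j (W *m W) i j ^+ 2)//.
  by apply: eq_bigr => j _; rewrite mxE expr2.
by rewrite -mulr_suml ler_wpM2r ?dotv_ge0.
Qed.

End OperatorNorm.

Section Tails.
Variables (R : realType) (n k : nat) (B : 'M[R]_k) (theta : {ffun 'I_n -> 'I_k}).
Hypothesis Bpar : sbm_parameter B.
Implicit Types (G : graph n) (i j : 'I_n).
Notation P := (prob_mx B theta).
Notation E := (expect B theta).
Notation prob := (prob B theta).
Notation noise := (noise B theta).
Variable p : R.
Hypothesis Pp : forall i j, P i j <= p.
Let d := n%:R * p.

Definition degree G i : R := \sum_j adjmx R G i j.

(** The entry (i, j) of W^2 without the two terms that contain the edge ij, so
    that the remaining terms are independent. *)
Definition cross G i j : R := \sum_(l | (l != i) && (l != j)) noise G i l * noise G j l.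

Lemma noiseC G i j : noise G i j = noise G j i.
Proof. by rewrite !noiseE graphC (prob_mxC theta Bpar). Qed.

(** One of the two entries is off-diagonal, hence centred and independent of the
    other one, which may be the constant diagonal entry. *)
Lemma expect_noise_mul i j l : j != l ->
  E (fun G => noise G i j * noise G i l) = 0.
Proof.
wlog ij : j l / i != j => [wl jl|jl].
  have [ij|] := eqVneq i j; last by move=> ij; exact: wl.
  have il : i != l by rewrite ij.
  rewrite -(wl l j il); last by rewrite eq_sym.
  by apply: eq_expect => G; rewrite mulrC.
transitivity (E (fun G => (fun b : bool => b%:R - P i j) (val G i j) * noise G i l)).
  by apply: eq_expect => G; rewrite noiseE.
rewrite (expect_edge theta Bpar (fun b : bool => b%:R - P i j) ij) => [|G].
  by rewrite /=; set q := P i j; ring.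
rewrite !noiseE flip_other// /same_edge negb_or !negb_and (eq_sym l) jl orbT/=.
by rewrite (negbTE ij).
Qed.

Lemma expect_noise_sqr i j : E (fun G => noise G i j ^+ 2) <= p.
Proof.
have /andP[h0 h1] := prob_mx_bd theta Bpar i j.
have hp := Pp i j.
have [ij|ij] := eqVneq i j.
  rewrite (@eq_expect _ _ _ _ _ _ (fun=> P i j ^+ 2)) => [|G].
    by rewrite expect_cst expr2 (le_trans _ hp)// ler_piMr// ltW.
  by rewrite noiseE ij graph_irrefl sub0r sqrrN.
rewrite (_ : E _ = E (fun G => (fun b : bool => (b%:R - P i j) ^+ 2) (val G i j) * 1));
  last by apply: eq_expect => G; rewrite noiseE mulr1.
rewrite (expect_edge theta Bpar (fun b : bool => (b%:R - P i j) ^+ 2) ij)// expect1 /=.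
apply: le_trans hp; set q := P i j in h0 h1 *.
have : 0 <= q * q by rewrite mulr_ge0// ltW.
lra.
Qed.

Lemma expect_noise_vec (x : 'cV[R]_n) :
  E (fun G => dotv (noise G *m x) (noise G *m x)) <= d * dotv x x.
Proof.
rewrite /dotv expect_sum.
apply: (@le_trans _ _ (\sum_(i < n) p * dotv x x)); last first.
  by rewrite sumr_const card_ord /d -mulrA mulr_natl.
apply: ler_sum => i _.
have -> : E (fun G => (noise G *m x) i 0 * (noise G *m x) i 0)
    = \sum_j \sum_l E (fun G => (x j 0 * x l 0) * (noise G i j * noise G i l)).
  under [in RHS]eq_bigr do rewrite -expect_sum.
  rewrite -expect_sum; apply: eq_expect => G.
  rewrite mxE mulr_suml; apply: eq_bigr => j _; rewrite mulr_sumr.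
  by apply: eq_bigr => l _; ring.
rewrite /dotv mulr_sumr; apply: ler_sum => j _.
rewrite (bigD1 j)//= big1 ?addr0 => [|l lj]; last first.
  by rewrite expectZ expect_noise_mul ?mulr0// eq_sym.
rewrite expectZ mulrC ler_wpM2r -?expr2 ?sqr_ge0//.
rewrite (@eq_expect _ _ _ _ _ _ (fun G => noise G i j ^+ 2)) ?expect_noise_sqr//.
Qed.

Lemma degree_tail i : prob (fun G => 3 * d <= degree G i) <= expR (- (d / 2)).
Proof.
apply: (@le_trans _ _ (E (fun G => expR (2^-1 * degree G i)) / expR (3 * d / 2))).
  apply: (markov_expect _ Bpar) => [|G|G h]; first exact: expR_gt0.
    exact: expR_ge0.
  by rewrite ler_expR; lra.
rewrite ler_pdivrMr ?expR_gt0// -expRD (le_trans (degree_mgf Bpar Pp i))// ler_expR /d.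
by set z := n%:R * p; lra.
Qed.

Lemma cross_tail i j (s t : R) : i != j -> 0 <= t <= 2^-1 ->
  prob (fun G => s <= `|cross G i j|)
    <= 2 * expR (n%:R * (2 * t ^+ 2 * p ^+ 2) - t * s).
Proof.
move=> ij /andP[t0 t2].
have one (sg : R) : `|sg| = 1 -> prob (fun G => s <= sg * cross G i j)
    <= expR (n%:R * (2 * t ^+ 2 * p ^+ 2) - t * s).
  move=> sg1.
  apply: (@le_trans _ _ (E (fun G => expR (sg * t * cross G i j)) / expR (t * s))).
    apply: (markov_expect _ Bpar) => [|G|G h]; first exact: expR_gt0.
      exact: expR_ge0.
    by rewrite ler_expR [sg * t]mulrC -mulrA ler_wpM2l.
  rewrite ler_pdivrMr ?expR_gt0// -expRD subrK.
  have sg2 : (sg * t) ^+ 2 = t ^+ 2.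
    by rewrite exprMn -[sg ^+ 2]real_normK ?num_real// sg1 expr1n mul1r.
  rewrite -sg2; apply: (cross_mgf Bpar Pp ij).
  by rewrite normrM sg1 mul1r ger0_norm.
apply: (@le_trans _ _ (prob (fun G => (s <= 1 * cross G i j) || (s <= -1 * cross G i j)))).
  apply: expect_le => // G; rewrite ler_nat; case: (boolP (s <= `|_|)) => // h.
  rewrite lt0b mul1r mulN1r; move: h; case: (ger0P (cross G i j)) => _ -> //.
  by rewrite orbT.
apply: (le_trans (prob_or _ _ _ _)) => //.
have := one 1 (normr1 _); have := one (-1) (normrN1 _); lra.
Qed.

Lemma noise_sqr_offdiag G i j s : i != j -> `|cross G i j| <= s ->
  `|(noise G *m noise G) i j| <= s + 2.
Proof.
move=> ij h.
have -> : (noise G *m noise G) i j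
    = cross G i j + noise G i i * noise G i j + noise G i j * noise G j j.
  rewrite mxE (bigD1 i)//= (bigD1 j) 1?eq_sym//=.
  rewrite (_ : \sum_(l | _) _ = cross G i j); first by ring.
  by apply: eq_bigr => l _; rewrite [noise G l j]noiseC.
apply: (le_trans (ler_normD _ _)); rewrite (_ : 2 = 1 + 1)// addrA.
apply: lerD; last by rewrite normrM mulr_ile1 ?noise_le1.
by apply: (le_trans (ler_normD _ _)); apply: lerD => //; rewrite normrM mulr_ile1 ?noise_le1.
Qed.

Lemma noise_sqr_diag G i : (noise G *m noise G) i i <= degree G i + d.
Proof.
rewrite mxE /d (_ : n%:R * p = \sum_(j < n) p); last by rewrite sumr_const card_ord mulr_natl.
rewrite -big_split; apply: ler_sum => j _ /=.
rewrite [noise G j i]noiseC noiseE [adjmx _ _ _ _]mxE.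
have /andP[h0 h1] := prob_mx_bd theta Bpar i j; have := Pp i j.
set q := P i j in h0 h1 *.
have : 0 <= q * (1 - q) by rewrite mulr_ge0 ?subr_ge0// ltW.
by case: (val G i j) => /=; lra.
Qed.

(** The diagonal of W^2 is of the order of the degrees, and its contribution
    n d^2 to the squared Frobenius norm is of lower order than d^4. *)
Lemma noise_operator_norm G (s om : R) (x : 'cV[R]_n) : 0 <= om -> 0 <= s ->
  (forall i, degree G i <= 3 * d) ->
  (forall i j, i != j -> `|cross G i j| <= s) ->
  n%:R * (4 * d) ^+ 2 + n%:R ^+ 2 * (s + 2) ^+ 2 <= om ^+ 2 ->
  dotv (noise G *m x) (noise G *m x) <= om * dotv x x.
Proof.
move=> om0 s0 hd hc hom; apply: (operator_norm_frobenius (noise_sym theta Bpar G)) => //.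
apply: le_trans hom.
have -> : n%:R * (4 * d) ^+ 2 + n%:R ^+ 2 * (s + 2) ^+ 2
    = \sum_(i < n) ((4 * d) ^+ 2 + \sum_(j < n) (s + 2) ^+ 2).
  by rewrite !sumr_const !card_ord; ring.
apply: ler_sum => i _; rewrite (bigD1 i)//= lerD//.
  have := noise_sqr_diag G i; have := hd i => h1 h2.
  have h0 : 0 <= (noise G *m noise G) i i.
    rewrite mxE; apply: sumr_ge0 => j _.
    by rewrite [noise G j i]noiseC -expr2 sqr_ge0.
  by rewrite ler_pXn2r ?nnegrE//; lra.
rewrite [leRHS](bigD1 i)//= ler_wpDl ?sqr_ge0//; apply: ler_sum => j ji.
rewrite -[leLHS]real_normK ?num_real// ler_pXn2r ?nnegrE ?addr_ge0//.
by apply: noise_sqr_offdiag; [rewrite eq_sym|apply: hc; rewrite eq_sym].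
Qed.

End Tails.

(** * The posterior of a typical graph *)
Section Cap.
Variables (R : realType) (n : nat) (theta : {ffun 'I_n -> 'I_2}).
Hypothesis n0 : (0 < n)%N.
Notation vec := (n.-tuple (measurableTypeR R)).
Notation N := (@tnormalize R n).
Notation u := (community_vec R theta).

(** Small enough for the utility to vary by at most 4 on the cap: its
    coefficients are of order n, and there are n^2 of them. *)
Definition cap_radius : R := (4 * n%:R ^+ 4)^-1.

Let nR : 1 <= n%:R :> R. Proof. by rewrite -[1]/(1%:R) ler_nat. Qed.

Lemma coord_le1 (v : 'cV[R]_n) i : dotv v v <= 1 -> `|v i 0| <= 1.
Proof.
move=> v1; rewrite -(@expr_le1 _ 2)// real_normK ?num_real// (le_trans _ v1)//.
by rewrite /dotv (bigD1 i)//= -expr2 lerDl sumr_ge0// => j _; rewrite -expr2 sqr_ge0.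
Qed.

(** A vector within r of the unit vector u in every coordinate has norm within
    3 n r of 1, so normalising moves each coordinate by at most 3 n r. *)
Lemma tnormalize_cap (x : vec) : box (fun i => u i 0) cap_radius x ->
  forall i, `|(tnth (N x) i : R) - u i 0| <= (n%:R ^+ 3)^-1.
Proof.
move=> bx i.
have nz : n%:R != 0 :> R by rewrite gt_eqF// (lt_le_trans _ nR).
have n3 : 1 <= n%:R ^+ 3 :> R by rewrite exprn_ege1.
pose q : R := (n%:R ^+ 3)^-1.
have q0 : 0 < q by rewrite invr_gt0 (lt_le_trans _ n3).
have q1 : q <= 1 by rewrite invf_le1// (lt_le_trans _ n3).
have rq : cap_radius * (4 * n%:R) = q by rewrite /cap_radius /q; field.
set r := cap_radius in bx rq *.
have r0 : 0 < r by rewrite invr_gt0 mulr_gt0// exprn_gt0// (lt_le_trans _ nR).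
have r1 : r <= 1.
  have n1 : 1 <= 4 * n%:R :> R by have := nR; lra.
  have : r * 1 <= r * (4 * n%:R) by rewrite ler_pM2l.
  lra.
have uu := dotv_community_vec R theta n0.
have u1 j : `|u j 0| <= 1 by apply: coord_le1; rewrite uu.
pose s : R := \sum_(j < n) (tnth x j : R) ^+ 2.
have s1 : `|s - 1| <= 3 * n%:R * r.
  have -> : s - 1 = s - dotv u u by rewrite uu.
  rewrite /s /dotv -sumrB (le_trans (ler_norm_sum _ _ _))//.
  apply: (@le_trans _ _ (\sum_(j < n) (3 * r))).
    apply: ler_sum => j _; set y : R := tnth x j; set z := u j 0.
    have hj : `|y - z| <= r by exact: bx.
    have hz : `|z| <= 1 by exact: u1.
    have -> : y ^+ 2 - z * z = (y - z) * ((y - z) + 2 * z) by ring.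
    rewrite normrM [3 * r]mulrC ler_pM//.
    apply: (le_trans (ler_normD _ _)); rewrite normrM [`|2|]ger0_norm//; lra.
  by rewrite sumr_const card_ord le_eqVlt; apply/orP; left; apply/eqP; ring.
pose c := Num.sqrt s.
have s1q : `|s - 1| <= 3 / 4.
  by apply: (le_trans s1); rewrite (_ : 3 * n%:R * r = 3 / 4 * q); [lra|rewrite -rq; field].
have s0 : 0 < s by move: s1q; rewrite ler_norml => /andP[? ?]; lra.
have c0 : 0 < c by rewrite sqrtr_gt0.
have c2 : c ^+ 2 = s by rewrite sqr_sqrtr// ltW.
have c1 : `|1 - c| <= 3 * n%:R * r.
  apply: le_trans s1; rewrite -c2 distrC.
  have -> : c ^+ 2 - 1 = (c - 1) * (c + 1) by ring.
  by rewrite normrM ler_peMr// ger0_norm; lra.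
have v1 : `|(tnth (N x) i : R)| <= 1.
  by have := coord_le1 i (dotv_tnormalize x); rewrite mxE.
have vE : (tnth (N x) i : R) * c = tnth x i by rewrite tnth_mktuple -/s -/c mulfVK// gt_eqF.
have -> : (tnth (N x) i : R) - u i 0
    = ((tnth x i : R) - u i 0) + (tnth (N x) i : R) * (1 - c) by rewrite -vE; ring.
apply: (le_trans (ler_normD _ _)); rewrite normrM.
have h1 : `|(tnth x i : R) - u i 0| <= r by exact: bx.
have h2 : `|(tnth (N x) i : R)| * `|1 - c| <= 1 * `|1 - c| by rewrite ler_wpM2r.
have h3 : r <= n%:R * r by rewrite ler_peMl// ltW.
rewrite -/q -rq; lra.
Qed.

Lemma utility_cap G (s : R) (v : 'cV[R]_n) : 0 <= s <= n%:R -> dotv v v <= 1 ->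
  (forall i, `|v i 0 - u i 0| <= (n%:R ^+ 3)^-1) ->
  utility (adjmx R G) (unit_ones R n) s u - 4 <= utility (adjmx R G) (unit_ones R n) s v.
Proof.
move=> /andP[s0 sn] v1 hv.
have nz : n%:R != 0 :> R by rewrite gt_eqF// (lt_le_trans _ nR).
have np : 0 < n%:R :> R by rewrite (lt_le_trans _ nR).
set q := (n%:R ^+ 3)^-1 in hv.
have u1 j : `|u j 0| <= 1 by apply: coord_le1; rewrite dotv_community_vec.
have utE w : utility (adjmx R G) (unit_ones R n) s w
  = \sum_i \sum_j ((adjmx R G *m adjmx R G) i j - s ^+ 2 / n%:R) * (w i 0 * w j 0).
  rewrite /utility -quad_sqr_mx ?adjmx_sym// dotv_unit_ones_sqr.
  have -> : s ^+ 2 * ((\sum_i w i 0) ^+ 2 / n%:R)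
      = \sum_i \sum_j s ^+ 2 / n%:R * (w i 0 * w j 0).
    set S := \sum_i w i 0; rewrite (_ : _ * _ = s ^+ 2 / n%:R * (S * S)); last by ring.
    rewrite {1}/S mulr_suml mulr_sumr; apply: eq_bigr => i _.
    by rewrite mulr_sumr mulr_sumr.
  rewrite /quad -sumrB; apply: eq_bigr => i _; rewrite -sumrB; apply: eq_bigr => j _; ring.
rewrite lerBlDr -lerBlDl !utE -sumrB.
apply: (@le_trans _ _ (\sum_(i < n) \sum_(j < n) (2 * n%:R * (2 * q)))).
  apply: ler_sum => i _; rewrite -sumrB; apply: ler_sum => j _.
  rewrite -mulrBr; apply: (le_trans (ler_norm _)); rewrite normrM ler_pM//.
    apply: (le_trans (ler_normB _ _)).
    have h1 : `|(adjmx R G *m adjmx R G) i j| <= n%:R.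
      by rewrite ger0_norm ?sqr_adjmx_ge0 ?sqr_adjmx_le.
    have h2 : `|s ^+ 2 / n%:R| <= n%:R.
      rewrite ger0_norm ?divr_ge0 ?sqr_ge0// ler_pdivrMr// expr2.
      exact: ler_pM.
    lra.
  have -> : u i 0 * u j 0 - v i 0 * v j 0
    = - ((v i 0 - u i 0) * u j 0 + v i 0 * (v j 0 - u j 0)) by ring.
  rewrite normrN; apply: (le_trans (ler_normD _ _)); rewrite !normrM.
  have h1 : `|v i 0 - u i 0| * `|u j 0| <= q * 1 by rewrite ler_pM.
  have h2 : `|v i 0| * `|v j 0 - u j 0| <= 1 * q by rewrite ler_pM ?coord_le1.
  lra.
rewrite !sumr_const !card_ord /q.
by rewrite le_eqVlt; apply/orP; left; apply/eqP; field.
Qed.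

End Cap.

Section GoodGraph.
Variables (R : realType) (n : nat) (B : 'M[R]_2) (theta : {ffun 'I_n -> 'I_2}).
Hypotheses (n0 : (0 < n)%N) (bal : balanced R theta) (Bpar : sbm_parameter B).
Hypotheses (B11 : B 0 0 = B 1 1) (B10 : B 0 1 = B 1 0).
Notation e := (unit_ones R n).
Notation u := (community_vec R theta).
Notation noise := (noise B theta).
Notation N := (@tnormalize R n).
Implicit Types G : graph n.

Definition eig1 : R := n%:R * (B 0 0 + B 0 1) / 2.
Definition eig2 : R := n%:R * (B 0 0 - B 0 1) / 2.

Lemma ord2P (j : 'I_2) : j = 0 \/ j = 1.
Proof. by case: j => [[|[|//]] hj]; [left|right]; apply: val_inj. Qed.

Lemma prob_mx_side i j :
  prob_mx B theta i j = (B 0 0 + B 0 1) / 2 + (B 0 0 - B 0 1) / 2 * (side R (theta i) * side R (theta j)).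
Proof.
rewrite mxE /side; case: (ord2P (theta i)) => ->; case: (ord2P (theta j)) => -> /=.
- by field.
- by field.
- by rewrite -B10; field.
- by rewrite -B11; field.
Qed.

(** With its diagonal the matrix of edge probabilities has rank two. *)
Lemma adjmx_decomp G v : adjmx R G *m v
  = (eig1 * dotv e v) *: e + (eig2 * dotv u v) *: u + noise G *m v.
Proof.
have -> : adjmx R G = prob_mx B theta + noise G by rewrite /noise addrC subrK.
rewrite mulmxDl; congr (_ + _); apply/matrixP => i k; rewrite ord1 [LHS]mxE.
rewrite [RHS]mxE [X in _ = X + _]mxE [X in _ = _ + X]mxE.
pose q : R := (Num.sqrt n%:R)^-1.
have nq : n%:R * q ^+ 2 = 1 by rewrite exprVn sqr_sqrtr// mulfV// pnatr_eq0 -lt0n.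
rewrite /dotv !mulr_sumr !mulr_suml -big_split; apply: eq_bigr => j _ /=.
rewrite prob_mx_side !mxE -/q.
set a := B 0 0; set b := B 0 1; set v_ := v j 0.
set si := side R _; set sj := side R _.
rewrite -[LHS]mulr1 -[X in _ * X = _]nq /eig1 /eig2 -/a -/b; by field.
Qed.

Variables (eps D gamma g : R) (sol : kmeans_solver R n).
Hypotheses (eps0 : 0 < eps) (D0 : 0 < D).
Hypotheses (solP : approx_solver gamma sol) (gg : gamma <= g) (g1 : -1 <= g).

Lemma weight_utility G s x : (forall i, degree R G i <= D) ->
  weight eps D G s (N x) = expR (inv_temp eps D *
    (entry_sum (adjmx R G *m adjmx R G) + utility (adjmx R G) e s (colv (N x)))).
Proof.
move=> hdeg; rewrite weightE.
rewrite (lip_ext_untruncated (@sqr_adjmx_ge0 R n G)).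
- rewrite (quad_sqr_mx _ (adjmx_sym R G)); congr (expR (_ * _)).
  rewrite /utility dotv_unit_ones_sqr.
  under [in RHS]eq_bigr do rewrite mxE.
  set X := dotv _ _; set Y := entry_sum _; ring.
- by rewrite trmx_mul adjmx_sym.
- exact: row_sqr_adjmx.
- exact: dotv_tnormalize.
Qed.

Variables (G : graph n) (s om C1 K tau r : R).
Hypotheses (hdeg : forall i, degree R G i <= D) (s_bd : 0 <= s <= n%:R).
Hypothesis noise_op : forall v, dotv (noise G *m v) (noise G *m v) <= om * dotv v v.
Hypothesis om_eig2 : om <= eig2 ^+ 2 / 16.
Hypothesis s_eig2 : `|eig1 ^+ 2 - s ^+ 2| <= eig2 ^+ 2 / 8.
Hypothesis eig1_eig2 : eig1 ^+ 2 <= C1 * eig2 ^+ 2.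
Hypothesis eig2_neq0 : eig2 != 0.
Hypothesis noise_eig : 9 * dotv (noise G *m u) (noise G *m u)
  + 8 * C1 * dotv (noise G *m e) (noise G *m e) <= K.
Hypothesis tau1 : 0 <= tau < 1.
Hypothesis tau_small : 4 * (2 + g) * tau < 2^-1.
Hypothesis tau_r : 16 * (2 + g) * tau <= r.

Let S := [set t : {ffun 'I_n -> 'I_2} | loss R t theta <= r]%SET.
Let T := entry_sum (adjmx R G *m adjmx R G).
Let U := utility (adjmx R G) e s.
Let beta := inv_temp eps D.

(** Contraposition of [loss_ple_labels], then [utility_gap]. *)
Lemma utility_bad x : ~~ in_output sol S (N x) ->
  U (colv (N x)) <= U u - tau * (eig2 ^+ 2 / 2) + K.
Proof.
move=> notS; set v := colv (N x).
have v1 : dotv v v <= 1 := dotv_tnormalize x.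
have tm : tau <= 1 - dotv u v ^+ 2.
  rewrite leNgt; apply/negP => mt; move/negP: notS; apply.
  have g2 : 0 <= 2 + g by have := g1; lra.
  have mt' : (2 + g) * (1 - dotv u v ^+ 2) <= (2 + g) * tau by rewrite ler_wpM2l// ltW.
  rewrite /in_output inE; apply: le_trans tau_r.
  apply: le_trans (loss_ple_labels n0 bal solP gg g1 v1 _ _) _.
  - apply: le_lt_trans tau_small; rewrite -!mulrA ler_pM2l//.
  - by case/andP: tau1 => _; exact: lt_trans.
  - by rewrite -!mulrA ler_pM2l.
have := utility_gap (dotv_unit_ones R n0) (dotv_community_vec R theta n0)
  (dotv_ones_community bal) (noise_sym theta Bpar G) (adjmx_decomp G)
  noise_op om_eig2 s_eig2 eig1_eig2 eig2_neq0 v1.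
rewrite -/(U v) -/(U u) => h; apply: (le_trans h).
have e2 : 0 <= eig2 ^+ 2 / 2 by rewrite divr_ge0 ?sqr_ge0.
have := noise_eig; have := ler_wpM2r e2 tm; lra.
Qed.

(** The exponential mechanism in its usual form: the posterior mass of the bad
    labellings is at most its largest density, over a lower bound of the density
    on the cap times the mass of the cap. *)
Lemma cond_prob_good :
  1 - expR (- (beta * (tau * (eig2 ^+ 2 / 2) - K - 4))) / (2 * gauss_low R * cap_radius R n) ^+ n
    <= ple_cond_prob eps D sol G s S.
Proof.
have b0 : 0 <= beta := inv_temp_ge0 eps0 D0.
have nR : 1 <= n%:R :> R by rewrite -[1]/(1%:R) ler_nat.
set mass := _ ^+ n.
have rad0 : 0 < cap_radius R n.
  by rewrite invr_gt0 mulr_gt0// exprn_gt0// (lt_le_trans _ nR).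
have rad1 : cap_radius R n <= 1.
  by rewrite invf_le1 ?mulr_gt0 ?exprn_gt0 ?(lt_le_trans _ nR)//; have := exprn_ege1 4 nR; lra.
have mass0 : 0 < mass by rewrite exprn_gt0// mulr_gt0// mulr_gt0// gauss_low_gt0.
pose lo := expR (beta * (T + (U u - 4))).
have total_ge : lo * mass <= post_mass eps D sol G s [set: _]%SET.
  apply: (@post_mass_box _ _ _ _ _ _ eps0 D0 solP G s (fun i => u i 0)).
  - by move=> i; apply: coord_le1; rewrite dotv_community_vec.
  - by rewrite (ltW rad0).
  - exact: expR_ge0.
  move=> x bx; rewrite weight_utility// /lo ler_expR ler_wpM2l// lerD2l.
  apply: utility_cap => //; first exact: dotv_tnormalize.
  by move=> i; rewrite mxE; exact: tnormalize_cap.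
pose hi := expR (beta * (T + (U u - tau * (eig2 ^+ 2 / 2) + K))).
have bad_le : post_mass eps D sol G s (~: S)%SET <= hi.
  suff : 0 <= post_mass eps D sol G s (~: S)%SET <= hi by case/andP.
  apply: Rintegral_bounded => [|x]; first by apply: (measurable_post_integrand _ _ solP).
  rewrite mulr_ge0 ?(ltW (weight_gt0 _ _ _ _ _))//=.
  rewrite /in_output finset.in_setC -/(in_output sol S (N x)).
  case: (boolP (in_output sol S (N x))) => /= hx; first by rewrite mulr0 expR_ge0.
  rewrite mulr1 weight_utility// /hi ler_expR ler_wpM2l// lerD2l.
  exact: utility_bad.
rewrite (ple_cond_probE _ _ solP).
have pos := post_massT_gt0 eps0 D0 solP G s.
have := post_massU eps0 D0 solP G s S.
move: pos total_ge bad_le.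
move: (post_mass _ _ _ _ _ [set: _]%SET) (post_mass _ _ _ _ _ S)
  (post_mass _ _ _ _ _ (~: S)%SET) => t a b t0 lot bhi tE.
have lo0 : 0 < lo by exact: expR_gt0.
have hilo : expR (- (beta * (tau * (eig2 ^+ 2 / 2) - K - 4))) = hi / lo.
  by rewrite /hi /lo -expRN -expRD; congr expR; ring.
rewrite ler_pdivlMr// mulrBl mul1r hilo lerBlDr {1}tE lerD2l (le_trans bhi)//.
have h : hi * (lo * mass) <= hi * t by rewrite ler_wpM2l ?expR_ge0.
have -> : hi / lo / mass * t = (hi * t) / (lo * mass) by field; rewrite !gt_eqF.
by rewrite ler_pdivlMr// mulr_gt0.
Qed.

End GoodGraph.

(** * Quantitative recovery for large n *)
Section LogBounds.
Variable R : realType.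

Lemma expR_ge_id (x : R) : x <= expR x.
Proof. by have := expR_ge1Dx x; lra. Qed.

Lemma expR_ln_nat (n : nat) (L : R) : (0 < n)%N -> L = ln n%:R -> expR L = n%:R.
Proof. by move=> n0 ->; rewrite lnK// posrE ltr0n. Qed.

Lemma density_facts (n : nat) (d L : R) : (0 < n)%N -> 1 <= L ->
  Num.sqrt n%:R * L ^+ 2 < d ->
  [/\ L ^+ 4 * n%:R <= d ^+ 2, Num.sqrt n%:R <= d, L ^+ 2 <= d, L <= Num.sqrt d & 1 <= d].
Proof.
move=> n0 L1 hd.
have nR : 1 <= n%:R :> R by rewrite -[1]/(1%:R) ler_nat.
have s1 : 1 <= Num.sqrt n%:R :> R by rewrite -[leLHS]sqrtr1 ler_sqrt// ltr0n.
have sn : Num.sqrt n%:R ^+ 2 = n%:R :> R by rewrite sqr_sqrtr.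
set q := Num.sqrt n%:R in hd s1 sn *.
have L2 : 1 <= L ^+ 2 by rewrite exprn_ege1.
have qL0 : 0 <= q * L ^+ 2 by rewrite mulr_ge0; lra.
have d0 : 0 <= d by lra.
have qd : q <= d by rewrite (le_trans _ (ltW hd))// ler_peMr//; lra.
have Ld : L ^+ 2 <= d by rewrite (le_trans _ (ltW hd))// ler_peMl//; lra.
split => //; last by lra.
- rewrite (_ : L ^+ 4 * n%:R = (q * L ^+ 2) ^+ 2); last by rewrite -sn; ring.
  by rewrite ler_pXn2r ?nnegrE// ltW.
- by rewrite -[leLHS]ger0_norm ?sqrtr_ge0 -?sqrtr_sqr ?ler_sqrt//; lra.
Qed.

End LogBounds.

Section BadGraphs.
Variables (R : realType) (n : nat) (B : 'M[R]_2) (theta : {ffun 'I_n -> 'I_2}).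
Implicit Types G : graph n.
Notation e := (unit_ones R n).
Notation u := (community_vec R theta).
Notation noise := (noise B theta).
Notation prob := (prob B theta).

(** The last two conditions have the threshold d^(3/2) while the mean is d: the
    gap sqrt d is the price of Markov's inequality, and d^(3/2) relative to the
    curvature d^2 is the term 1 / sqrt d of the rate. *)
Definition good_graph (d s : R) G : bool :=
  [&& [forall i, degree R G i < 3 * d],
      [forall ij : 'I_n * 'I_n, (ij.1 != ij.2) ==> (`|cross B theta G ij.1 ij.2| < s)],
      dotv (noise G *m u) (noise G *m u) < d * Num.sqrt d
    & dotv (noise G *m e) (noise G *m e) < d * Num.sqrt d].

Lemma prob_bad_graph (p t s L : R) : let d := n%:R * p in
  (0 < n)%N -> sbm_parameter B -> (forall i j, prob_mx B theta i j <= p) ->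
  0 <= t <= 2^-1 -> 0 < d -> L = ln n%:R -> 2 * L <= d / 2 ->
  n%:R * (2 * t ^+ 2 * p ^+ 2) - t * s <= - (3 * L) ->
  prob (fun G => ~~ good_graph d s G) <= 3 / n%:R + 2 / Num.sqrt d.
Proof.
move=> d n0 Bpar Pp t01 d0 LE Ld hs.
have nR : 0 < n%:R :> R by rewrite ltr0n.
have eL : expR L = n%:R by exact: expR_ln_nat.
have sd0 : 0 < Num.sqrt d by rewrite sqrtr_gt0.
have sd2 : Num.sqrt d * Num.sqrt d = d by rewrite -expr2 sqr_sqrtr// ltW.
have dsd : 0 < d * Num.sqrt d := mulr_gt0 d0 sd0.
pose bad1 G := [exists i, 3 * d <= degree R G i].
pose bad2 G := [exists ij : 'I_n * 'I_n, (ij.1 != ij.2) && (s <= `|cross B theta G ij.1 ij.2|)].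
pose bad3 (x : 'cV[R]_n) G := d * Num.sqrt d <= dotv (noise G *m x) (noise G *m x).
have h1 : prob bad1 <= n%:R^-1.
  apply: (le_trans (prob_union _ _ _)) => //.
  apply: (@le_trans _ _ (\sum_(i < n) expR (- (2 * L)))).
    apply: ler_sum => i _; apply: (le_trans (degree_tail Bpar Pp i)).
    by rewrite ler_expR lerN2.
  rewrite sumr_const card_ord -[leLHS]mulr_natl expRN expRM_natl eL.
  by rewrite le_eqVlt; apply/orP; left; apply/eqP; field; rewrite gt_eqF.
have h2 : prob bad2 <= 2 / n%:R.
  apply: (le_trans (prob_union _ _ _)) => //.
  apply: (@le_trans _ _ (\sum_(ij : 'I_n * 'I_n) (2 * expR (- (3 * L))))).
    apply: ler_sum => -[i j] _ /=; case: (boolP (i != j)) => /= ij.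
      apply: (le_trans (cross_tail Bpar Pp s ij t01)).
      by rewrite ler_pM2l// ler_expR.
    by rewrite /prob expect_cst mulr_ge0// expR_ge0.
  rewrite sumr_const card_prod card_ord -[leLHS]mulr_natl natrM expRN expRM_natl eL.
  by rewrite le_eqVlt; apply/orP; left; apply/eqP; field; rewrite gt_eqF.
have h3 x : dotv x x = 1 -> prob (bad3 x) <= (Num.sqrt d)^-1.
  move=> xx; apply: (le_trans (@markov_expect _ _ _ _ _ Bpar (bad3 x)
     (fun G => dotv (noise G *m x) (noise G *m x)) (d * Num.sqrt d) _ _ _)) => //.
  - by move=> G; exact: dotv_ge0.
  - rewrite ler_pdivrMr// (le_trans (expect_noise_vec Bpar Pp x))// xx mulr1.
    by rewrite mulrCA mulVf ?mulr1// gt_eqF.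
apply: (@le_trans _ _ (prob (fun G => (bad1 G || bad2 G) || (bad3 u G || bad3 e G)))).
  apply: expect_le => // G; rewrite ler_nat.
  case: (boolP (good_graph d s G)) => //= /negP h.
  suff -> : bad1 G || bad2 G || (bad3 u G || bad3 e G) by [].
  apply/negP => /negP; rewrite !negb_or => /andP[/andP[b1 b2] /andP[b3 b4]].
  apply: h; apply/and4P; split; rewrite ?ltNge//.
    apply/forallP => i; rewrite ltNge; apply: contra b1 => h.
    by apply/existsP; exists i.
  apply/forallP => ij; apply/implyP => ij'; rewrite ltNge; apply: contra b2 => h.
  by apply/existsP; exists ij; rewrite ij'.
apply: (le_trans (prob_or _ _ _ _)) => //.
have := prob_or theta Bpar bad1 bad2; have := prob_or theta Bpar (bad3 u) (bad3 e).
have := h3 _ (dotv_community_vec R theta n0); have := h3 _ (dotv_unit_ones R n0).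
lra.
Qed.

End BadGraphs.

Section Constants.
Variable R : realType.

(** With k the relative separation of the densities, l2 >= k d / 2; the noise term
    of the utility gap, at most (13 + 32 / k^2) d^(3/2), is then dominated by
    tau k^2 d^2 / 8 for tau = rate_const k / sqrt d. *)
Definition rate_const (k : R) : R := 8 / k ^+ 2 * (13 + 32 / k ^+ 2).

(** How large ln n has to be.  The four terms serve, in this order, the
    concentration of the noise, the mass of the cap, the smallness of tau that
    k-means rounding needs, and the absolute constants. *)
Definition log_threshold (k g : R) : R :=
  10 ^+ 6 / k ^+ 4 + 2 / gauss_low R + 100 * (2 + g) * rate_const k + 100.

Lemma rate_const_bound k : 0 < k <= 1 -> 0 < rate_const k /\ 288 <= k ^+ 2 * rate_const k.
Proof.
move=> /andP[k0 k1]; have k2 : 0 < k ^+ 2 by rewrite exprn_gt0.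
have k21 : k ^+ 2 <= 1 by rewrite exprn_ile1// ltW.
have h : 1 <= (k ^+ 2)^-1 by rewrite invf_ge1.
split; first by rewrite mulr_gt0 ?divr_gt0//; lra.
rewrite /rate_const (_ : _ * _ = 8 * (13 + 32 * (k ^+ 2)^-1)); last by field; rewrite gt_eqF.
lra.
Qed.

Lemma log_threshold_facts k g L : 0 < k <= 1 -> 0 <= g -> log_threshold k g <= L ->
  [/\ 10 ^+ 6 <= k ^+ 4 * L, 2 <= gauss_low R * L,
      100 * (2 + g) * rate_const k <= L & 100 <= L].
Proof.
move=> k01 g0; have [K0 _] := rate_const_bound k01; have /andP[k0 k1] := k01.
have k4 : 0 < k ^+ 4 by rewrite exprn_gt0.
have g1 := gauss_low_gt0 R.
have h1 : 0 <= 10 ^+ 6 / k ^+ 4 by rewrite divr_ge0 ?exprn_ge0// ltW.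
have h2 : 0 <= 2 / gauss_low R by rewrite divr_ge0// ltW.
have h3 : 0 <= 100 * (2 + g) * rate_const k.
  by apply: mulr_ge0; [apply: mulr_ge0 => //; lra|exact: ltW].
rewrite /log_threshold => hL; split.
- by rewrite mulrC -ler_pdivrMr//; lra.
- by rewrite mulrC -ler_pdivrMr//; lra.
- lra.
- lra.
Qed.

End Constants.

Section Recovery.
Variables (R : realType) (n : nat) (B : 'M[R]_2) (theta : {ffun 'I_n -> 'I_2}).
Implicit Types G : graph n.
Notation e := (unit_ones R n).
Notation u := (community_vec R theta).

Lemma density_scale (k L d : R) : 0 < k <= 1 -> 1 <= L -> 0 < d -> 0 <= n%:R :> R ->
  10 ^+ 6 <= k ^+ 4 * L -> L ^+ 4 * n%:R <= d ^+ 2 -> L <= Num.sqrt d -> L ^+ 2 <= d ->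
  [/\ 10 ^+ 6 * L * n%:R <= k ^+ 4 * d ^+ 2, k ^+ 4 * d ^+ 2 <= k ^+ 2 * d ^+ 2,
      4 * 10 ^+ 4 <= k ^+ 4 * Num.sqrt d & 200 <= k ^+ 2 * d].
Proof.
move=> /andP[k0 k1] L1 d0 n0 kL dL sL Ld.
have k4 : 0 < k ^+ 4 by rewrite exprn_gt0.
have k2 : 0 < k ^+ 2 by rewrite exprn_gt0.
have k21 : k ^+ 2 <= 1 by rewrite exprn_ile1// ltW.
have k42 : k ^+ 4 <= k ^+ 2.
  by rewrite (_ : k ^+ 4 = k ^+ 2 * k ^+ 2); [rewrite ler_piMr// ltW|ring].
have L3 : L <= L ^+ 3 by rewrite -[leLHS]expr1 ler_weXn2l.
have L12 : L <= L ^+ 2 by rewrite -[leLHS]expr1 ler_weXn2l.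
split.
- apply: (@le_trans _ _ (k ^+ 4 * (L ^+ 4 * n%:R))); last by rewrite ler_pM2l.
  rewrite (_ : k ^+ 4 * (L ^+ 4 * n%:R) = (k ^+ 4 * L * L ^+ 3) * n%:R); last by ring.
  by rewrite ler_wpM2r// ler_pM// ?exprn_ge0// (le_trans _ L1).
- by rewrite ler_pM2r// exprn_gt0.
- have : k ^+ 4 * L <= k ^+ 4 * Num.sqrt d by rewrite ler_pM2l.
  lra.
- have : k ^+ 4 * L <= k ^+ 2 * d by apply: ler_pM => //; lra.
  lra.
Qed.


Lemma avg_degree_eig G : (0 < n)%N -> balanced R theta -> B 0 0 = B 1 1 -> B 0 1 = B 1 0 ->
  avg_degree R G = eig1 n B + dotv e (noise B theta G *m e).
Proof.
move=> n0 bal B11 B10.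
have eu : dotv e u = 0 := dotv_ones_community bal.
have ee : dotv e e = 1 := dotv_unit_ones R n0.
transitivity (dotv e (adjmx R G *m e)).
  pose q : R := (Num.sqrt n%:R)^-1.
  have q2 : n%:R^-1 = q * q by rewrite -expr2 exprVn sqr_sqrtr.
  rewrite /avg_degree /dotv mulr_suml; apply: eq_bigr => i _.
  rewrite [X in _ = X * _]mxE [X in _ = _ * X]mxE -/q mulr_suml mulr_sumr.
  by apply: eq_bigr => j _; rewrite [X in _ = _ * (_ * X)]mxE -/q q2; ring.
rewrite (adjmx_decomp theta n0 B11 B10) !dotE ee (dotvC u e) eu; ring.
Qed.

Lemma clip_close (x y : R) : 0 <= y <= n%:R -> `|clip n x - y| <= `|x - y|.
Proof.
move=> /andP[y0 yn]; rewrite /clip.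
have h1 := ler_norm (x - y); have h2 := ler_norm (- (x - y)); rewrite normrN in h2.
rewrite ler_norml; case: (leP x n%:R) => xn.
  by case: (leP 0 x) => x0; apply/andP; split; lra.
by case: (leP 0 n%:R) => x0; apply/andP; split; lra.
Qed.

Lemma clip_bd (x : R) : 0 <= clip n x <= n%:R.
Proof.
by rewrite /clip le_max lexx /= ge_max ler0n /= ge_min lexx orbT.
Qed.

Lemma eig2_lower (p k : R) : 0 <= p -> 0 < k -> k * p <= `|B 0 0 - B 0 1| ->
  k ^+ 2 * (n%:R * p) ^+ 2 / 4 <= eig2 n B ^+ 2.
Proof.
move=> p0 k0 h.
have h2 : (k * p) ^+ 2 <= (B 0 0 - B 0 1) ^+ 2.
  by rewrite -[leRHS]real_normK ?num_real// ler_pXn2r ?nnegrE// mulr_ge0// ltW.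
have n2 : 0 <= n%:R ^+ 2 / 4 :> R by rewrite divr_ge0// exprn_ge0.
have := ler_wpM2l n2 h2.
rewrite /eig2 (_ : n%:R ^+ 2 / 4 * (k * p) ^+ 2 = k ^+ 2 * (n%:R * p) ^+ 2 / 4); last by field.
by rewrite (_ : n%:R ^+ 2 / 4 * _ = (n%:R * (B 0 0 - B 0 1) / 2) ^+ 2)//; field.
Qed.

(** The average degree is l1 + <e, W e>, so the input s differs from E = l1 by
    at most |x| + 1, where x = <e, W e> and 1 bounds the Laplace noise. *)
Lemma sigma_close (d k E s x : R) : 0 < d -> 0 < k <= 1 -> 0 <= E <= d ->
  `|s - E| <= `|x| + 1 -> x ^+ 2 <= d * Num.sqrt d ->
  4 * 10 ^+ 4 <= k ^+ 4 * Num.sqrt d -> 200 <= k ^+ 2 * d ->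
  `|E ^+ 2 - s ^+ 2| <= k ^+ 2 * d ^+ 2 / 32.
Proof.
move=> d0 /andP[k0 k1] /andP[E0 Ed] sE xd kd kd2.
have k2 : 0 < k ^+ 2 by rewrite exprn_gt0.
have k21 : k ^+ 2 <= 1 by rewrite exprn_ile1// ltW.
have sd2 : Num.sqrt d * Num.sqrt d = d by rewrite -expr2 sqr_sqrtr// ltW.
have sd0 : 0 < Num.sqrt d by rewrite sqrtr_gt0.
pose y := k ^+ 2 * d.
have y0 : 0 < y by rewrite mulr_gt0.
have yd : y <= d by rewrite /y ler_piMl// ltW.
have hx : `|x| <= y / 200.
  apply: ler_of_sqr; first by rewrite divr_ge0// ltW.
  rewrite real_normK ?num_real// (le_trans xd)// /y.
  have := ler_wpM2l (ltW (mulr_gt0 d0 sd0)) kd.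
  rewrite (_ : d * Num.sqrt d * (k ^+ 4 * Num.sqrt d) = k ^+ 4 * d * (Num.sqrt d * Num.sqrt d));
    last by ring.
  rewrite sd2; lra.
have hy : `|s - E| <= y / 100 by rewrite /y in hx *; lra.
have -> : E ^+ 2 - s ^+ 2 = - ((s - E) * (2 * E + (s - E))) by ring.
rewrite normrN normrM.
have h3 : `|2 * E + (s - E)| <= 3 * d.
  apply: (le_trans (ler_normD _ _)); rewrite ger0_norm; last by lra.
  lra.
apply: (le_trans (ler_pM (normr_ge0 _) (normr_ge0 _) hy h3)).
have : 0 <= y * d by rewrite mulr_ge0// ltW.
rewrite /y; lra.
Qed.

(** The hypothesis of [noise_operator_norm] with target norm
    k^2 d^2 / 64 <= l2^2 / 16.  Half of the level k^2 d^2 / (100 n) of the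
    entries of W^2 is for the sum [cross], the other half for the constant 2
    that bounds the two remaining terms. *)
Lemma noise_norm_budget (k d s : R) : 0 < k <= 1 -> 0 < d -> 0 < n%:R :> R ->
  s = k ^+ 2 / 200 * (d ^+ 2 / n%:R) -> 400 * n%:R <= k ^+ 2 * d ^+ 2 ->
  10 ^+ 6 * n%:R <= k ^+ 4 * d ^+ 2 ->
  n%:R * (4 * d) ^+ 2 + n%:R ^+ 2 * (s + 2) ^+ 2 <= (k ^+ 2 * d ^+ 2 / 64) ^+ 2.
Proof.
move=> /andP[k0 k1] d0 nR sE h1 h2.
have s2 : n%:R * (s + 2) <= k ^+ 2 * d ^+ 2 / 100.
  rewrite sE mulrDr (_ : n%:R * (_ * _) = k ^+ 2 * d ^+ 2 / 200); last by field; rewrite gt_eqF.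
  lra.
have s0 : 0 <= n%:R * (s + 2).
  by rewrite mulr_ge0// ?ltW// sE ltr_wpDl// mulr_ge0 ?divr_ge0 ?sqr_ge0// ltW.
have h3 : (n%:R * (s + 2)) ^+ 2 <= (k ^+ 2 * d ^+ 2 / 100) ^+ 2.
  by rewrite ler_pXn2r// ?nnegrE// (le_trans s0).
have d2 : 0 <= d ^+ 2 := sqr_ge0 d.
have := ler_wpM2r d2 h2.
have h4 : 0 <= k ^+ 4 * d ^+ 4 by rewrite mulr_ge0 ?exprn_ge0// ltW.
rewrite exprMn in h3; move: h3 h4.
lra.
Qed.

End Recovery.

Section Regime.
Variable R : realType.

Definition error_rate (d D eps : R) : R := 1 / Num.sqrt d + D ^+ 2 / eps.

Definition cross_level (n : nat) (k d : R) : R := k ^+ 2 / 200 * (d ^+ 2 / n%:R).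

(** All that is asked of a fixed n: p bounds the edge probabilities, d = n p the
    expected degrees, k is the relative separation of the two densities, g
    bounds the k-means error gamma, and L = ln n.  The separation is taken in
    absolute value because a scaling B = a B0 with a negative factor reverses
    the order of the two densities. *)
Definition regime (n : nat) (B : 'M[R]_2) (theta : {ffun 'I_n -> 'I_2})
    (k g p d L D eps gamma : R) (sol : kmeans_solver R n) : Prop :=
  [/\ [/\ (0 < n)%N, balanced R theta, sbm_parameter B, B 0 0 = B 1 1 & B 0 1 = B 1 0],
      [/\ d = n%:R * p, forall i j, B i j <= p, p <= 1, k * p <= `|B 0 0 - B 0 1| & 0 < k <= 1],
      [/\ approx_solver gamma sol, gamma <= g & 0 <= g]
    & [/\ L = ln n%:R, log_threshold k g <= L, Num.sqrt n%:R * L ^+ 2 < d,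
          3 * d <= D & D ^+ 2 * L < eps]].

Definition accurate (n : nat) (theta : {ffun 'I_n -> 'I_2}) (r : R) :
  {set {ffun 'I_n -> 'I_2}} := [set t | loss R t theta <= r]%SET.

End Regime.

Lemma regime_facts (R : realType) (n : nat) (B : 'M[R]_2) (theta : {ffun 'I_n -> 'I_2})
    (k g p d L D eps gamma : R) (sol : kmeans_solver R n) :
  regime B theta k g p d L D eps gamma sol ->
  [/\ 0 < p, 100 <= L, 1 <= n%:R :> R & [/\ 1 <= d, L <= Num.sqrt d, 0 < D, 0 < eps & error_rate d D eps <= 2 / L]].
Proof.
move=> [[n0 bal Bpar B11 B10] [dE Bp p1 kp k01] [solP gg g0] [LE thr dens Dd Deps]].
have [_ _ _ L100] := log_threshold_facts k01 g0 thr.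
have p0 : 0 < p.
  by have [/(_ 0 0)/andP[h _] _ _] := Bpar; exact: lt_le_trans (Bp 0 0).
have nR : 1 <= n%:R :> R by rewrite -[1]/(1%:R) ler_nat.
have L1 : 1 <= L by lra.
have [_ _ _ Ls d1] := density_facts n0 L1 dens.
have D0 : 0 < D by lra.
have eps0 : 0 < eps.
  by apply: le_lt_trans Deps; rewrite mulr_ge0 ?sqr_ge0//; lra.
have Lp : 0 < L by lra.
split => //; split => //.
rewrite /error_rate (_ : 2 / L = 1 / L + L^-1); last by field; rewrite gt_eqF.
apply: lerD; first by rewrite !div1r lef_pV2 ?posrE// (lt_le_trans Lp).
by rewrite ler_pdivrMr// mulrC ler_pdivlMr// ltW.
Qed.

(** The part 1 / sqrt d of the rate absorbs K; the part D^2 / eps, multiplied by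
    the curvature d^2 and by eps / D^2, leaves a multiple of d^2, which exceeds
    n ln^4 n. *)
Lemma posterior_exponent (R : realType) (n : nat) (B : 'M[R]_2) (theta : {ffun 'I_n -> 'I_2})
    (k g p d L D eps gamma : R) (sol : kmeans_solver R n) (K : R) :
  regime B theta k g p d L D eps gamma sol ->
  K <= (13 + 32 / k ^+ 2) * (d * Num.sqrt d) ->
  6 * n%:R * L <= inv_temp eps D *
    (rate_const k * error_rate d D eps * (eig2 n B ^+ 2 / 2) - K).
Proof.
move=> reg hK.
have [[n0 bal Bpar B11 B10] [dE Bp p1 kp k01] [solP gg g0] [LE thr dens Dd Deps]] := reg.
have [p0 L100 nR [d1 Ls D0 eps0 rL]] := regime_facts reg.
have [rc0 rc1] := rate_const_bound k01.
have [k0 k1] := andP k01.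
have L1 : 1 <= L by lra.
have [d2 _ _ _ _] := density_facts n0 L1 dens.
have d0 : 0 < d by lra.
have sd0 : 0 < Num.sqrt d by rewrite sqrtr_gt0.
have k2 : 0 < k ^+ 2 by rewrite exprn_gt0.
have D2 : 0 < D ^+ 2 by rewrite exprn_gt0.
have e2 : k ^+ 2 * d ^+ 2 / 8 <= eig2 n B ^+ 2 / 2.
  by have := eig2_lower n (ltW p0) k0 kp; rewrite -?dE; lra.
have sd2 : Num.sqrt d * Num.sqrt d = d by rewrite -expr2 sqr_sqrtr// ltW.
have rate0 : 0 <= error_rate d D eps by rewrite addr_ge0 ?divr_ge0 ?ltW.
have main : (rate_const k * k ^+ 2 / 8) * (d * Num.sqrt d + d ^+ 2 * (D ^+ 2 / eps))
    <= rate_const k * error_rate d D eps * (eig2 n B ^+ 2 / 2).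
  have -> : (rate_const k * k ^+ 2 / 8) * (d * Num.sqrt d + d ^+ 2 * (D ^+ 2 / eps))
      = rate_const k * error_rate d D eps * (k ^+ 2 * d ^+ 2 / 8).
    rewrite /error_rate; move: (Num.sqrt d) sd0 sd2 => y y0 <-.
    by field; rewrite !gt_eqF.
  by rewrite ler_wpM2l// mulr_ge0// ltW.
have rcK : K <= rate_const k * k ^+ 2 / 8 * (d * Num.sqrt d).
  apply: (le_trans hK); rewrite le_eqVlt; apply/orP; left; apply/eqP.
  by rewrite /rate_const; field; rewrite gt_eqF.
apply: (@le_trans _ _ (inv_temp eps D * (rate_const k * k ^+ 2 / 8 * (d ^+ 2 * (D ^+ 2 / eps))))).
  rewrite /inv_temp.
  rewrite [leRHS](_ : _ = rate_const k * k ^+ 2 / 48 * d ^+ 2); last by field; rewrite !gt_eqF.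
  have L3 : L <= L ^+ 4 by rewrite -[leLHS]expr1 ler_weXn2l.
  apply: (@le_trans _ _ (6 * d ^+ 2)).
    rewrite -mulrA ler_pM2l// (le_trans _ d2)// mulrC ler_wpM2r//; lra.
  by rewrite ler_wpM2r ?sqr_ge0//; lra.
apply: ler_wpM2l; first exact: inv_temp_ge0.
move: main; rewrite mulrDr; lra.
Qed.


(** Each coordinate contributes a constant times n^(-4); the constant is at least
    1 / n for large n. *)
Lemma cap_mass_lower (R : realType) (n : nat) (B : 'M[R]_2) (theta : {ffun 'I_n -> 'I_2})
    (k g p d L D eps gamma : R) (sol : kmeans_solver R n) :
  regime B theta k g p d L D eps gamma sol ->
  expR (- (5 * n%:R * L)) <= (2 * gauss_low R * cap_radius R n) ^+ n.
Proof.
move=> reg.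
have [[n0 _ _ _ _] [_ _ _ _ k01] [_ _ g0] [LE thr _ _ _]] := reg.
have [_ L100 nR _] := regime_facts reg.
have [_ gL _ _] := log_threshold_facts k01 g0 thr.
have eL : expR L = n%:R := expR_ln_nat n0 LE.
have Ln : L <= n%:R by rewrite -eL expR_ge_id.
have gl0 := gauss_low_gt0 R.
have n1 : 0 < n%:R :> R by lra.
have gn : 2 <= gauss_low R * n%:R.
  by apply: (le_trans gL); rewrite ler_pM2l.
rewrite (_ : 5 * n%:R * L = n%:R * (5%:R * L)); last by ring.
rewrite -mulrN expRM_natl.
have step : expR (- (5%:R * L)) <= 2 * gauss_low R * cap_radius R n.
  rewrite expRN expRM_natl eL /cap_radius.
  rewrite (_ : 2 * gauss_low R * (4 * n%:R ^+ 4)^-1 = (gauss_low R * n%:R / 2) * (n%:R ^+ 5)^-1);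
    last by field; rewrite gt_eqF.
  by apply: ler_peMl; [rewrite invr_ge0 exprn_ge0// ltW|lra].
by rewrite lerXn2r ?nnegrE ?expR_ge0// (le_trans _ step)// expR_ge0.
Qed.

(** [cond_prob_good] with tau = rate_const k * error_rate; the exponent 6 n ln n
    pays for the cap, n^(-5n), and leaves 1 / n. *)
Lemma good_graph_posterior (R : realType) (n : nat) (B : 'M[R]_2) (theta : {ffun 'I_n -> 'I_2})
    (k g p d L D eps gamma : R) (sol : kmeans_solver R n)
    (G : graph n) (x : R) :
  regime B theta k g p d L D eps gamma sol -> good_graph B theta d (cross_level n k d) G -> `|x| <= 1 ->
  1 - n%:R^-1 <= ple_cond_prob eps D sol G (clip n (avg_degree R G + x)) (accurate theta (16 * (2 + g) * rate_const k * error_rate d D eps)).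
Proof.
move=> reg good x1.
have [[n0 bal Bpar B11 B10] [dE Bp p1 kp k01] [solP gg g0] [LE thr dens Dd Deps]] := reg.
have [p0 L100 nR [d1 Ls D0 eps0 rL]] := regime_facts reg.
have [kL _ rcL _] := log_threshold_facts k01 g0 thr.
have [rc0 _] := rate_const_bound k01.
have [k0 k1] := andP k01.
have L1 : 1 <= L by lra.
have [d2 _ Ld _ _] := density_facts n0 L1 dens.
have d0 : 0 < d by lra.
have n1 : 0 < n%:R :> R by lra.
have [dn1 dn2 dn3 dn4] := density_scale k01 L1 d0 (ltW n1) kL d2 Ls Ld.
have sd0 : 0 < Num.sqrt d by rewrite sqrtr_gt0.
have k2 : 0 < k ^+ 2 by rewrite exprn_gt0.
have [/forallP gdeg /forallP gcross gu ge] := and4P good.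
have Pp i j : prob_mx B theta i j <= p by rewrite mxE.
have e2 : k ^+ 2 * d ^+ 2 / 4 <= eig2 n B ^+ 2.
  by rewrite dE; exact: (eig2_lower n (ltW p0) k0 kp).
have kd0 : 0 < k ^+ 2 * d ^+ 2 by rewrite mulr_gt0// exprn_gt0.
have nL : n%:R <= L * n%:R by rewrite ler_peMl// ltW.
have [B00 B01] : (0 < B 0 0 <= 1) /\ (0 < B 0 1 <= 1) by have [h _ _] := Bpar; split; apply: h.
have eig1_bd : 0 <= eig1 n B <= d.
  have := Bp 0 0; have := Bp 0 1; rewrite /eig1 dE -mulrA => h1 h2.
  case/andP: B00 => H1 H2; case/andP: B01 => H3 H4.
  by rewrite mulr_ge0 ?ler_pM2l//=; clear -h1 h2 H1 H2 H3 H4; lra.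
have dn : d <= n%:R by rewrite dE ler_piMr// ltW.
have w2 : dotv (unit_ones R n) (noise B theta G *m unit_ones R n) ^+ 2 <= d * Num.sqrt d.
  rewrite (le_trans (dotv_CauchySchwarz _ _))// dotv_unit_ones// mul1r.
  exact: ltW.
have sclose : `|eig1 n B ^+ 2 - clip n (avg_degree R G + x) ^+ 2| <= k ^+ 2 * d ^+ 2 / 32.
  apply: (@sigma_close _ d k _ _ (dotv (unit_ones R n) (noise B theta G *m unit_ones R n))) => //.
  apply: (le_trans (clip_close _ _)).
    by have /andP[-> /le_trans ->] := eig1_bd.
  rewrite (avg_degree_eig G n0 bal B11 B10).
  rewrite (_ : _ + _ - _ = dotv (unit_ones R n) (noise B theta G *m unit_ones R n) + x); last by ring.
  by apply: (le_trans (ler_normD _ _)); rewrite lerD2l.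
pose K := (9 + 32 / k ^+ 2) * (d * Num.sqrt d).
have sd1 : 1 <= Num.sqrt d by apply: le_trans L1 Ls.
have dsd : 1 <= d * Num.sqrt d by rewrite -[1]mulr1 ler_pM.
have rate0 : 0 <= error_rate d D eps by rewrite addr_ge0 ?divr_ge0 ?sqr_ge0 ?ltW.
have tau_bd : rate_const k * error_rate d D eps * (100 * (2 + g)) <= 2.
  apply: (@le_trans _ _ (L * error_rate d D eps)).
    by rewrite (_ : _ * _ = 100 * (2 + g) * rate_const k * error_rate d D eps); [rewrite ler_wpM2r|ring].
  by move: rL; rewrite ler_pdivlMr; [rewrite mulrC|exact: lt_le_trans L1].
have tau0 : 0 <= rate_const k * error_rate d D eps by rewrite mulr_ge0// ltW.
have tau2 : 200 * (rate_const k * error_rate d D eps) <= 2.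
  apply: le_trans tau_bd; rewrite mulrC ler_wpM2l//; clear -g0; lra.
have := @cond_prob_good R n B theta n0 bal Bpar B11 B10 eps D gamma g sol eps0 D0 solP gg
  (le_trans _ g0) G (clip n (avg_degree R G + x)) (k ^+ 2 * d ^+ 2 / 64) (4 / k ^+ 2) K
  (rate_const k * error_rate d D eps) (16 * (2 + g) * rate_const k * error_rate d D eps).
move=> /(_ (lerN10 _)) good_bound.
apply: le_trans (good_bound _ _ _ _ _ _ _ _ _ _ _).
- rewrite lerD2l lerN2 ler_pdivrMr; last first.
    by apply: lt_le_trans (cap_mass_lower reg); exact: expR_gt0.
  have eL : expR L = n%:R := expR_ln_nat n0 LE.
  apply: (@le_trans _ _ (expR (- L) * expR (- (5 * n%:R * L)))); last first.
    rewrite expRN eL ler_wpM2l ?invr_ge0 ?(ltW n1)//; exact: (cap_mass_lower reg).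
  rewrite -expRD ler_expR.
  have K4 : K + 4 <= (13 + 32 / k ^+ 2) * (d * Num.sqrt d) by rewrite /K; clear -dsd; lra.
  have := posterior_exponent reg K4; rewrite opprD addrA.
  have LnL : L <= n%:R * L by rewrite ler_peMl// (le_trans _ L1).
  by move: (inv_temp eps D * _) => X; clear -LnL; lra.
- by move=> i; rewrite (le_trans (ltW (gdeg i))).
- exact: clip_bd.
- move=> v; apply: (@noise_operator_norm _ _ _ _ _ Bpar p Pp G (cross_level n k d)) => //.
  + by rewrite divr_ge0// ltW.
  + exact: mulr_ge0 (divr_ge0 (sqr_ge0 k) (ler0n _ _)) (divr_ge0 (sqr_ge0 d) (ler0n _ _)).
  + by move=> i; rewrite -dE; apply: ltW; exact: gdeg.
  + by move=> i j ij; apply: ltW; have := gcross (i, j); rewrite ij.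
  + rewrite -dE; apply: (noise_norm_budget k01) => //; clear -dn1 dn2 nL n1; lra.
- by clear -e2; lra.
- by apply: (le_trans sclose); clear -e2; lra.
- apply: (@le_trans _ _ (d ^+ 2)).
    by case/andP: eig1_bd => h1 h2; rewrite ler_pXn2r ?nnegrE// ltW.
  by rewrite mulrAC ler_pdivlMr//; clear -e2; lra.
- by apply/negP => /eqP E0; move: e2; rewrite E0 expr0n /=; clear -kd0; lra.
- rewrite /K.
  have k2i : 0 <= 32 / k ^+ 2 by rewrite divr_ge0// ltW.
  have h1 : 9 * dotv (noise B theta G *m community_vec R theta) (noise B theta G *m community_vec R theta) <= 9 * (d * Num.sqrt d) by rewrite ler_pM2l// ltW.
  have h2 : 32 / k ^+ 2 * dotv (noise B theta G *m unit_ones R n) (noise B theta G *m unit_ones R n) <= 32 / k ^+ 2 * (d * Num.sqrt d).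
    by rewrite ler_wpM2l// ltW.
  by clear -h1 h2; lra.
- by rewrite tau0 /=; clear -tau2; lra.
- by clear -tau_bd; lra.
- by rewrite le_eqVlt; apply/orP; left; apply/eqP; ring.
Qed.

Lemma sbm_recovery (R : realType) (n : nat) (B : 'M[R]_2) (theta : {ffun 'I_n -> 'I_2})
    (k g p d L D eps gamma : R) (sol : kmeans_solver R n) :
  regime B theta k g p d L D eps gamma sol ->
  1 - 1 / (n%:R `^ (8^-1)) <= sbm_run_prob B theta (ple_prob eps D sol) (accurate theta (16 * (2 + g) * rate_const k * error_rate d D eps)).
Proof.
move=> reg.
have [[n0 bal Bpar B11 B10] [dE Bp p1 kp k01] [solP gg g0] [LE thr dens Dd Deps]] := reg.
have [p0 L100 nR [d1 Ls D0 eps0 rL]] := regime_facts reg.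
have [kL _ rcL _] := log_threshold_facts k01 g0 thr.
have [k0 k1] := andP k01.
have L1 : 1 <= L by lra.
have [d2 sqd Ld _ _] := density_facts n0 L1 dens.
have d0 : 0 < d by lra.
have n1 : 0 < n%:R :> R by lra.
have [dn1 dn2 dn3 dn4] := density_scale k01 L1 d0 (ltW n1) kL d2 Ls Ld.
have sd0 : 0 < Num.sqrt d by rewrite sqrtr_gt0.
have eL : expR L = n%:R := expR_ln_nat n0 LE.
have Pp i j : prob_mx B theta i j <= p by rewrite mxE.
have ni0 : 0 <= n%:R^-1 :> R by rewrite invr_ge0 ltW.
have ni1 : n%:R^-1 <= 1 :> R by rewrite invf_le1.
have good_out G : good_graph B theta d (cross_level n k d) G -> 1 - 2 / n%:R <= ple_prob eps D sol G (accurate theta (16 * (2 + g) * rate_const k * error_rate d D eps)).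
  move=> good.
  have q0 : 0 <= 1 - n%:R^-1 :> R by rewrite subr_ge0.
  apply: le_trans (ple_prob_ge eps0 D0 solP q0
    (fun x x1 => good_graph_posterior reg good x1)).
  have eeps : expR (- (eps / 2)) <= n%:R^-1.
      rewrite -eL -expRN ler_expR lerN2.
      have : 9 * L <= D ^+ 2 * L.
        rewrite ler_wpM2r ?(le_trans _ L1)// (_ : 9 = 3 ^+ 2); last by ring.
        by rewrite ler_pXn2r ?nnegrE ?(ltW D0)//; clear -Dd d1; lra.
      by move=> h; clear -h Deps L1; lra.
    have : (1 - n%:R^-1) * (1 - n%:R^-1) <= (1 - n%:R^-1) * (1 - expR (- (eps / 2))).
      by rewrite ler_wpM2l ?subr_ge0// lerD2l lerN2.
    have : 0 <= n%:R^-1 * n%:R^-1 :> R by rewrite mulr_ge0.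
    by move=> h1 h2; clear -h1 h2; lra.
have ple0 G : 0 <= ple_prob eps D sol G (accurate theta (16 * (2 + g) * rate_const k * error_rate d D eps)).
  rewrite -[leLHS](mul0r (1 - expR (- (eps / 2)))).
  apply: (ple_prob_ge eps0 D0 solP (lexx 0)) => x _.
  exact: (cond_prob_ge0 eps0 D0 solP).
have pbad : prob B theta (fun G => ~~ good_graph B theta d (cross_level n k d) G) <= 3 / n%:R + 2 / Num.sqrt d.
  (* The minimiser of the exponent 2 t^2 d^2 / n - t s. *)
  have bound := @prob_bad_graph R n B theta p (k ^+ 2 / 800) (cross_level n k d) L n0 Bpar Pp.
  rewrite /= -dE in bound; apply: bound => //.
  - have k21 : k ^+ 2 <= 1 by rewrite exprn_ile1// ltW.
    by apply/andP; split; [exact: divr_ge0 (sqr_ge0 k) (ler0n _ _)|clear -k21; lra].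
  - have h : 4 * L <= L ^+ 2.
      by rewrite expr2; apply: ler_wpM2r; [exact: le_trans ler01 L1|clear -L100; lra].
    by clear -h Ld; lra.
  rewrite /cross_level (_ : _ - _ = - (k ^+ 4 * d ^+ 2 / n%:R / (32 * 10 ^+ 4))); last first.
    by rewrite dE; field; rewrite gt_eqF.
  rewrite lerN2 ler_pdivlMr ?mulr_gt0 ?exprn_gt0// ler_pdivlMr//.
  have h : 0 <= L * n%:R by rewrite mulr_ge0 ?(ltW n1)// (le_trans _ L1).
  by clear -h dn1; lra.
have run : 1 - 2 / n%:R - prob B theta (fun G => ~~ good_graph B theta d (cross_level n k d) G)
    <= sbm_run_prob B theta (ple_prob eps D sol) (accurate theta (16 * (2 + g) * rate_const k * error_rate d D eps)).
  have -> : 1 - 2 / n%:R - prob B theta (fun G => ~~ good_graph B theta d (cross_level n k d) G)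
      = expect B theta (fun G => (1 - 2 / n%:R) + (-1) * (~~ good_graph B theta d (cross_level n k d) G)%:R).
    by rewrite expectD expect_cst expectZ mulN1r.
  apply: expect_le => // G.
  case: (boolP (good_graph B theta d (cross_level n k d) G)) => /= h.
    by rewrite mulr0 addr0 good_out.
  by have h1 := ple0 G; move: (ple_prob _ _ _ _ _) h1 => X h1; clear -h1 ni0; lra.
apply: le_trans run.
(* y = n^(1/8), in terms of which the failure probability is 5 / y^8 + 2 / sqrt d
   with y^2 <= sqrt d. *)
pose y := expR (L / 8).
have yE : n%:R `^ 8^-1 = y by rewrite /y /powR gt_eqF// -LE mulrC.
have y8 : y ^+ 8 = n%:R by rewrite /y -expRM_natl -eL; congr expR; field.
have y13 : 7 <= y by have h := expR_ge1Dx (L / 8); rewrite -/y in h; clear -h L100; lra.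
have y0 : 0 < y by exact: expR_gt0.
have y4 : y ^+ 4 = Num.sqrt n%:R.
  have -> : n%:R = (y ^+ 4) ^+ 2 by rewrite -y8; ring.
  by rewrite sqrtr_sqr ger0_norm// exprn_ge0// ltW.
have ysd : y ^+ 2 <= Num.sqrt d.
  apply: ler_of_sqr; first exact: ltW.
  have -> : (y ^+ 2) ^+ 2 = y ^+ 4 by ring.
  by rewrite y4 sqr_sqrtr// ltW.
rewrite yE.
have h1 : (Num.sqrt d)^-1 <= (y ^+ 2)^-1 by rewrite lef_pV2 ?posrE// exprn_gt0.
have h2 : n%:R^-1 <= (y ^+ 2)^-1.
  by rewrite lef_pV2 ?posrE ?exprn_gt0// -y8 ler_weXn2l// (le_trans _ y13)// ler1n.
have h3 : 7 * (y ^+ 2)^-1 <= 1 / y.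
  rewrite (_ : 1 / y = y * (y ^+ 2)^-1); last by field; rewrite gt_eqF.
  by rewrite ler_wpM2r// invr_ge0 exprn_ge0// ltW.
by clear -h1 h2 h3 pbad; lra.
Qed.

(** * Asymptotics *)
Section Asymptotics.
Variable R : realType.

Lemma near_ln_ge (X : R) : \forall n \near \oo, X <= ln n%:R.
Proof.
apply: filterS (nbhs_infty_ger (expR X)) => n h.
by rewrite -[leLHS]expRK ler_ln// posrE ?expR_gt0// (lt_le_trans (expR_gt0 X)).
Qed.

Lemma is_poly_powR (alpha : R) : 0 < alpha -> is_poly (fun n => n%:R `^ alpha).
Proof.
move=> a0; exists alpha => //.
by split; exists 1 => //; near=> n; rewrite mul1r.
Unshelve. all: by end_near. Qed.

Lemma mx_maxentry_ge (B : 'M[R]_2) i j : B i j <= mx_maxentry B.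
Proof. exact: le_trans (le_bigmax _ (B i) j) (le_bigmax _ _ i). Qed.

Lemma mx_maxentry_le (B : 'M[R]_2) (x : R) : 0 <= x -> (forall i j, B i j <= x) ->
  mx_maxentry B <= x.
Proof. by move=> x0 h; apply: bigmax_le => // i _; apply: bigmax_le => // j _. Qed.

(** Invariant under scaling of the connectivity matrix, hence independent of n. *)
Definition separation (b1 b2 : R) : R := `|b1 - b2| / (`|b1| + `|b2|).

Lemma separation_bd (b1 b2 : R) : b2 < b1 -> 0 < separation b1 b2 <= 1.
Proof.
move=> b12; have h0 : 0 < `|b1 - b2| by rewrite normr_gt0 subr_eq0 gt_eqF.
have S0 : 0 < `|b1| + `|b2| by apply: lt_le_trans h0 (ler_normB _ _).
by rewrite divr_gt0//= ler_pdivrMr// mul1r ler_normB.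
Qed.

Lemma separation_maxentry (B0 : 'M[R]_2) (a : R) :
  B0 0 0 = B0 1 1 -> B0 0 1 = B0 1 0 -> B0 0 1 < B0 0 0 ->
  separation (B0 0 0) (B0 0 1) * mx_maxentry (a *: B0)
    <= `|(a *: B0) 0 0 - (a *: B0) 0 1|.
Proof.
move=> h11 h10 h; have h0 : 0 < `|B0 0 0 - B0 0 1| by rewrite normr_gt0 subr_eq0 gt_eqF.
have S0 : 0 < `|B0 0 0| + `|B0 0 1| by apply: lt_le_trans h0 (ler_normB _ _).
rewrite !mxE -mulrBr normrM /separation mulrAC ler_pdivrMr//.
rewrite mulrC [X in _ <= X]mulrAC ler_wpM2r//.
apply: mx_maxentry_le => [|i j]; first by rewrite mulr_ge0// ltW.
rewrite mxE (le_trans (ler_norm _))// normrM ler_wpM2l//.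
case: (ord2P i) => ->; case: (ord2P j) => ->.
- by rewrite lerDl.
- by rewrite lerDr.
- by rewrite -h10 lerDr.
- by rewrite -h11 lerDl.
Qed.

(** The term D^2 / eps is below 1 / ln n by hypothesis, and 1 / sqrt d is smaller
    than 1 / ln n by the factor n^(-1/4), which is eventually below eta. *)
Lemma error_rate_log (n : nat) (d D eps eta L : R) : (0 < n)%N -> L = ln n%:R ->
  1 <= L -> 0 < eta -> 4 / eta <= L -> Num.sqrt n%:R * L ^+ 2 < d ->
  D ^+ 2 * L < eps -> error_rate d D eps < (1 + eta) / L.
Proof.
move=> n0 LE L1 eta0 Leta dens Deps.
have [_ _ _ _ d1] := density_facts n0 L1 dens.
have eL := expR_ln_nat n0 LE.
have eps0 : 0 < eps.
  by apply: le_lt_trans Deps; apply: mulr_ge0 (sqr_ge0 _) (le_trans ler01 L1).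
have L0 : 0 < L by exact: lt_le_trans L1.
have d0 : 0 < d by exact: lt_le_trans d1.
have sd0 : 0 < Num.sqrt d by rewrite sqrtr_gt0.
(* y = n^(1/4). *)
pose y := expR (L / 4).
have y0 : 0 < y := expR_gt0 _.
have y4 : y ^+ 4 = n%:R by rewrite /y -expRM_natl -eL; congr expR; field.
have yL : eta^-1 <= y.
  have := expR_ge1Dx (L / 4); rewrite -/y => h.
  apply: le_trans h; rewrite -(ler_pM2l (ltr0n R 4)).
  by move: Leta; set z := eta^-1; lra.
have ysn : y ^+ 2 = Num.sqrt n%:R.
  have -> : n%:R = (y ^+ 2) ^+ 2 by rewrite -y4; ring.
  by rewrite sqrtr_sqr ger0_norm// exprn_ge0// ltW.
have yLd : y * L <= Num.sqrt d.
  apply: ler_of_sqr; first exact: ltW.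
  rewrite sqr_sqrtr ?(ltW d0)// (_ : (y * L) ^+ 2 = y ^+ 2 * L ^+ 2); last by ring.
  by rewrite ysn ltW.
have h1 : (Num.sqrt d)^-1 <= eta / L.
  apply: (@le_trans _ _ (y * L)^-1); first by rewrite lef_pV2 ?posrE// mulr_gt0.
  rewrite invfM mulrC [leRHS]mulrC ler_pM2l ?invr_gt0//.
  by rewrite -[leRHS]invrK lef_pV2 ?posrE ?invr_gt0.
have h2 : D ^+ 2 / eps < L^-1.
  by rewrite ltr_pdivrMr// mulrC ltr_pdivlMr.
rewrite /error_rate div1r (_ : (1 + eta) / L = eta / L + L^-1); last by field; rewrite gt_eqF.
exact: ler_ltD.
Qed.

End Asymptotics.

Theorem theorem1 (R : realType) :
  (forall (n : nat) (eps D gamma : R) (sol : kmeans_solver R n),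
     (0 < n)%N -> 0 < eps -> 0 < D -> approx_solver gamma sol ->
     node_DP (2 * eps) 0 (ple_prob eps D sol))
  /\
  (forall (B0 : 'M[R]_2) (a D eps gamma : nat -> R)
     (theta : forall n, {ffun 'I_n -> 'I_2})
     (sol : forall n, kmeans_solver R n),
     let B n := a n *: B0 in
     let d n := n%:R * mx_maxentry (B n) in
     let rate n := 1 / Num.sqrt (d n) + D n ^+ 2 / eps n in
     B0 0 0 = B0 1 1 -> B0 0 1 = B0 1 0 -> B0 0 1 < B0 0 0 ->
     a @ \oo --> (0 : R) ->
     (fun n => d n / n%:R) @ \oo --> (0 : R) ->
     asymp gamma (fun=> 1) ->
     (\forall n \near \oo, ~~ odd n ->
        [/\ balanced R (theta n), sbm_parameter (B n),
            50 * ln n%:R / (n%:R * Num.min (B0 0 0) (B0 1 1)) <= a n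
          & approx_solver (gamma n) (sol n)] /\
        [/\ 3 * d n <= D n <= n%:R,
            Num.sqrt n%:R * ln n%:R ^+ 2 < d n
          & D n ^+ 2 * ln n%:R < eps n < n%:R * D n ^+ 2]) ->
     (exists (c : R) (p : nat -> R),
        [/\ 0 < c, is_poly p
          & \forall n \near \oo, ~~ odd n ->
              1 - 1 / p n <=
              sbm_run_prob (B n) (theta n) (ple_prob (eps n) (D n) (sol n))
                [set t | loss R t (theta n) <= c * rate n]%SET])
     /\ (forall eta : R, 0 < eta ->
           \forall n \near \oo, ~~ odd n -> rate n < (1 + eta) / ln n%:R)).
Proof.
split=> [n eps D gamma sol n0 eps0 D0 solP|]; first exact: ple_prob_DP n0 eps0 D0 solP.
move=> B0 a D eps gamma theta sol B d rate h11 h10 gap _ _ [[g g0 gamma_le] _] hyp.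
set k := separation (B0 0 0) (B0 0 1).
have k01 : 0 < k <= 1 := separation_bd gap.
have [rc0 _] := rate_const_bound k01.
split.
  exists (16 * (2 + g) * rate_const k), (fun n => n%:R `^ 8^-1); split.
  - by rewrite mulr_gt0// mulr_gt0// addr_gt0.
  - exact: is_poly_powR.
  apply: filterS (filterI (filterI hyp gamma_le)
    (filterI (near_ln_ge (log_threshold k g)) (nbhs_infty_gt 0))) => n.
  move=> [[+ gn] [thr n0]] even_n.
  move=> /(_ even_n) [[bal Bpar _ solP] [/andP[Dd _] dens /andP[Deps _]]].
  have Bentry : forall i j, B n i j <= 1 by move=> i j; have [/(_ i j)/andP[]] := Bpar.
  apply: (@sbm_recovery R n (B n) (theta n) k g (mx_maxentry (B n)) (d n) (ln n%:R)
    (D n) (eps n) (gamma n) (sol n)).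
  split; split => //.
  - by rewrite !mxE h11.
  - by rewrite !mxE h10.
  - exact: mx_maxentry_ge.
  - exact: mx_maxentry_le.
  - exact: separation_maxentry.
  - by move: gn; rewrite mulr1.
  - exact: ltW.
move=> eta eta0.
apply: filterS (filterI (filterI hyp (near_ln_ge (4 / eta)))
  (filterI (near_ln_ge (1 : R)) (nbhs_infty_gt 0))) => n [[+ h4] [h1 n0]] even_n.
move=> /(_ even_n) [_ [_ dens /andP[Deps _]]].
exact: (error_rate_log n0 erefl h1 eta0 h4 dens Deps).

Qed.
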